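(* Let $\nu>0$, let $f_0\in L^2(\mathbb{T}^2)$ have zero mean, and let $\Delta_\perp:=\partial_2^2+\partial_3^2$, $\nabla_\perp:=(0,\partial_2,\partial_3)$. The field $$u(t,x)=\bigl(e^{\nu t\Delta_\perp}f_0(x_2,x_3),\,0,\,0\bigr)$$ is a global smooth solution of the incompressible Navier--Stokes equations on $\mathbb{T}^3$ for $t>0$ (with $(u\cdot\nabla)u=0$). Its mean displacement $\ell$ and mean deformation $M$ (defined in the context) are $$\ell(t)=-t\,u(t),\qquad M(t)=I-t\,e_1\otimes\nabla_\perp e^{\nu t\Delta_\perp}f_0,$$ and for every $0<\alpha<1$ and $\tau>0$, $$\sup_{t\ge\tau}\|M(t)-I\|_{C^\alpha}\le C_\alpha\,\nu^{-1-\alpha/2}\,\tau^{-\alpha/2}\,\|f_0\|_{L^2(\mathbb{T}^2)},$$ where $C_\alpha$ depends only on $\alpha$.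
   Context: $\mathbb{T}^d=\mathbb{R}^d/\mathbb{Z}^d$. The Navier--Stokes equations are $\partial_tu+(u\cdot\nabla)u-\nu\Delta u+\nabla p=0$, $\operatorname{div}u=0$. For a solution $u$, the stochastic flow is $\mathrm{d}X_t(a)=u(t,X_t(a))\,\mathrm{d}t+\sqrt{2\nu}\,\mathrm{d}W_t$, $X_0(a)=a$, with a single 3-dimensional Brownian motion $W$ common to all labels $a$, and $A_t:=X_t^{-1}$, lifted equivariantly to $\mathbb{R}^3$ (solve the SDE on $\mathbb{R}^3$ with periodic drift). The periodic mean displacement is $\ell(t,x):=\mathbb{E}[A_t(x)-x]$; it satisfies $\partial_t\ell+u\cdot\nabla\ell-\nu\Delta\ell=-u$, $\ell(0)=0$. The mean deformation is $M:=I+\nabla\ell$ (equal to $\mathbb{E}\nabla A_t$ in the smooth setting), with $(\nabla v)_{ij}=\partial_jv_i$. $e_1\otimes w$ is the matrix with entries $(e_1)_iw_j$. $\|\cdot\|_{C^\alpha}$ is the sup norm plus the $\alpha$-Hölder seminorm. *)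

(* Defs.v *)
From HB Require Import structures.
From mathcomp Require Import all_boot all_order all_algebra.
From mathcomp Require Import all_classical all_reals all_analysis.

Set Implicit Arguments.
Unset Strict Implicit.
Unset Printing Implicit Defensive.

Import Order.TTheory GRing.Theory Num.Theory.
Import numFieldNormedType.Exports.

Local Open Scope classical_set_scope.
Local Open Scope ring_scope.

(** Functions on the torus R^n/Z^n are functions on R^n that are 1-periodic in
    each coordinate.  The coordinates x_1, x_2, x_3 of x : 'rV[R]_3 are
    x 0 0, x 0 1, x 0 2. *)

(** The Haar measure of R/Z, carried by the fundamental domain [0, 1]. *)
Definition circle_measure (R : realType) := uniform_prob (@ltr01 R).
Arguments circle_measure R : clear implicits.

Definition torus2_measure (R : realType) :=
  (circle_measure R \x circle_measure R)%E.
Arguments torus2_measure R : clear implicits.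

Definition periodic2 (R : realType) (f : R * R -> R) : Prop :=
  forall y, f (y.1 + 1, y.2) = f y /\ f (y.1, y.2 + 1) = f y.

Definition periodic3 (R : realType) (W : Type) (v : 'rV[R]_3 -> W) : Prop :=
  forall x (j : 'I_3), v (x + delta_mx 0 j) = v x.

Definition L2_norm2 (R : realType) (f : R * R -> R) : R :=
  fine ('N[torus2_measure R]_2%:E[EFin \o f])%E.

Definition torus2_phase (R : realType) (k : int * int) (y : R * R) : R :=
  2 * pi * (k.1%:~R * y.1 + k.2%:~R * y.2).

(** The real part of e^{-4 pi^2 |k|^2 s} \hat f(k) e^{2 i pi k.y}; since f is
    real, the imaginary parts of the modes k and -k cancel. *)
Definition heat_mode (R : realType) (s : R) (f : R * R -> R) (k : int * int)
    (y : R * R) : R :=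
  expR (- (4 * pi ^+ 2 * (k.1%:~R ^+ 2 + k.2%:~R ^+ 2) * s)) *
  ((\int[torus2_measure R]_z (f z * cos (torus2_phase k z)))
     * cos (torus2_phase k y) +
   (\int[torus2_measure R]_z (f z * sin (torus2_phase k z)))
     * sin (torus2_phase k y)).

(** e^{s Delta} f, as the limit over n of the sums over the squares
    -n <= k_1, k_2 <= n.  For s > 0 and f in L^2 the Fourier series converges
    absolutely.  At s = 0 the pointwise limit need not exist: the definition is
    meaningful for s > 0 only. *)
Definition heat (R : realType) (s : R) (f : R * R -> R) (y : R * R) : R :=
  limn (fun n : nat =>
    \sum_(i < n.*2.+1) \sum_(j < n.*2.+1)
      heat_mode s f (i%:Z - n%:Z, j%:Z - n%:Z) y).

Definition partial (R : realType) (j : 'I_3) (f : 'rV[R]_3 -> R)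
    (x : 'rV[R]_3) : R :=
  'D_(delta_mx 0 j) f x.

Definition grad (R : realType) (v : 'rV[R]_3 -> 'rV[R]_3) (x : 'rV[R]_3)
    : 'M[R]_3 :=
  \matrix_(i, j) partial j (fun y => v y 0 i) x.

Definition grad_perp (R : realType) (f : 'rV[R]_3 -> R) (x : 'rV[R]_3)
    : 'rV[R]_3 :=
  \row_j (if j == 0 then 0 else partial j f x).

Definition divergence (R : realType) (v : 'rV[R]_3 -> 'rV[R]_3)
    (x : 'rV[R]_3) : R :=
  \sum_j partial j (fun y => v y 0 j) x.

Definition laplacian (R : realType) (f : 'rV[R]_3 -> R) (x : 'rV[R]_3) : R :=
  \sum_j partial j (partial j f) x.

Definition advection (R : realType) (u v : 'rV[R]_3 -> 'rV[R]_3)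
    (x : 'rV[R]_3) : 'rV[R]_3 :=
  \row_i \sum_j u x 0 j * partial j (fun y => v y 0 i) x.

Definition tensor (R : realType) (v w : 'rV[R]_3) : 'M[R]_3 :=
  \matrix_(i, j) (v 0 i * w 0 j).

Fixpoint Ck_on (R : realType) (V W : normedModType R) (k : nat) (D : set V)
    (f : V -> W) : Prop :=
  match k with
  | 0%N => forall x, D x -> {for x, continuous f}
  | k'.+1 => (forall x, D x -> differentiable f x) /\
             (forall v, Ck_on k' D (fun x => 'D_v f x))
  end.

(** Meant for open D, as the derivatives are two-sided. *)
Definition smooth_on (R : realType) (V W : normedModType R) (D : set V)
    (f : V -> W) : Prop :=
  forall k, Ck_on k D f.

Definition positive_times (R : realType) : set (R^o * 'rV[R]_3) :=
  [set z | 0 < z.1].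

(** Smooth solution on (0, +oo) x T^3, jointly in time and space. *)
Definition smooth_navier_stokes (R : realType) (nu : R)
    (u : R -> 'rV[R]_3 -> 'rV[R]_3) : Prop :=
  [/\ smooth_on (@positive_times R) (fun z => u z.1 z.2),
      forall t : R, 0 < t -> periodic3 (u t),
      forall (t : R) x, 0 < t -> divergence (u t) x = 0 &
      exists p : R -> 'rV[R]_3 -> R,
        [/\ smooth_on (@positive_times R) (fun z => p z.1 z.2 : R^o),
            forall t : R, 0 < t -> periodic3 (p t) &
            forall (t : R) x (i : 'I_3), 0 < t ->
              derive1 (fun s => u s x 0 i) t + advection (u t) (u t) x 0 i
                - nu * laplacian (fun y => u t y 0 i) x + partial i (p t) x
              = 0]].

(** As B i = setT is allowed, the product rule over all of I gives the product
    rule over every subfamily. *)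
Definition independent_family (R : realType) d (T : measurableType d)
    (P : probability T R) (I : finType) (X : I -> T -> R) : Prop :=
  forall B : I -> set R, (forall i, measurable (B i)) ->
    P (\bigcap_i (X i @^-1` B i)) = (\prod_i P (X i @^-1` B i))%E.

Definition increment (R : realType) (T : Type) (W : R -> T -> 'rV[R]_3)
    (s t : R) (i : 'I_3) (w : T) : R :=
  W t w 0 i - W s w 0 i.

(** Standard three-dimensional Brownian motion; only the times t >= 0 matter.
    The second parameter of normal_prob is the standard deviation. *)
Definition brownian_motion (R : realType) d (T : measurableType d)
    (P : probability T R) (W : R -> T -> 'rV[R]_3) : Prop :=
  [/\ forall (t : R) i, 0 <= t -> measurable_fun [set: T] (fun w => W t w 0 i),
      {ae P, forall w, W 0 w = 0},
      {ae P, forall w,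
         {within `[0, +oo[%classic, continuous (fun t : R => W t w)}},
      forall (s t : R) i (B : set R), 0 <= s -> s < t -> measurable B ->
        P (increment W s t i @^-1` B) = normal_prob 0 (Num.sqrt (t - s)) B &
      forall (n : nat) (t : nat -> R), 0 <= t 0%N ->
        (forall k, t k < t k.+1) ->
        independent_family P (fun ki : 'I_n * 'I_3 =>
          increment W (t ki.1) (t ki.1.+1) ki.2)].

(** X t a w is the position at time t >= 0, on the event w, of the particle
    with label a.  The noise is additive, so dX = u dt + sqrt (2 nu) dW means
    the pathwise integral equation, almost surely for all labels and times. *)
Definition stochastic_flow (R : realType) d (T : measurableType d)
    (P : probability T R) (nu : R) (W : R -> T -> 'rV[R]_3)
    (u : R -> 'rV[R]_3 -> 'rV[R]_3) (X : R -> 'rV[R]_3 -> T -> 'rV[R]_3)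
    : Prop :=
  (forall (t : R) a i, 0 <= t -> measurable_fun [set: T] (fun w => X t a w 0 i)) /\
  {ae P, forall w, forall a, X 0 a w = a /\
    forall (t : R) i, 0 <= t ->
      lebesgue_measure.-integrable `[0, t]
        (fun s => (u s (X s a w) 0 i)%:E) /\
      X t a w 0 i = a 0 i
        + \int[lebesgue_measure]_(s in `[0, t]) u s (X s a w) 0 i
        + Num.sqrt (2 * nu) * W t w 0 i}.

Definition inverse_flow (R : realType) d (T : measurableType d)
    (P : probability T R) (X A : R -> 'rV[R]_3 -> T -> 'rV[R]_3) : Prop :=
  (forall (t : R) x i, 0 <= t -> measurable_fun [set: T] (fun w => A t x w 0 i)) /\
  {ae P, forall w, forall t : R, 0 <= t ->
    cancel (fun a => X t a w) (fun x => A t x w) /\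
    cancel (fun x => A t x w) (fun a => X t a w)}.

Definition displacement (R : realType) (T : Type)
    (A : R -> 'rV[R]_3 -> T -> 'rV[R]_3) (t : R) (x : 'rV[R]_3) (i : 'I_3)
    (w : T) : R :=
  (A t x w - x) 0 i.

Definition mean_displacement (R : realType) d (T : measurableType d)
    (P : probability T R) (A : R -> 'rV[R]_3 -> T -> 'rV[R]_3) (t : R)
    (x : 'rV[R]_3) : 'rV[R]_3 :=
  \row_i fine ('E_P[displacement A t x i])%E.

Definition mean_deformation (R : realType) d (T : measurableType d)
    (P : probability T R) (A : R -> 'rV[R]_3 -> T -> 'rV[R]_3) (t : R)
    (x : 'rV[R]_3) : 'M[R]_3 :=
  1%:M + grad (mean_displacement P A t) x.

(** Sup norm plus alpha-Hoelder seminorm of a periodic matrix field, with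
    values in [0, +oo].  For a periodic field, the seminorm over R^3 is the
    one for the quotient distance of the torus. *)
Definition holder_norm (R : realType) (alpha : R) (F : 'rV[R]_3 -> 'M[R]_3)
    : \bar R :=
  (ereal_sup [set (`|F x|)%:E | x in [set: 'rV[R]_3]] +
   ereal_sup [set (`|F z.1 - F z.2| / `|z.1 - z.2| `^ alpha)%:E
             | z in [set z : 'rV[R]_3 * 'rV[R]_3 | z.1 != z.2]])%E.

Definition shear_profile (R : realType) (nu : R) (f0 : R * R -> R) (t : R)
    (x : 'rV[R]_3) : R :=
  heat (nu * t) f0 (x 0 1, x 0 2).

Definition e1 (R : realType) : 'rV[R]_3 := delta_mx 0 0.

Definition shear_flow (R : realType) (nu : R) (f0 : R * R -> R) (t : R)
    (x : 'rV[R]_3) : 'rV[R]_3 :=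
  shear_profile nu f0 t x *: e1 R.

(* Main.v *)
(** Only the noise moves the transverse coordinates of the flow, and the drift
    is parallel to e_1 and independent of x_1, so the back-to-labels map is
    explicit: with phi the shear profile,
    A_t(x) - x = - sqrt (2 nu) W_t - e_1 int_0^t phi(s, x - sqrt (2 nu) (W_t - W_s)) ds.
    Averaging a Fourier mode over the Gaussian increment W_t - W_s is the heat
    semigroup at time t - s, so every integrand has mean phi(t, x), whence
    l(t) = - t u(t).  The time integral is handled as a limit of Riemann sums,
    which are bounded because |phi(s, .)| = O(s^{-1/2}) by Bessel and
    Cauchy-Schwarz on Fourier series; the same two inequalities give the
    Hoelder bound, with a constant uniform in alpha. *)

Require Import Defs.
From HB Require Import structures.
From mathcomp Require Import all_boot all_order all_algebra.
From mathcomp Require Import all_classical all_reals all_analysis.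
From mathcomp Require Import measurable_realfun.
From mathcomp Require Import lra ring.

Set Implicit Arguments.
Unset Strict Implicit.
Unset Printing Implicit Defensive.

Import Order.TTheory GRing.Theory Num.Theory.
Import numFieldNormedType.Exports.

Local Open Scope classical_set_scope.
Local Open Scope ring_scope.

(** * Sums over squares of lattice points *)

(** Expectation and time integral are not exchanged by Fubini: [brownian_motion] gives measurability
    at each fixed time and continuity only almost surely, so joint measurability in time and event
    is not at hand. A Riemann sum is a finite sum of random variables whose means are known exactly;
    a limit in time along each path, followed by a limit of expectations, replaces the exchange.

    All series are kept real: a series is given by two families of coefficients, for cosines and for
    sines, and a space-time derivative only changes these families. Smoothness is then an induction
    over coefficients of polynomial growth.

    The exponent of the Hoelder bound is a count of powers. On Z^2 the weight |k|^(1 + alpha) e^(-4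
    pi^2 nu t |k|^2) has l^2 norm of order (nu t)^(-1 - alpha/2): (1 + alpha)/2 comes from the
    weight and 1/2 from summing squares in dimension 2. The factor t in l = -t u turns this into
    nu^(-1 - alpha/2) t^(-alpha/2). The zero mean serves to bound phi itself, whose mode k = 0 would
    not decay. *)

Section SquareSums.
Variable R : realType.
Implicit Types (T U : int * int -> R) (k : int * int).

(** Indexed like the partial sums in [heat], so that the profile becomes a [square_series] term by
    term. *)
Definition square_sum T (n : nat) : R :=
  \sum_(i < n.*2.+1) \sum_(j < n.*2.+1) T (i%:Z - n%:Z, j%:Z - n%:Z).

Definition square_series T : R := limn (square_sum T).

(** Absolute summability as a uniform bound: square sums of nonnegative terms are nondecreasing, and
    bounds are easier to add and compare than limits. *)
Definition square_summable T : Prop :=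
  exists M, forall n, square_sum (fun k => `|T k|) n <= M.

Lemma eq_square_sum T U : T =1 U -> square_sum T =1 square_sum U.
Proof. by move=> TU n; do 2 apply: eq_bigr => ? _; rewrite TU. Qed.

Lemma square_sumD T U n :
  square_sum (fun k => T k + U k) n = square_sum T n + square_sum U n.
Proof.
by rewrite /square_sum -big_split/=; apply: eq_bigr => i _; rewrite -big_split.
Qed.

Lemma square_sumZ c T n :
  square_sum (fun k => c * T k) n = c * square_sum T n.
Proof.
by rewrite /square_sum mulr_sumr; apply: eq_bigr => i _; rewrite mulr_sumr.
Qed.

Lemma ler_square_sum T U n :
  (forall k, T k <= U k) -> square_sum T n <= square_sum U n.
Proof. by move=> TU; do 2 apply: ler_sum => ? _; exact: TU. Qed.

Lemma square_sum_ge0 T n : (forall k, 0 <= T k) -> 0 <= square_sum T n.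
Proof. by move=> T0; do 2 apply: sumr_ge0 => ? _. Qed.

Lemma ler_norm_square_sum T n :
  `|square_sum T n| <= square_sum (fun k => `|T k|) n.
Proof.
apply: (le_trans (ler_norm_sum _ _ _)); apply: ler_sum => i _.
exact: ler_norm_sum.
Qed.

Lemma square_sum_prod (a b : int -> R) n :
  square_sum (fun k => a k.1 * b k.2) n =
  (\sum_(i < n.*2.+1) a (i%:Z - n%:Z)) * (\sum_(i < n.*2.+1) b (i%:Z - n%:Z)).
Proof.
rewrite mulr_suml; apply: eq_bigr => i _; rewrite mulr_sumr.
exact: eq_bigr.
Qed.

Lemma centered_sumS (V : nmodType) (a : int -> V) n :
  \sum_(i < n.+1.*2.+1) a (i%:Z - n.+1%:Z) =
  (a (- n.+1%:Z) + \sum_(i < n.*2.+1) a (i%:Z - n%:Z) + a n.+1%:Z)%R.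
Proof.
rewrite doubleS big_ord_recl big_ord_recr/= addrA; congr (_ + _ + _).
- by rewrite sub0r.
- apply: eq_bigr => i _; congr (a _).
  by rewrite /bump/= -addn1 -[n.+1]addn1 !PoszD; ring.
- by congr (a _); rewrite /bump/= -addnn -2![_.+1]addn1 !PoszD; ring.
Qed.

Lemma square_sum_nondecreasing T : (forall k, 0 <= T k) ->
  nondecreasing_seq (square_sum T).
Proof.
move=> T0; apply/nondecreasing_seqP => n.
pose r (N : nat) (m : int) := \sum_(j < N.*2.+1) T (m, j%:Z - N%:Z).
rewrite -[leRHS]/(\sum_(i < n.+1.*2.+1) r n.+1 (i%:Z - n.+1%:Z)).
have r0 m : 0 <= r n.+1 m by exact: sumr_ge0.
rewrite centered_sumS; apply: ler_wpDr => //; apply: ler_wpDl => //.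
apply: ler_sum => i _.
rewrite /r (centered_sumS (fun j => T (_, j))).
by apply: ler_wpDr => //; exact: ler_wpDl.
Qed.

(** T is the difference of [|T| + T] and [|T|], whose square sums are nondecreasing and bounded. *)
Lemma square_summable_cvg T : square_summable T -> cvgn (square_sum T).
Proof.
have pos U : (forall k, 0 <= U k) -> (exists M, forall n, square_sum U n <= M) ->
    cvgn (square_sum U).
  move=> U0 [M UM]; apply: nondecreasing_is_cvgn.
    exact: square_sum_nondecreasing.
  by exists M => _ [n _ <-].
move=> [M TM].
have -> : square_sum T = (square_sum (fun k => `|T k| + T k) -
                          square_sum (fun k => `|T k|)).
  by apply/funext => n; rewrite !fctE square_sumD addrAC subrr add0r.
apply: is_cvgB; apply: pos => //; last by exists M.
  by move=> k; have := ler_norm (- T k); rewrite normrN; lra.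
exists (2 * M) => n; rewrite square_sumD.
have := ler_norm_square_sum T n; have := TM n.
by move: (ler_norm (square_sum T n)); lra.
Qed.

Lemma square_summable_le T U :
  (forall k, `|T k| <= U k) -> square_summable U -> square_summable T.
Proof.
move=> TU [M UM]; exists M => n; apply: le_trans (UM n).
by apply: ler_square_sum => k; apply: le_trans (TU k) (ler_norm _).
Qed.

Lemma square_summableD T U : square_summable T -> square_summable U ->
  square_summable (fun k => T k + U k).
Proof.
move=> [M TM] [N UN]; exists (M + N) => n.
apply: le_trans (lerD (TM n) (UN n)); rewrite -square_sumD.
by apply: ler_square_sum => k; exact: ler_normD.
Qed.

Lemma square_summableZ c T : square_summable T ->
  square_summable (fun k => c * T k).
Proof.
move=> [M TM]; exists (`|c| * M) => n.
rewrite (eq_square_sum (U := fun k => `|c| * `|T k|)); last first.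
  by move=> k; rewrite normrM.
by rewrite square_sumZ ler_wpM2l.
Qed.

Lemma square_seriesD T U : square_summable T -> square_summable U ->
  square_series (fun k => T k + U k) = square_series T + square_series U.
Proof.
move=> /square_summable_cvg Tc /square_summable_cvg Uc.
rewrite /square_series -limD//; congr (limn _).
by apply/funext => n; rewrite square_sumD.
Qed.

Lemma square_seriesZ c T : square_summable T ->
  square_series (fun k => c * T k) = c * square_series T.
Proof.
move=> /square_summable_cvg Tc; apply/cvg_lim => //.
rewrite (_ : square_sum _ = fun n => c * square_sum T n); last first.
  by apply/funext => n; rewrite square_sumZ.
exact: cvgMr.
Qed.

Lemma square_series_bound T M : square_summable T ->
  (forall n, `|square_sum T n| <= M) -> `|square_series T| <= M.
Proof.
move=> /square_summable_cvg Tc TM; rewrite /square_series.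
have /cvg_lim <- // : (fun n => `|square_sum T n|) @ \oo --> `|limn (square_sum T)|.
  exact: cvg_norm.
apply: limr_le; last by apply: nearW.
by apply: is_cvg_norm.
Qed.

End SquareSums.

(** * Gaussian sums over the lattice Z^2 *)

Section LatticeSums.
Variable R : realType.

Definition sqnorm (k : int * int) : R := k.1%:~R ^+ 2 + k.2%:~R ^+ 2.

Lemma sqnorm_ge0 k : 0 <= sqnorm k.
Proof. by rewrite addr_ge0 ?sqr_ge0. Qed.

Lemma sqnorm_ge1 k : k != (0, 0) -> 1 <= sqnorm k.
Proof.
have sq1 (m : int) : m != 0 -> 1 <= m%:~R ^+ 2 :> R.
  move=> m0; rewrite -rmorphXn/= -[1]/(1%:~R) ler_int.
  by rewrite -gtz0_ge1 lt0r sqrf_eq0 m0 sqr_ge0.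
case: k => a b; rewrite xpair_eqE negb_and /sqnorm/= => /orP[/sq1|/sq1] h.
  by rewrite ler_wpDr ?sqr_ge0.
by rewrite ler_wpDl ?sqr_ge0.
Qed.

(** The two new terms at -(n+1) and n+1 are at most [4 / (1 + a (n+1))^2], which is below the
    telescoping difference [4 / ((1 + a n) (1 + a (n+1)))]. The negative remainder is kept so that
    the induction closes. *)
Lemma centered_sum_telescope (a : R) (g : int -> R) n : 0 < a ->
  g 0 <= 1 ->
  (forall m, g m <= 2 / (1 + a * `|m|%:R) ^+ 2) ->
  \sum_(i < n.*2.+1) g (i%:Z - n%:Z) <= 1 + 4 / a * (1 - (1 + a * n%:R)^-1).
Proof.
move=> a0 g0 gm.
have pos (m : nat) : 0 < 1 + a * m%:R by rewrite ltr_wpDr// mulr_ge0// ltW.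
elim: n => [|n IHn]; first by rewrite big_ord1 subrr mulr0 addr0 invr1 subrr mulr0 addr0.
rewrite centered_sumS.
have h1 := gm (- n.+1%:Z); have h2 := gm n.+1%:Z; rewrite abszN in h1.
rewrite /= in h1 h2.
suff : 4 / (1 + a * n.+1%:R) ^+ 2 <=
    4 / a * ((1 + a * n%:R)^-1 - (1 + a * n.+1%:R)^-1).
  set u := (_ ^+ 2)^-1 in h1 h2 *; set v := (1 + a * n%:R)^-1 in IHn *.
  set w := (1 + a * n.+1%:R)^-1.
  rewrite -!mulrA mulrBr; set z := a^-1 in IHn *.
  move: IHn h1 h2; rewrite !mulrBr -!mulrA !mulr1.
  set s := \sum_(_ < _) _; set zv := z * v; set zw := z * w; lra.
have -> : 4 / a * ((1 + a * n%:R)^-1 - (1 + a * n.+1%:R)^-1) =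
    4 / ((1 + a * n%:R) * (1 + a * n.+1%:R)).
  have := pos n; have := pos n.+1; rewrite -natr1 => /lt0r_neq0 h3 /lt0r_neq0 h4.
  by field; rewrite h3 h4 lt0r_neq0.
rewrite ler_pM2l// lef_pV2 ?posrE ?mulr_gt0 ?exprn_gt0// expr2 ler_pM2r//.
by rewrite lerD2l ler_pM2l// ler_nat.
Qed.

Lemma centered_sum_le (a : R) (g : int -> R) n : 0 < a -> g 0 <= 1 ->
  (forall m, g m <= 2 / (1 + a * `|m|%:R) ^+ 2) ->
  \sum_(i < n.*2.+1) g (i%:Z - n%:Z) <= 1 + 4 / a.
Proof.
move=> a0 g0 gm; apply: le_trans (centered_sum_telescope n a0 g0 gm) _.
rewrite lerD2l ler_piMr//; first by rewrite divr_ge0 ?ltW.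
rewrite gerBl invr_ge0.
by rewrite addr_ge0// mulr_ge0// ltW.
Qed.

(** This is [(1 + y)^2 <= 2 (1 + y^2)] with [y = b |m|], in the form that telescopes. *)
Lemma inv_sq_le (b : R) (m : int) : 0 <= b ->
  (1 + b ^+ 2 * m%:~R ^+ 2)^-1 <= 2 / (1 + b * `|m|%:R) ^+ 2.
Proof.
move=> b0; have -> : m%:~R ^+ 2 = `|m|%:R ^+ 2 :> R.
  by rewrite natr_absz intr_norm real_normK ?num_real.
set x := (`|m|%:R : R); have x0 : 0 <= x by [].
have bx : 0 <= b * x by rewrite mulr_ge0.
rewrite -exprMn; set y := b * x in bx *.
rewrite -[leLHS]mul1r ler_pdivrMr ?ltr_wpDr ?sqr_ge0// mulrAC.
rewrite ler_pdivlMr ?exprn_gt0 ?ltr_wpDr// mul1r.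
by have := sqr_ge0 (1 - y); nra.
Qed.

Lemma inv_expR_le (x : R) : 0 <= x -> expR (- x) <= (1 + x)^-1.
Proof.
move=> x0; rewrite expRN lef_pV2 ?posrE ?expR_gt0//; last by lra.
exact: expR_ge1Dx.
Qed.

(** The exponential factors over the two coordinates, and [exp (-x) <= 1 / (1 + x)] reduces each
    factor to [centered_sum_le]. The dependence on b is explicit because b will be proportional to
    time. *)
Lemma square_sum_gauss (b : R) n : 0 < b ->
  square_sum (fun k => expR (- (b * sqnorm k))) n <= (1 + 4 / Num.sqrt b) ^+ 2.
Proof.
move=> b0; rewrite (eq_square_sum (U := fun k =>
    expR (- (b * k.1%:~R ^+ 2)) * expR (- (b * k.2%:~R ^+ 2)))); last first.
  by move=> k; rewrite -expRD mulrDr opprD.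
pose g (m : int) := expR (- (b * m%:~R ^+ 2)).
rewrite (square_sum_prod g g) -expr2.
have sb : 0 < Num.sqrt b by rewrite sqrtr_gt0.
rewrite ler_pXn2r ?nnegrE; [|by []|..]; last 2 first.
- by apply: sumr_ge0 => i _; exact: expR_ge0.
- by rewrite addr_ge0// divr_ge0// ltW.
apply: centered_sum_le => //.
  by rewrite /g expr0n/= mulr0 oppr0 expR0.
move=> m; apply: (le_trans (inv_expR_le _)).
  by rewrite mulr_ge0 ?sqr_ge0 ?ltW.
rewrite -{1}(sqr_sqrtr (ltW b0)); apply: inv_sq_le; exact: ltW.
Qed.

(** Since |k| >= 1 off the origin, half of the exponent yields a factor [exp (-a/2)]; the other half
    is summed and gives at most [2 + 64 / a]. As [exp (-a/2)] is at most both 1 and [2 / a], the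
    total is [4 / a + 64 / a]. *)
Lemma square_sum_gauss_nz (a : R) n : 0 < a ->
  square_sum (fun k => (k != (0, 0))%:R * expR (- (a * sqnorm k))) n <= 68 / a.
Proof.
move=> a0; have a20 : 0 < a / 2 by lra.
apply: (@le_trans _ _ (expR (- (a / 2)) * (1 + 4 / Num.sqrt (a / 2)) ^+ 2)).
  apply: le_trans (ler_wpM2l (expR_ge0 _) (square_sum_gauss n a20)).
  rewrite -square_sumZ; apply: ler_square_sum => k.
  have [->|k0] := eqVneq k (0, 0); first by rewrite mul0r mulr_ge0 ?expR_ge0.
  rewrite mul1r -expRD ler_expR; have := sqnorm_ge1 k0; nra.
set s := Num.sqrt (a / 2); have s0 : 0 < s by rewrite sqrtr_gt0.
have s2 : s ^+ 2 = a / 2 by rewrite sqr_sqrtr// ltW.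
have h1 : (1 + 4 / s) ^+ 2 <= 2 + 64 / a.
  have -> : 64 / a = 2 * (4 / s) ^+ 2.
    by rewrite expr_div_n s2; field; rewrite lt0r_neq0.
  by have := sqr_ge0 (1 - 4 / s); nra.
have h2 : expR (- (a / 2)) <= 2 / a.
  apply: (le_trans (inv_expR_le (ltW a20))).
  have -> : 2 / a = (a / 2)^-1 by rewrite invf_div.
  by rewrite lef_pV2 ?posrE; lra.
have h3 : expR (- (a / 2)) <= 1 by rewrite -[leRHS]expR0 ler_expR; lra.
have h4 : 0 < a^-1 by rewrite invr_gt0.
have := expR_ge0 (- (a / 2)); nra.
Qed.

(* [x = N * (x / N)] and [1 + u <= expR u] *)
Lemma exprn_le_expR (x : R) (N : nat) : 0 <= x -> (0 < N)%N ->
  x ^+ N <= N%:R ^+ N * expR x.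
Proof.
move=> x0 N0; have NR0 : 0 < N%:R :> R by rewrite ltr0n.
have -> : expR x = expR (x / N%:R) ^+ N.
  by rewrite -expRM_natl mulrC divfK// lt0r_neq0.
rewrite -exprMn ler_pXn2r ?nnegrE ?mulr_ge0 ?expR_ge0//.
rewrite -ler_pdivrMl// mulrC; apply: le_trans (expR_ge1Dx _); lra.
Qed.

(** With [w = 1 + |k|^2], [exprn_le_expR] at [x = a w] and [N = m + 2] leaves two spare powers of w,
    and [w^2] dominates the product of the two one-dimensional weights. The factor [expR a] in the
    constant pays for the 1 in w. *)
Lemma poly_gauss_le (a : R) (m : nat) : 0 < a ->
  exists2 M, 0 <= M & forall k, (1 + sqnorm k) ^+ m * expR (- (a * sqnorm k))
    <= M * ((1 + k.1%:~R ^+ 2)^-1 * (1 + k.2%:~R ^+ 2)^-1).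
Proof.
move=> a0; exists (m.+2%:R ^+ m.+2 * expR a / a ^+ m.+2).
  by apply: divr_ge0; [apply: mulr_ge0; rewrite ?exprn_ge0 ?expR_ge0|rewrite exprn_ge0// ltW].
move=> k; set w := 1 + sqnorm k.
have w1 : 1 <= w by rewrite lerDl sqnorm_ge0.
have w0 : 0 < w by lra.
have h1 : w ^+ 2 >= (1 + k.1%:~R ^+ 2) * (1 + k.2%:~R ^+ 2).
  rewrite /w /sqnorm; have := sqr_ge0 (k.1%:~R : R); have := sqr_ge0 (k.2%:~R : R).
  set u := _ ^+ 2; set v := _ ^+ 2; nra.
have pos (x : R) : 0 < 1 + x ^+ 2 by rewrite ltr_wpDr ?sqr_ge0.
apply: (@le_trans _ _ (m.+2%:R ^+ m.+2 * expR a / a ^+ m.+2 * (w ^+ 2)^-1)); last first.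
  apply: ler_wpM2l.
    by apply: divr_ge0; [apply: mulr_ge0; rewrite ?exprn_ge0 ?expR_ge0|rewrite exprn_ge0// ltW].
  by rewrite -invfM lef_pV2 ?posrE ?mulr_gt0 ?exprn_gt0.
have := @exprn_le_expR (a * w) m.+2 (mulr_ge0 (ltW a0) (ltW w0)) isT.
have -> : expR (a * w) = expR a * expR (a * sqnorm k).
  by rewrite -expRD /w mulrDr mulr1.
rewrite expRN ler_pdivlMr ?exprn_gt0// ler_pdivlMr ?exprn_gt0//.
rewrite exprMn -[m.+2]addn2 [w ^+ (_ + _)]exprD => h.
rewrite mulrAC [_ / _]mulrC -!mulrA ler_pdivrMl ?expR_gt0//.
by move: h; rewrite !mulrA; set u := expR _; set v := expR _ ; lra.
Qed.

Lemma poly_gauss_summable (a : R) (m : nat) : 0 < a ->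
  square_summable (fun k => (1 + sqnorm k) ^+ m * expR (- (a * sqnorm k))).
Proof.
move=> a0; have [M M0 hM] := poly_gauss_le m a0.
apply: (@square_summable_le _ _ (fun k => M * ((1 + k.1%:~R ^+ 2)^-1 * (1 + k.2%:~R ^+ 2)^-1))).
  move=> k; rewrite ger0_norm// mulr_ge0 ?expR_ge0// exprn_ge0//.
  by rewrite addr_ge0 ?sqnorm_ge0.
apply: square_summableZ; exists ((1 + 4 / 1) ^+ 2) => n.
pose g (m : int) : R := (1 + m%:~R ^+ 2)^-1.
have g0 i : 0 <= g i by rewrite invr_ge0 addr_ge0 ?sqr_ge0.
rewrite (eq_square_sum (U := fun k => g k.1 * g k.2)); last first.
  by move=> k; rewrite ger0_norm// mulr_ge0 ?g0.
rewrite square_sum_prod -expr2 ler_pXn2r ?nnegrE; [|by []|..]; last 2 first.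
- exact: sumr_ge0.
- by lra.
apply: centered_sum_le => //.
  by rewrite /g expr0n/= addr0 invr1.
move=> i; apply: le_trans (inv_sq_le _ _) => //.
by rewrite expr1n mul1r.
Qed.

End LatticeSums.

(** * Heat series on the three-torus *)

Section Differentiability.

Lemma linear_bound_continuous (K : realType) (V W : normedModType K)
    (f : {linear V -> W}) (C : K) :
  (forall v, `|f v| <= C * `|v|) -> continuous f.
Proof.
move=> fC; apply/linear_bounded_continuous/linear_boundedP.
exists C; split; first exact: num_real.
by move=> r Cr v; apply: le_trans (fC v) _; rewrite ler_wpM2r// ltW.
Qed.

(** A quadratic error is little-o of the increment, so a candidate linear map with such an error is
    the differential. A series can thus be differentiated from termwise Taylor bounds. *)
Lemma differentiable_quadratic (K : realType) (V W : normedModType K)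
    (f : V -> W) (df : {linear V -> W}) (x : V) (r C : K) : 0 < r ->
  continuous df ->
  (forall h, `|h| < r -> `|f (h + x) - (f x + df h)| <= C * `|h| ^+ 2) ->
  differentiable f x /\ 'd f x = df :> (V -> W).
Proof.
move=> r0 dfc fC.
have E : f \o shift x = cst (f x) + df +o_ 0 id.
  apply/eqaddoP => e e0.
  have re0 : 0 < Num.min r (e / (`|C| + 1)).
    by rewrite lt_min r0 divr_gt0// ltr_wpDl.
  apply/nbhs_ballP; exists (Num.min r (e / (`|C| + 1))) => //= h.
  rewrite -ball_normE /= sub0r normrN lt_min => /andP[hr he].
  rewrite !fctE/=; apply: le_trans (fC h hr) _.
  rewrite expr2 mulrA ler_wpM2r//.
  have C0 : 0 < `|C| + 1 by rewrite ltr_wpDl.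
  move: he; rewrite ltr_pdivlMr// => he.
  have := ler_norm C; have := normr_ge0 h; nra.
have dE := diff_unique dfc E; split => //.
apply/diff_locallyP; split; last by rewrite dE.
by move=> y; rewrite /continuous_at dE; exact: dfc.
Qed.

End Differentiability.

(** * Second-order Taylor estimates for damped waves *)

Section Taylor.
Variable R : realType.

Lemma mvt_bound (f df : R -> R) (a b M : R) :
  (forall x, is_derive x (1 : R) f (df x)) ->
  (forall x, `|x - a| <= `|b - a| -> `|df x| <= M) ->
  `|f b - f a| <= M * `|b - a|.
Proof.
move=> fdf dfM.
have cf : continuous f.
  by move=> x; apply/differentiable_continuous/derivable1_diffP; have [] := fdf x.
have [ab|/ltW ba] := leP a b.
  have [c|c cab ->] := @MVT_segment R f df a b ab (fun x _ => fdf x).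
    exact: continuous_subspaceT.
  rewrite normrM ler_wpM2r//; apply: dfM.
  by move: cab; rewrite in_itv/= => /andP[? ?]; rewrite !ger0_norm; lra.
have [c|c cab E] := @MVT_segment R f df b a ba (fun x _ => fdf x).
  exact: continuous_subspaceT.
rewrite distrC E normrM [`|b - a|]distrC ler_wpM2r//; apply: dfM.
move: cab; rewrite in_itv/= => /andP[? ?].
by rewrite distrC [`|b - a|]distrC !ger0_norm; lra.
Qed.

(** The mean value bound is applied to [f x - x * df a], and once more to its derivative
    [df x - df a]; this costs the usual factor 1/2. *)
Lemma taylor_bound (f df ddf : R -> R) (a b M : R) :
  (forall x, is_derive x (1 : R) f (df x)) ->
  (forall x, is_derive x (1 : R) df (ddf x)) ->
  (forall x, `|x - a| <= `|b - a| -> `|ddf x| <= M) ->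
  `|f b - f a - (b - a) * df a| <= M * `|b - a| ^+ 2.
Proof.
move=> fdf dfddf ddfM.
pose g x := f x - x * df a.
have -> : f b - f a - (b - a) * df a = g b - g a by rewrite /g; ring.
rewrite expr2 mulrA; apply: (@mvt_bound g (fun x => df x - df a)).
  move=> x; have -> : g = f - (df a *: @id R).
    by apply/funext => y; rewrite /g !fctE /GRing.scale/= mulrC.
  apply: is_deriveB => //; apply: is_derive_eq; by rewrite /GRing.scale/= mulr1.
move=> x xab; apply: le_trans (mvt_bound dfddf _) _.
  by move=> y ya; apply: ddfM; apply: le_trans ya xab.
rewrite ler_wpM2l//; apply: le_trans (ddfM a _); first by [].
by rewrite subrr normr0.
Qed.

Lemma norm_cos_le1 (x : R) : `|cos x| <= 1.
Proof. by rewrite ler_norml cos_geN1 cos_le1. Qed.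

Lemma norm_sin_le1 (x : R) : `|sin x| <= 1.
Proof. by rewrite ler_norml sin_geN1 sin_le1. Qed.

Lemma is_derive_oppsin (x : R) : is_derive x (1 : R) (fun y => - sin y) (- cos x).
Proof. exact: is_deriveN. Qed.

Lemma cos_taylor (x h : R) : `|cos (x + h) - cos x + h * sin x| <= `|h| ^+ 2.
Proof.
have := @taylor_bound (@cos R) (fun y => - sin y) (fun y => - cos y) x (x + h) 1
  (@is_derive_cos R) is_derive_oppsin.
rewrite mul1r [x + h]addrC addrK mulrN opprK; apply=> y _.
by rewrite normrN norm_cos_le1.
Qed.

Lemma sin_taylor (x h : R) : `|sin (x + h) - sin x - h * cos x| <= `|h| ^+ 2.
Proof.
have := @taylor_bound (@sin R) cos (fun y => - sin y) x (x + h) 1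
  (@is_derive_sin R) (@is_derive_cos R).
rewrite mul1r [x + h]addrC addrK; apply=> y _.
by rewrite normrN norm_sin_le1.
Qed.

Lemma norm_cosB_le (x y : R) : `|cos x - cos y| <= `|x - y|.
Proof.
rewrite -[leRHS]mul1r; apply: (@mvt_bound cos (fun y => - sin y)).
by move=> z _; rewrite normrN norm_sin_le1.
Qed.

Lemma norm_sinB_le (x y : R) : `|sin x - sin y| <= `|x - y|.
Proof.
rewrite -[leRHS]mul1r; apply: (@mvt_bound sin cos).
by move=> z _; exact: norm_cos_le1.
Qed.

Lemma is_derive_decay (l x : R) :
  is_derive x (1 : R) (fun t => expR (- (l * t))) (- (l * expR (- (l * x)))).
Proof.
have -> : - (l * expR (- (l * x))) = expR (- (l * x)) * (- l) by ring.
apply: (@is_derive1_comp _ expR (fun t => - (l * t))).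
have -> : (fun t => - (l * t)) = (- l) *: @id R.
  by apply/funext => y; rewrite !fctE /GRing.scale/= mulNr.
by apply: is_derive_eq; rewrite /GRing.scale/= mulr1.
Qed.

(** The condition on h keeps every intermediate time above t / 2, so that half of the decay survives
    to absorb the powers of l. *)
Lemma decay_taylor (l t h : R) : 0 <= l -> 0 < t -> `|h| <= t / 2 ->
  `|expR (- (l * (t + h))) - expR (- (l * t))| <=
    l * expR (- (l * (t / 2))) * `|h| /\
  `|expR (- (l * (t + h))) - expR (- (l * t)) + h * (l * expR (- (l * t)))| <=
    l ^+ 2 * expR (- (l * (t / 2))) * `|h| ^+ 2.
Proof.
move=> l0 t0 ht.
have e x : `|x - t| <= `|t + h - t| -> expR (- (l * x)) <= expR (- (l * (t / 2))).
  rewrite [t + h]addrC addrK => xt; rewrite ler_expR lerN2 ler_wpM2l//.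
  by move: (le_trans xt ht); rewrite ler_norml => /andP[]; lra.
split.
  have := @mvt_bound _ _ t (t + h) (l * expR (- (l * (t / 2)))) (is_derive_decay l).
  rewrite {3}[t + h]addrC addrK; apply=> x /e ex.
  by rewrite normrN normrM !ger0_norm ?expR_ge0// ler_wpM2l.
have d2 x : is_derive x (1 : R) (fun t => - (l * expR (- (l * t))))
    (l ^+ 2 * expR (- (l * x))).
  have -> : l ^+ 2 * expR (- (l * x)) = - (l *: - (l * expR (- (l * x)))).
    by rewrite /GRing.scale/=; ring.
  by apply: is_deriveN; apply: is_deriveZ; exact: is_derive_decay.
have := @taylor_bound _ _ _ t (t + h) (l ^+ 2 * expR (- (l * (t / 2))))
  (is_derive_decay l) d2.
rewrite {3 4}[t + h]addrC addrK mulrN opprK; apply=> x /e ex.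
by rewrite normrM !ger0_norm ?expR_ge0 ?sqr_ge0// ler_wpM2l ?sqr_ge0.
Qed.

(** The increment is h in time and e in phase. The linear part is again a damped wave with the same
    rate and phase, which is where [dcos] and [dsin] come from. *)
Lemma damped_wave_taylor (l t h A B x e : R) :
  0 <= l -> 0 < t -> `|h| <= t / 2 ->
  `|expR (- (l * (t + h))) * (A * cos (x + e) + B * sin (x + e)) -
    (expR (- (l * t)) * (A * cos x + B * sin x) +
     expR (- (l * t)) * ((- (h * l * A) + e * B) * cos x +
                         (- (h * l * B) - e * A) * sin x))|
  <= (`|A| + `|B|) * expR (- (l * (t / 2))) * (l * `|h| + `|e|) ^+ 2.
Proof.
move=> l0 t0 ht; have [E1 E2] := decay_taylor l0 t0 ht.
have E3 : `|expR (- (l * (t + h)))| <= expR (- (l * (t / 2))).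
  rewrite ger0_norm ?expR_ge0// ler_expR lerN2 ler_wpM2l//.
  by move: ht; rewrite ler_norml => /andP[]; lra.
set E := expR (- (l * (t + h))) in E1 E2 E3 *.
set F := expR (- (l * t)) in E1 E2 *.
set D := expR (- (l * (t / 2))) in E1 E2 E3 *.
have D0 : 0 <= D by exact: expR_ge0.
set S := `|A| + `|B|; have S0 : 0 <= S by rewrite addr_ge0.
have bnd (p q : R) M : 0 <= M -> `|p| <= M -> `|q| <= M -> `|A * p + B * q| <= S * M.
  move=> M0 pM qM; apply: le_trans (ler_normD _ _) _.
  by rewrite !normrM mulrDl lerD// ler_wpM2l.
have G : `|A * (cos (x + e) - cos x + e * sin x) + B * (sin (x + e) - sin x - e * cos x)|
    <= S * `|e| ^+ 2.
  by apply: bnd; [exact: sqr_ge0|exact: cos_taylor|exact: sin_taylor].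
have G0 : `|A * cos x + B * sin x| <= S * 1.
  by apply: bnd; [|exact: norm_cos_le1|exact: norm_sin_le1].
have G1 : `|A * (- sin x) + B * cos x| <= S * 1.
  by apply: bnd; [|rewrite normrN; exact: norm_sin_le1|exact: norm_cos_le1].
set G' := _ + _ in G; set g0 := _ + _ in G0; set g1 := _ + _ in G1.
(* The remainder splits into the Taylor error of the wave, the Taylor error of the decay, and the
   product of the two first-order variations. *)
rewrite [X in `|X|](_ : _ = E * G' + (E - F + h * (l * F)) * g0 + (E - F) * (e * g1)); last first.
  by rewrite /G' /g0 /g1; ring.
apply: le_trans (ler_normD _ _) _.
apply: le_trans (lerD (ler_normD _ _) (lexx _)) _.
rewrite !normrM.
apply: le_trans (lerD (lerD (ler_pM _ _ E3 G) (ler_pM _ _ E2 G0))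
                      (ler_pM _ _ E1 (ler_wpM2l (normr_ge0 e) G1))) _ => //.
set u := `|h|; set v := `|e|.
have := mulr_ge0 (mulr_ge0 S0 D0) (mulr_ge0 (mulr_ge0 l0 (normr_ge0 h)) (normr_ge0 e)).
rewrite -/u -/v.
nra.
Qed.

End Taylor.

(** * Heat series with coefficients of polynomial growth *)

Section HeatSeries.
Variable R : realType.
Implicit Types (A B : int * int -> R) (k : int * int).

Lemma ler_coord_norm m n (M : 'M[R]_(m, n)) i j : `|M i j| <= `|M|.
Proof.
have /mapP[ij Hij ->] : `|M i j| \in [seq `|M x.1 x.2| | x : 'I_m * 'I_n].
  by apply/mapP; exists (i, j) => //=; rewrite mem_enum.
by rewrite [leRHS]/Num.norm /= mx_normrE; apply/bigmax_geP; right => /=; exists ij.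
Qed.

Lemma four_pi_sq_gt0 : 0 < 4 * pi ^+ 2 :> R.
Proof. by rewrite mulr_gt0 ?exprn_gt0 ?pi_gt0. Qed.

Definition phase k (x : 'rV[R]_3) : R := torus2_phase k (x 0 1, x 0 2).

Lemma phaseD k x y : phase k (x + y) = phase k x + phase k y.
Proof. by rewrite /phase /torus2_phase /= !mxE; ring. Qed.

Lemma phaseZ k c x : phase k (c *: x) = c * phase k x.
Proof. by rewrite /phase /torus2_phase /= !mxE; ring. Qed.

Lemma norm_le_sqnorm k : `|k.1%:~R| + `|k.2%:~R| <= 1 + sqnorm R k.
Proof.
rewrite /sqnorm -(real_normK (num_real k.1%:~R)) -(real_normK (num_real k.2%:~R)).
set a := `|_|; set b := `|_|.
by have := sqr_ge0 (1 - 2 * a); have := sqr_ge0 (1 - 2 * b); lra.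
Qed.

Lemma ler_norm_phase k x :
  `|phase k x| <= 2 * pi * (`|k.1%:~R| + `|k.2%:~R|) * `|x|.
Proof.
rewrite /phase /torus2_phase/= normrM.
rewrite ger0_norm ?mulr_ge0 ?pi_ge0// -mulrA ler_wpM2l ?mulr_ge0 ?pi_ge0//.
apply: le_trans (ler_normD _ _) _; rewrite !normrM mulrDl.
by rewrite lerD// ler_wpM2l// ler_coord_norm.
Qed.

Variable nu : R.
Hypothesis nu_gt0 : 0 < nu.

Definition rate k : R := 4 * pi ^+ 2 * sqnorm R k * nu.

Lemma rate_ge0 k : 0 <= rate k.
Proof.
apply: mulr_ge0; last exact: ltW.
by rewrite mulr_ge0 ?sqnorm_ge0// ltW// four_pi_sq_gt0.
Qed.

Definition mode A B k (t : R) (x : 'rV[R]_3) : R :=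
  expR (- (rate k * t)) * (A k * cos (phase k x) + B k * sin (phase k x)).

Definition heat_series A B (z : R^o * 'rV[R]_3) : R :=
  square_series (fun k => mode A B k z.1 z.2).

(** Polynomial growth is stable under [dcos] and [dsin], while the heat factor still makes the
    series converge absolutely at every positive time. *)
Definition tempered A B : Prop := exists m M, 0 <= M /\
  forall k, `|A k| + `|B k| <= M * (1 + sqnorm R k) ^+ m.

Lemma ler_norm_mode A B k t x :
  `|mode A B k t x| <= expR (- (rate k * t)) * (`|A k| + `|B k|).
Proof.
rewrite normrM ger0_norm ?expR_ge0// ler_wpM2l ?expR_ge0//.
apply: le_trans (ler_normD _ _) _; rewrite !normrM.
by rewrite lerD// ler_piMr ?norm_cos_le1 ?norm_sin_le1.
Qed.

Lemma tempered_summable A B t : tempered A B -> 0 < t ->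
  square_summable (fun k => expR (- (rate k * t)) * (`|A k| + `|B k|)).
Proof.
move=> [m [M [M0 AB]]] t0.
apply: (@square_summable_le _ _ (fun k =>
    M * ((1 + sqnorm R k) ^+ m * expR (- (4 * pi ^+ 2 * nu * t * sqnorm R k))))).
  move=> k; rewrite ger0_norm ?mulr_ge0 ?expR_ge0 ?addr_ge0//.
  rewrite mulrA [leRHS]mulrC.
  have -> : 4 * pi ^+ 2 * nu * t * sqnorm R k = rate k * t by rewrite /rate; ring.
  by rewrite ler_wpM2l ?expR_ge0.
apply/square_summableZ/poly_gauss_summable.
by do 2 rewrite mulr_gt0//; exact: four_pi_sq_gt0.
Qed.

Lemma mode_summable A B t x : tempered A B -> 0 < t ->
  square_summable (fun k => mode A B k t x).
Proof.
move=> AB t0; apply: square_summable_le (tempered_summable AB t0) => k.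
exact: ler_norm_mode.
Qed.

(** [dcos] and [dsin] are the coefficients of the derivative of a mode in the space-time direction
    v: [v.1] differentiates the decay and [v.2] the phase. *)
Definition dcos (v : R^o * 'rV[R]_3) A B k : R :=
  - (v.1 * rate k * A k) + phase k v.2 * B k.

Definition dsin (v : R^o * 'rV[R]_3) A B k : R :=
  - (v.1 * rate k * B k) - phase k v.2 * A k.

(** The cost of one derivative relative to [1 + |k|^2]: the first summand comes from time, the
    second from space. *)
Definition speed : R := 4 * pi ^+ 2 * nu + 2 * pi.

Lemma speed_ge0 : 0 <= speed.
Proof. by apply: addr_ge0; rewrite mulr_ge0 ?pi_ge0// ltW// four_pi_sq_gt0. Qed.

Lemma ler_speed (v : R^o * 'rV[R]_3) k :
  rate k * `|v.1| + `|phase k v.2| <= speed * (1 + sqnorm R k) * `|v|.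
Proof.
have v1 : `|v.1| <= `|v| by rewrite prod_normE le_max lexx.
have v2 : `|v.2| <= `|v| by rewrite prod_normE le_max lexx orbT.
apply: (@le_trans _ _ (rate k * `|v| + 2 * pi * (1 + sqnorm R k) * `|v|)).
  rewrite lerD ?ler_wpM2l ?rate_ge0//; apply: le_trans (ler_norm_phase _ _) _.
  have p0 : 0 <= 2 * pi :> R by rewrite mulr_ge0 ?pi_ge0.
  by apply: ler_pM => //; [rewrite mulr_ge0 ?addr_ge0|rewrite ler_wpM2l ?norm_le_sqnorm].
rewrite -mulrDl ler_wpM2r// /rate /speed [leRHS]mulrDl lerD2r.
have : 0 <= 4 * pi ^+ 2 * nu by rewrite mulr_ge0 ?ltW ?four_pi_sq_gt0.
by move=> c0; rewrite [leRHS]mulrDr mulr1 [leLHS]mulrAC lerDr.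
Qed.

Lemma dcoef_le v A B k :
  `|dcos v A B k| + `|dsin v A B k| <=
  speed * (1 + sqnorm R k) * `|v| * (`|A k| + `|B k|).
Proof.
apply: le_trans (ler_wpM2r _ (ler_speed v k)); last by rewrite addr_ge0.
have -> : rate k * `|v.1| = `|(v.1 : R) * rate k|.
  by rewrite normrM (ger0_norm (rate_ge0 k)) mulrC.
have bnd (p q a b : R) :
    `|- (p * a) + q * b| + `|- (p * b) - q * a| <= (`|p| + `|q|) * (`|a| + `|b|).
  apply: le_trans (lerD (ler_normD _ _) (ler_normB _ _)) _.
  by rewrite !normrN !normrM le_eqVlt; apply/orP; left; apply/eqP; ring.
exact: bnd.
Qed.

Lemma tempered_d v A B : tempered A B -> tempered (dcos v A B) (dsin v A B).
Proof.
move=> [m [M [M0 AB]]]; exists m.+1, (speed * `|v| * M).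
split; first by rewrite !mulr_ge0 ?speed_ge0.
move=> k; apply: le_trans (dcoef_le v A B k) _.
have s0 : 0 <= 1 + sqnorm R k by rewrite addr_ge0 ?sqnorm_ge0.
rewrite exprS [leRHS](_ : _ = speed * (1 + sqnorm R k) * `|v| *
   (M * (1 + sqnorm R k) ^+ m)); last by ring.
by rewrite ler_wpM2l ?AB// !mulr_ge0 ?speed_ge0.
Qed.

Lemma mode_lin c v w A B k t x :
  mode (dcos (c *: v + w) A B) (dsin (c *: v + w) A B) k t x =
  c * mode (dcos v A B) (dsin v A B) k t x + mode (dcos w A B) (dsin w A B) k t x.
Proof.
rewrite /mode /dcos /dsin !phaseD !phaseZ.
by have -> : (c *: v + w).1 = c * v.1 + w.1 by []; ring.
Qed.

Lemma heat_series_lin A B z : tempered A B -> 0 < z.1 ->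
  forall c v w, heat_series (dcos (c *: v + w) A B) (dsin (c *: v + w) A B) z =
    c * heat_series (dcos v A B) (dsin v A B) z +
    heat_series (dcos w A B) (dsin w A B) z.
Proof.
move=> AB z0 c v w.
have S u := mode_summable z.2 (tempered_d u AB) z0.
rewrite /heat_series -(square_seriesZ c (S v)) -square_seriesD//; last first.
  exact: square_summableZ.
by congr (limn (square_sum _)); apply/funext => k; rewrite mode_lin.
Qed.

(** The factor [1 + |k|^2] lost in [dcoef_le] is moved into the coefficients A' and B', which are
    still tempered. The bound makes the candidate differential continuous. *)
Lemma heat_series_d_bound A B z : tempered A B -> 0 < z.1 ->
  exists C, forall v, `|heat_series (dcos v A B) (dsin v A B) z| <= C * `|v|.
Proof.
move=> AB z0.
pose A' k := (1 + sqnorm R k) * A k; pose B' k := (1 + sqnorm R k) * B k.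
have E k : `|A' k| + `|B' k| = (1 + sqnorm R k) * (`|A k| + `|B k|).
  have s0 : 0 <= 1 + sqnorm R k by rewrite addr_ge0 ?sqnorm_ge0.
  by rewrite /A' /B' [X in X + _]normrM [X in _ + X]normrM (ger0_norm s0) [RHS]mulrDr.
have AB' : tempered A' B'.
  move: AB => [m [M [M0 AB]]]; exists m.+1, M; split => // k.
  by rewrite E exprS mulrCA ler_wpM2l// addr_ge0 ?sqnorm_ge0.
have [C hC] := tempered_summable AB' z0.
exists (speed * C) => v.
apply: square_series_bound; first exact/mode_summable/z0/tempered_d.
move=> n; apply: le_trans (ler_norm_square_sum _ _) _.
rewrite mulrAC; apply: le_trans (ler_wpM2l _ (hC n)); last first.
  by rewrite mulr_ge0 ?speed_ge0.
rewrite -square_sumZ; apply: ler_square_sum => k.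
apply: le_trans (ler_norm_mode _ _ _ _ _) _.
apply: le_trans (ler_wpM2l (expR_ge0 _) (dcoef_le v A B k)) _.
apply: le_trans (ler_wpM2l _ (ler_norm _)); last by rewrite mulr_ge0 ?speed_ge0.
by rewrite E le_eqVlt; apply/orP; left; apply/eqP; ring.
Qed.

(** [damped_wave_taylor] is summed over all modes: the decay left at time [z.1 / 2] makes the
    coefficients A' and B', which absorb [(1 + |k|^2)^2], summable. *)
Lemma heat_series_taylor A B z : tempered A B -> 0 < z.1 ->
  exists C, forall h, `|h| < z.1 / 2 ->
    `|heat_series A B (h + z) -
      (heat_series A B z + heat_series (dcos h A B) (dsin h A B) z)|
    <= C * `|h| ^+ 2.
Proof.
move=> AB z0; have z20 : 0 < z.1 / 2 by rewrite divr_gt0.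
pose A' k := (1 + sqnorm R k) ^+ 2 * A k; pose B' k := (1 + sqnorm R k) ^+ 2 * B k.
have s0 k : 0 <= 1 + sqnorm R k by rewrite addr_ge0 ?sqnorm_ge0.
have E k : `|A' k| + `|B' k| = (1 + sqnorm R k) ^+ 2 * (`|A k| + `|B k|).
  by rewrite /A' /B' [X in X + _]normrM [X in _ + X]normrM (ger0_norm (sqr_ge0 (1 + sqnorm R k))) [RHS]mulrDr.
have AB' : tempered A' B'.
  move: AB => [m [M [M0 AB]]]; exists m.+2, M; split => // k.
  by rewrite E -[m.+2]add2n exprD mulrCA ler_wpM2l// sqr_ge0.
have [C hC] := tempered_summable AB' z20.
exists (speed ^+ 2 * C) => h hz.
have h1 : `|h.1| <= z.1 / 2.
  by apply: le_trans (ltW hz); rewrite prod_normE le_max lexx.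
have hz0 : 0 < (h + z).1.
  by rewrite /=; move: h1; rewrite ler_norml => /andP[]; lra.
have s1 := mode_summable (h + z).2 AB hz0.
have s2 := mode_summable z.2 AB z0.
have s3 := mode_summable z.2 (tempered_d h AB) z0.
rewrite [X in `|X|](_ : _ = square_series (fun k => mode A B k (h + z).1 (h + z).2 +
   (- 1) * (mode A B k z.1 z.2 + mode (dcos h A B) (dsin h A B) k z.1 z.2))); last first.
  rewrite square_seriesD ?square_seriesZ ?square_seriesD ?mulN1r//.
  - exact: square_summableD.
  - exact/square_summableZ/square_summableD.
apply: square_series_bound.
  by apply: square_summableD => //; exact/square_summableZ/square_summableD.
move=> n; apply: le_trans (ler_norm_square_sum _ _) _.
rewrite mulrAC; apply: le_trans (ler_wpM2l _ (hC n)); last first.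
  by rewrite mulr_ge0 ?sqr_ge0.
rewrite -square_sumZ; apply: ler_square_sum => k.
rewrite mulN1r /mode /= phaseD [h.1 + z.1]addrC [phase k h.2 + _]addrC.
apply: le_trans (damped_wave_taylor _ _ _ _ (rate_ge0 k) z0 h1) _.
apply: le_trans (ler_wpM2l _ (ler_norm _)); last by rewrite mulr_ge0 ?sqr_ge0.
rewrite E; have := ler_speed h k.
set X := rate k * _ + _; set Y := speed * _ * _ => XY.
have X0 : 0 <= X by rewrite /X addr_ge0// mulr_ge0// rate_ge0.
have XY2 : X ^+ 2 <= Y ^+ 2 by rewrite ler_pXn2r// nnegrE// (le_trans X0).
apply: le_trans (ler_wpM2l _ XY2) _; first by rewrite mulr_ge0 ?addr_ge0 ?expR_ge0.
by rewrite /Y le_eqVlt; apply/orP; left; apply/eqP; ring.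
Qed.

(** Stated for any f that agrees with the series at positive times only: a derivative of the series
    is known as a series only there, and this form can be iterated. The fixed vector w covers scalar
    and vector fields at once. *)
Lemma heat_series_diff (W : normedModType R) (f : R^o * 'rV[R]_3 -> W) (w : W)
    A B (z : R^o * 'rV[R]_3) : tempered A B ->
  (forall y : R^o * 'rV[R]_3, 0 < y.1 -> f y = heat_series A B y *: w) ->
  0 < z.1 ->
  differentiable f z /\
  forall v, 'D_v f z = heat_series (dcos v A B) (dsin v A B) z *: w.
Proof.
move=> AB fE z0.
pose L v : W := heat_series (dcos v A B) (dsin v A B) z *: w.
have Llin : linear L.
  by move=> c v u; rewrite /L (heat_series_lin AB z0) scalerDl scalerA.
pose L' : {linear (R^o * 'rV[R]_3)%type -> W} := HB.pack L (GRing.isLinear.Build _ _ _ _ L Llin).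
have [K hK] := heat_series_d_bound AB z0.
have Lc : continuous L'.
  apply: (@linear_bound_continuous _ _ _ L' (K * `|w|)) => v.
  by rewrite /L' /= /L normrZ mulrAC ler_wpM2r.
have [C hC] := heat_series_taylor AB z0.
have [|h hz|df dE] := @differentiable_quadratic _ _ _ f L' z (z.1 / 2) (C * `|w|) _ Lc.
- by rewrite divr_gt0.
- have h1 : `|h.1| < z.1 / 2.
    by apply: le_lt_trans hz; rewrite prod_normE le_max lexx.
  have hz0 : 0 < (h + z).1.
    by rewrite /=; move: h1; rewrite ltr_norml => /andP[]; lra.
  rewrite !fE// /L' /= /L -scalerDl -scalerBl normrZ mulrAC ler_wpM2r//.
  exact: hC.
- by split => // v; rewrite deriveE// dE.
Qed.

Lemma heat_series_smooth (W : normedModType R) (w : W) A B : tempered A B ->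
  smooth_on (@positive_times R) (fun z => heat_series A B z *: w).
Proof.
move=> AB k.
(* The coefficients are generalised before the induction on k because each derivative changes
   them. *)
suff : forall (f : R^o * 'rV[R]_3 -> W) A B, tempered A B ->
    (forall y : R^o * 'rV[R]_3, 0 < y.1 -> f y = heat_series A B y *: w) ->
    Ck_on k (@positive_times R) f by move=> H; exact: (H _ _ _ AB).
elim: k => [|k IH] f {}A {}B {}AB fE.
  move=> z z0; apply: differentiable_continuous.
  by have [] := heat_series_diff AB fE z0.
split=> [z z0|v]; first by have [] := heat_series_diff AB fE z0.
apply: (IH _ _ _ (tempered_d v AB)) => z z0.
by have [_ ->] := heat_series_diff AB fE z0.
Qed.

End HeatSeries.

(** * Fourier coefficients and Bessel's inequality *)

Section IntegralLemmas.
Variable R : realType.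

Lemma integral_derive (F f : R -> R) (a b : R) : a < b ->
  (forall x, a <= x <= b -> is_derive x (1 : R) F (f x)) ->
  (forall x, a <= x <= b -> {for x, continuous f}) ->
  (\int[lebesgue_measure]_(x in `[a, b]) (f x)%:E = (F b - F a)%:E)%E.
Proof.
move=> ab dF cf.
have cF x : a <= x <= b -> {for x, continuous F}.
  move=> xab; apply/differentiable_continuous/derivable1_diffP.
  by have [] := dF x xab.
rewrite (@continuous_FTC2 _ f F)//.
- by apply: continuous_in_subspaceT => x; rewrite inE/= in_itv/= => /cf.
- have aab : a <= a <= b by rewrite lexx ltW.
  have bab : a <= b <= b by rewrite lexx ltW.
  split.
  + by move=> x; rewrite in_itv/= => /andP[/ltW ax /ltW xb]; have [] := dF x; rewrite ?ax.
  + by apply: cvg_at_right_filter; exact: cF.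
  + by apply: cvg_at_left_filter; exact: cF.
- move=> x; rewrite in_itv/= => /andP[/ltW ax /ltW xb].
  by rewrite derive1E; have [|_ ->] := dF x; rewrite ?ax.
Qed.

Lemma Rintegral_sum d (T : measurableType d) (mu : {measure set T -> \bar R})
    (I : Type) (s : seq I) (F : I -> T -> R) :
  (forall i, mu.-integrable setT (EFin \o F i)) ->
  mu.-integrable setT (EFin \o (fun x => \sum_(i <- s) F i x)) /\
  \int[mu]_x (\sum_(i <- s) F i x) = \sum_(i <- s) \int[mu]_x F i x.
Proof.
move=> Fi.
have Ii r : mu.-integrable setT (EFin \o (fun x => \sum_(i <- r) F i x)).
  rewrite (_ : _ \o _ = fun x => (\sum_(i <- r) (EFin \o F i) x)%E).
    exact: integrable_sum.
  by apply/funext => x /=; rewrite sumEFin.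
split => //; elim: s => [|i s IHs].
  by rewrite big_nil; under eq_Rintegral do rewrite big_nil; rewrite Rintegral_cst// mul0r.
rewrite big_cons -IHs -RintegralD//.
by apply: eq_Rintegral => x _; rewrite big_cons.
Qed.

Lemma Rintegral_square_sum d (T : measurableType d) (mu : {measure set T -> \bar R})
    (F : int * int -> T -> R) n :
  (forall k, mu.-integrable setT (EFin \o F k)) ->
  mu.-integrable setT (EFin \o (fun x => square_sum (F^~ x) n)) /\
  \int[mu]_x square_sum (F^~ x) n = square_sum (fun k => \int[mu]_x F k x) n.
Proof.
move=> Fi.
have H i := @Rintegral_sum _ _ mu _ (index_enum 'I_(n.*2.+1))
  (fun (j : 'I_(n.*2.+1)) x => F (i%:Z - n%:Z, j%:Z - n%:Z) x) (fun j => Fi _).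
have [H1 H2] := @Rintegral_sum _ _ mu _ (index_enum 'I_(n.*2.+1))
  (fun (i : 'I_(n.*2.+1)) x => \sum_(j < n.*2.+1) F (i%:Z - n%:Z, j%:Z - n%:Z) x)
  (fun i => (H i).1).
split; first exact: H1.
by rewrite [LHS]H2; apply: eq_bigr => i _; rewrite (H i).2.
Qed.

Lemma bounded_integrable d (T : measurableType d) (P : probability T R)
    (f : T -> R) (M : R) : measurable_fun setT f -> (forall x, `|f x| <= M) ->
  P.-integrable setT (EFin \o f).
Proof.
move=> mf fM; apply: measurable_bounded_integrable => //.
  by rewrite -ge0_fin_numE// fin_num_measure.
exists M; split; first exact: num_real.
by move=> r /ltW Mr x _; exact: le_trans (fM x) Mr.
Qed.

Lemma integrable_mul_bounded d (T : measurableType d) (P : probability T R)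
    (f g : T -> R) (M : R) : P.-integrable setT (EFin \o f) ->
  measurable_fun setT g -> (forall x, `|g x| <= M) ->
  P.-integrable setT (EFin \o (fun x => f x * g x)).
Proof.
move=> fi mg gM.
have : P.-integrable setT ((EFin \o f) \* (EFin \o g))%E.
  apply: integrableMl => //.
  exists M; split; first exact: num_real.
  by move=> r /ltW Mr x _; exact: le_trans (gM x) Mr.
by apply: eq_integrable => // x _; rewrite /= EFinM.
Qed.

Lemma measurable_cos_comp d (T : measurableType d) (f : T -> R) :
  measurable_fun setT f -> measurable_fun setT (fun x => cos (f x)).
Proof.
by move=> mf; apply: measurableT_comp mf; apply: continuous_measurable_fun; exact: continuous_cos.
Qed.

Lemma measurable_sin_comp d (T : measurableType d) (f : T -> R) :
  measurable_fun setT f -> measurable_fun setT (fun x => sin (f x)).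
Proof.
by move=> mf; apply: measurableT_comp mf; apply: continuous_measurable_fun; exact: continuous_sin.
Qed.

End IntegralLemmas.

(** * Integrals of trigonometric functions over the torus *)

Section TorusIntegrals.
Variable R : realType.

Lemma sin_periodz (x : R) (m : int) : sin (x + 2 * pi * m%:~R) = sin x.
Proof.
have H (n : nat) y : sin (y + 2 * pi * n%:R) = sin y :> R.
  by rewrite -mulrA [_ * n%:R]mulr_natr mulr_natl -mulrnA mulnC mulrnA (periodicn (@sinD2pi R)).
case: m => n; first exact: H.
rewrite NegzE -(H n.+1 (x + _)) -addrA -mulrDr mulrNz -pmulrn addNr.
by rewrite mulr0 addr0.
Qed.

Lemma cos_periodz (x : R) (m : int) : cos (x + 2 * pi * m%:~R) = cos x.
Proof.
by rewrite -!sinDpihalf addrAC sin_periodz.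
Qed.

Lemma two_pi_neq0 : 2 * pi != 0 :> R.
Proof. by rewrite mulf_neq0// lt0r_neq0// pi_gt0. Qed.

Lemma is_derive_sin_affine (a c x : R) :
  is_derive x (1 : R) (fun x => sin (a * x + c)) (cos (a * x + c) * a).
Proof.
apply: (@is_derive1_comp _ sin (fun x => a * x + c)).
have -> : (fun x => a * x + c) = (a *: @id R) + cst c by [].
by apply: is_derive_eq; rewrite /GRing.scale/= mulr1 addr0.
Qed.

Lemma continuous_affine (a c : R) : continuous (fun x : R => a * x + c).
Proof. by move=> x; apply: cvgD; [apply: cvgMr; exact: cvg_id|exact: cvg_cst]. Qed.

Lemma measurable_affine (a c : R) : measurable_fun setT (fun x : R => a * x + c).
Proof. by apply: continuous_measurable_fun; exact: continuous_affine. Qed.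

Lemma circle_cos (m : int) (c : R) :
  \int[circle_measure R]_x cos (2 * pi * m%:~R * x + c) = (m == 0)%:R * cos c.
Proof.
have [->|m0] := eqVneq m 0.
  rewrite mul1r (_ : (fun x => _) = cst (cos c)); last first.
    by apply/funext => x; rewrite mulr0 mul0r add0r.
  by rewrite Rintegral_cst//= probability_setT/= mulr1.
set a := 2 * pi * m%:~R.
have a0 : a != 0 by rewrite mulf_neq0 ?two_pi_neq0 ?intr_eq0.
have mc : measurable_fun setT (fun x : R => cos (a * x + c)).
  by apply: measurable_cos_comp; exact: measurable_affine.
have ic : (circle_measure R).-integrable setT (EFin \o (fun x => cos (a * x + c))).
  by apply: (@bounded_integrable _ _ _ (circle_measure R) _ 1) => // x; exact: norm_cos_le1.
have i1 : (circle_measure R).-integrable setT (EFin \o cst (1 : R)).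
  by apply: (@bounded_integrable _ _ _ (circle_measure R) _ 1) => // x; rewrite normr1.
(* Adding 1 makes the integrand nonnegative, as [integral_uniform] requires. *)
suff : \int[circle_measure R]_x (1 + cos (a * x + c)) = 1.
  rewrite RintegralD// Rintegral_cst//= probability_setT/= mulr1 mul0r.
  by move/(congr1 (fun z => z - 1)); rewrite addrAC subrr add0r.
pose F (x : R) := x + a^-1 * sin (a * x + c).
have F1 : F 1 - F 0 = 1.
  by rewrite /F mulr1 mulr0 !add0r -[a + c]addrC /a sin_periodz; ring.
have hd (x : R) : is_derive x (1 : R) F (1 + cos (a * x + c)).
  have -> : 1 + cos (a * x + c) = 1 + a^-1 *: (cos (a * x + c) * a).
    by rewrite /GRing.scale/= mulrCA mulVf// mulr1.
  apply: (@is_deriveD _ _ _ id (a^-1 \*: (fun x : R => sin (a * x + c)))).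
  by apply: is_deriveZ; exact: is_derive_sin_affine.
have hc (x : R) : {for x, continuous (fun x : R => 1 + cos (a * x + c))}.
  apply: cvgD; first exact: cvg_cst.
  apply: (@continuous_comp _ _ _ (fun x => a * x + c) cos).
    exact: continuous_affine.
  exact: continuous_cos.
rewrite /Rintegral integral_uniform/=.
- by rewrite subr0 invr1 mul1e (integral_derive ltr01 (fun x _ => hd x) (fun x _ => hc x)) F1.
- by apply/measurable_EFinP; apply: measurable_funD.
- by move=> x; rewrite lee_fin; have := cos_geN1 (a * x + c); lra.
Qed.

Lemma measurable_torus2_phase k : measurable_fun setT (@torus2_phase R k).
Proof.
apply: measurable_funM => //; apply: measurable_funD; apply: measurable_funM => //.
Qed.

Lemma torus2_measureT : torus2_measure R setT = 1%E.
Proof. exact: (@probability_setT _ _ _ (torus2_measure R)). Qed.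

Lemma torus_cos_integrable k c :
  (torus2_measure R).-integrable setT (EFin \o (fun z => cos (torus2_phase k z + c))).
Proof.
apply: (@bounded_integrable _ _ _ (torus2_measure R) _ 1).
  by apply: measurable_cos_comp; apply: measurable_funD => //; exact: measurable_torus2_phase.
by move=> z; exact: norm_cos_le1.
Qed.

(** The shift c handles cosine and sine together, sine being the shift by -pi/2. *)
Lemma torus_cos k c :
  \int[torus2_measure R]_z cos (torus2_phase k z + c) = (k == (0, 0))%:R * cos c.
Proof.
have e z : cos (torus2_phase k z + c) =
    cos (2 * pi * k.1%:~R * z.1 + (2 * pi * k.2%:~R * z.2 + c)).
  by congr cos; rewrite /torus2_phase; ring.
rewrite /Rintegral -[X in fine X](@integral21_prod_meas1 _ _ _ _ _ (circle_measure R) (circle_measure R)); last first.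
  exact: torus_cos_integrable.
rewrite /fubini_G/=.
have E y : (\int[circle_measure R]_x (cos (torus2_phase k (x, y) + c))%:E =
   ((k.1 == 0)%:R * cos (2 * pi * k.2%:~R * y + c))%:E)%E.
  rewrite -circle_cos /Rintegral fineK; last first.
    apply: integrable_fin_num => //; apply: (@bounded_integrable _ _ _ (circle_measure R) _ 1).
      by apply: measurable_cos_comp; exact: measurable_affine.
    by move=> x; exact: norm_cos_le1.
  by apply: eq_integral => x _; rewrite e.
under eq_integral do rewrite E.
rewrite -/(Rintegral _ _ _) RintegralZl//; last first.
  apply: (@bounded_integrable _ _ _ (circle_measure R) _ 1).
    by apply: measurable_cos_comp; exact: measurable_affine.
  by move=> x; exact: norm_cos_le1.
rewrite circle_cos mulrA; congr (_ * _).
by case: k {e E} => a b /=; rewrite xpair_eqE; case: (a == 0); case: (b == 0); rewrite ?mulr1 ?mul0r ?mulr0.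
Qed.

End TorusIntegrals.

(** * Cauchy-Schwarz for square sums *)

Section CauchySchwarz.
Variable R : realType.
Implicit Types (b g : int * int -> R).

(** Summing [(x |b| - |g|)^2 >= 0] gives a quadratic inequality in x, used at its optimal point
    [x = D / B]. *)
Lemma square_sum_CS b g n :
  square_sum (fun k => `|b k * g k|) n ^+ 2 <=
  square_sum (fun k => b k ^+ 2) n * square_sum (fun k => g k ^+ 2) n.
Proof.
set D := square_sum _ n; set B := square_sum _ n; set G := square_sum _ n.
have D0 : 0 <= D by exact: square_sum_ge0.
have B0 : 0 <= B by apply: square_sum_ge0 => k; exact: sqr_ge0.
have G0 : 0 <= G by apply: square_sum_ge0 => k; exact: sqr_ge0.
have quad x : 2 * x * D <= x ^+ 2 * B + G.
  rewrite -!square_sumZ -square_sumD; apply: ler_square_sum => k.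
  rewrite normrM -(real_normK (num_real (b k))) -(real_normK (num_real (g k))).
  by have := sqr_ge0 (x * `|b k| - `|g k|); lra.
have [B00|Bn0] := eqVneq B 0.
  have [->|Dn0] := eqVneq D 0; first by rewrite expr0n mulr_ge0.
  (* For B = 0 the inequality reads [2 x D <= G] for all x; this x turns it into [G + 1 <= G]. *)
  have := quad ((G + 1) / (2 * D)); rewrite B00 mulr0 add0r.
  have -> : 2 * ((G + 1) / (2 * D)) * D = G + 1 by field.
  lra.
have := quad (D / B).
have -> : 2 * (D / B) * D = 2 * (D ^+ 2 / B) by field.
have -> : (D / B) ^+ 2 * B = D ^+ 2 / B by field.
have BB : 0 < B by rewrite lt0r Bn0.
move=> h; rewrite mulrC -ler_pdivrMr//; lra.
Qed.

(** An inequality, because m may lie outside the square. *)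
Lemma square_sum_delta m n : square_sum (fun l => (l == m)%:R : R) n <= 1.
Proof.
pose d (a b : int) : R := (b == a)%:R.
rewrite (eq_square_sum (U := fun l => d m.1 l.1 * d m.2 l.2)); last first.
  move=> [a b]; case: m => a' b'; rewrite /d xpair_eqE /=.
  by case: (a == a'); rewrite ?mul1r ?mul0r.
have H a : 0 <= \sum_(i < n.*2.+1) d a (i%:Z - n%:Z) <= 1.
  rewrite sumr_ge0//=.
  have [/existsP[i0 /eqP i0a]|/existsPn noi] := boolP [exists i : 'I_(n.*2.+1), i%:Z - n%:Z == a].
    rewrite (bigD1 i0)//= big1 ?addr0 /d; first by rewrite i0a eqxx.
    move=> i ii0; case: eqP => // ia; case/eqP: ii0; apply: val_inj => /=.
    by apply/eqP; rewrite -eqz_nat; apply/eqP; move: ia; rewrite -i0a => /addIr.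
  rewrite big1// => i _; rewrite /d; case: eqP => // ia.
  by have := noi i; rewrite ia eqxx.
rewrite square_sum_prod.
have /andP[h1 h2] := H m.1; have /andP[h3 h4] := H m.2.
by rewrite -[leRHS]mulr1; apply: ler_pM.
Qed.

End CauchySchwarz.

(** * Real Fourier coefficients and Bessel's inequality *)

Section Bessel.
Variables (R : realType) (f : R * R -> R).
Hypothesis fL2 : f \in Lfun (torus2_measure R) 2%:E.

Local Notation mu := (torus2_measure R).

Definition cos_coef (k : int * int) : R :=
  \int[mu]_z (f z * cos (torus2_phase k z)).
Definition sin_coef (k : int * int) : R :=
  \int[mu]_z (f z * sin (torus2_phase k z)).

Local Notation c := cos_coef.
Local Notation s := sin_coef.

Lemma Lfun2_integrable : mu.-integrable setT (EFin \o f).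
Proof.
apply/Lfun1_integrable; apply: Lfun_subset12 fL2.
exact: (@eq_ind_r _ 1%E (fun x => x \is a fin_num) isT _ (torus2_measureT R)).
Qed.

Lemma L2_norm2_sqr : L2_norm2 f ^+ 2 = \int[mu]_z (f z ^+ 2).
Proof.
have ff := Lfun2_integrable_sqr fL2.
have N0 : (0 <= 'N[mu]_2%:E[EFin \o f])%E by exact: Lnorm_ge0.
have E : ('N[mu]_2%:E[EFin \o f] `^ 2 = \int[mu]_z (f z ^+ 2)%:E)%E.
  rewrite poweR_Lnorm ?pnatr_eq0//; apply: eq_integral => z _ /=.
  by rewrite powR_mulrn// real_normK ?num_real.
have Nfin : ('N[mu]_2%:E[EFin \o f])%E \is a fin_num.
  move: fL2; rewrite inE => /andP[_]; rewrite inE /= /finite_norm => h.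
  by rewrite ge0_fin_numE.
rewrite /L2_norm2 /Rintegral -E -(fineK Nfin) poweR_EFin /= powR_mulrn//.
by rewrite -lee_fin fineK.
Qed.

Lemma L2_norm2_ge0 : 0 <= L2_norm2 f.
Proof. by rewrite /L2_norm2 fine_ge0// Lnorm_ge0. Qed.

Lemma measurable_cos_phase k : measurable_fun setT (fun z => cos (@torus2_phase R k z)).
Proof. by apply: measurable_cos_comp; exact: measurable_torus2_phase. Qed.

Lemma measurable_sin_phase k : measurable_fun setT (fun z => sin (@torus2_phase R k z)).
Proof. by apply: measurable_sin_comp; exact: measurable_torus2_phase. Qed.

Lemma mul_cos_integrable k :
  mu.-integrable setT (EFin \o (fun z => f z * cos (torus2_phase k z))).
Proof.
apply: (@integrable_mul_bounded _ _ _ mu _ _ 1 Lfun2_integrable (measurable_cos_phase k)).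
by move=> z; exact: norm_cos_le1.
Qed.

Lemma mul_sin_integrable k :
  mu.-integrable setT (EFin \o (fun z => f z * sin (torus2_phase k z))).
Proof.
apply: (@integrable_mul_bounded _ _ _ mu _ _ 1 Lfun2_integrable (measurable_sin_phase k)).
by move=> z; exact: norm_sin_le1.
Qed.

Lemma norm_cos_coef k : `|c k| <= \int[mu]_z `|f z|.
Proof.
apply: (le_trans (le_normr_Rintegral measurableT (mul_cos_integrable k))).
apply: le_Rintegral => //.
- by have /integrable_norm := mul_cos_integrable k.
- by have /integrable_norm := Lfun2_integrable.
- by move=> z _; rewrite normrM ler_piMr ?norm_cos_le1.
Qed.

Lemma norm_sin_coef k : `|s k| <= \int[mu]_z `|f z|.
Proof.
apply: (le_trans (le_normr_Rintegral measurableT (mul_sin_integrable k))).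
apply: le_Rintegral => //.
- by have /integrable_norm := mul_sin_integrable k.
- by have /integrable_norm := Lfun2_integrable.
- by move=> z _; rewrite normrM ler_piMr ?norm_sin_le1.
Qed.

Lemma coef_tempered : tempered c s.
Proof.
exists 0%N, (2 * \int[mu]_z `|f z|); split.
  by rewrite mulr_ge0// (le_trans _ (norm_cos_coef (0, 0))).
by move=> k; rewrite expr0 mulr1 mulr_natl; apply: lerD; [exact: norm_cos_coef|exact: norm_sin_coef].
Qed.

Lemma torus2_phaseN k z : torus2_phase (- k.1, - k.2) z = - torus2_phase k z :> R.
Proof. by rewrite /torus2_phase/= !mulrNz; ring. Qed.

Lemma cos_coefN k : c (- k.1, - k.2) = c k.
Proof. by apply: eq_Rintegral => z _; rewrite torus2_phaseN cosN. Qed.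

Lemma sin_coefN k : s (- k.1, - k.2) = - s k.
Proof.
rewrite -[RHS]mulN1r /sin_coef -RintegralZl//; last exact: mul_sin_integrable.
by apply: eq_Rintegral => z _; rewrite torus2_phaseN sinN mulN1r mulrN.
Qed.

Definition fourier_term k z : R :=
  c k * cos (torus2_phase k z) + s k * sin (torus2_phase k z).
Local Notation T := fourier_term.

Lemma mul_term_integral k :
  mu.-integrable setT (EFin \o (fun z => f z * T k z)) /\
  \int[mu]_z (f z * T k z) = c k ^+ 2 + s k ^+ 2.
Proof.
have E : (fun z => f z * T k z) = (fun z => c k * (f z * cos (torus2_phase k z)) +
    s k * (f z * sin (torus2_phase k z))).
  by apply/funext => z; rewrite /T; ring.
have i1 : mu.-integrable setT (EFin \o (fun z => c k * (f z * cos (torus2_phase k z)))).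
  have := integrableZl measurableT (c k) (mul_cos_integrable k).
  by apply: eq_integrable => // z _; rewrite /= EFinM.
have i2 : mu.-integrable setT (EFin \o (fun z => s k * (f z * sin (torus2_phase k z)))).
  have := integrableZl measurableT (s k) (mul_sin_integrable k).
  by apply: eq_integrable => // z _; rewrite /= EFinM.
rewrite E; split.
  have := integrableD measurableT i1 i2.
  by apply: eq_integrable => // z _; rewrite /= EFinD.
rewrite RintegralD// RintegralZl ?RintegralZl ?expr2//; first exact: mul_sin_integrable.
exact: mul_cos_integrable.
Qed.

Lemma index_subr_eq0 (k l : int * int) :
  ((k.1 - l.1, k.2 - l.2) == (0, 0)) = (l == k).
Proof.
case: k => a b; case: l => a' b'.
by rewrite !xpair_eqE /= !subr_eq0 (eq_sym a) (eq_sym b).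
Qed.

Lemma index_addr_eq0 (k l : int * int) :
  ((k.1 + l.1, k.2 + l.2) == (0, 0)) = (l == (- k.1, - k.2)).
Proof.
case: k => a b; case: l => a' b'.
by rewrite !xpair_eqE /= [a + _]addrC [b + _]addrC !addr_eq0.
Qed.

(** Product-to-sum formulas leave waves of frequencies k - l and k + l, and only a zero frequency
    has a nonzero mean. The second Kronecker delta is there because k and -k carry the same real
    mode. *)
Lemma term_term_integral k l :
  mu.-integrable setT (EFin \o (fun z => T k z * T l z)) /\
  \int[mu]_z (T k z * T l z) =
  (c k ^+ 2 + s k ^+ 2) / 2 * ((l == k)%:R + (l == (- k.1, - k.2))%:R).
Proof.
pose w (m : int * int) (b : R) (z : R * R) : R := cos (torus2_phase m z + b).
pose p := (k.1 - l.1, k.2 - l.2); pose q := (k.1 + l.1, k.2 + l.2).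
(* Each triple is a coefficient, a frequency and a phase shift; the shift -pi/2 encodes a sine. *)
pose F : seq (R * (int * int) * R) := [:: ((c k * c l + s k * s l) / 2, p, 0); ((c k * c l - s k * s l) / 2, q, 0);
  ((c k * s l + s k * c l) / 2, q, - (pi / 2)); ((s k * c l - c k * s l) / 2, p, - (pi / 2))].
have E : (fun z => T k z * T l z) = (fun z => \sum_(t <- F) t.1.1 * w t.1.2 t.2 z).
  apply/funext => z; rewrite /F !big_cons big_nil /= addr0 /w.
  rewrite !cosB !cos_pihalf !sin_pihalf !mulr0 !mulr1 !add0r !addr0.
  have -> : torus2_phase p z = torus2_phase k z - torus2_phase l z.
    by rewrite /torus2_phase/= !mulrzBr; ring.
  have -> : torus2_phase q z = torus2_phase k z + torus2_phase l z.
    by rewrite /torus2_phase/= !mulrzDr; ring.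
  rewrite cosB cosD sinB sinD /T.
  set a := cos _; set b := sin _; set a' := cos _; set b' := sin _; by field.
have wi m b : mu.-integrable setT (EFin \o w m b) by exact: torus_cos_integrable.
have Fi (t : R * (int * int) * R) : mu.-integrable setT (EFin \o (fun z => t.1.1 * w t.1.2 t.2 z)).
  have := integrableZl measurableT t.1.1 (wi t.1.2 t.2).
  by apply: eq_integrable => // z _; rewrite /= EFinM.
have [I1 I2] := Rintegral_sum F Fi.
rewrite E; split; first exact: I1.
rewrite I2 (eq_bigr (fun t : R * (int * int) * R => t.1.1 * ((t.1.2 == (0, 0))%:R * cos t.2))); last first.
  by move=> t _; rewrite RintegralZl// torus_cos.
rewrite /F !big_cons big_nil /= cosN cos_pihalf cos0 !mulr0 !mulr1 !addr0.
rewrite index_subr_eq0 index_addr_eq0.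
have [ln|_] := eqVneq l (- k.1, - k.2).
  have cl : c l = c k by rewrite ln cos_coefN.
  have sl : s l = - s k by rewrite ln sin_coefN.
  (* Both deltas are 1 when k = -k; the sine coefficient then vanishes by oddness. *)
  have [lk|_] := eqVneq l k; rewrite cl sl /=; last by field.
  have -> : s k = 0 by move: sl; rewrite lk; lra.
  by field.
by have [->|_] := eqVneq l k; rewrite /=; field.
Qed.

(** Expanding the integral of [(f - S)^2 >= 0], with S the partial Fourier sum, gives the cross term
    exactly, while the integral of [S^2] is at most the sum on the left. *)
Lemma bessel n : square_sum (fun k => c k ^+ 2 + s k ^+ 2) n <= L2_norm2 f ^+ 2.
Proof.
pose S z := square_sum (fun k => T k z) n.
have [fS1 fS2] := Rintegral_square_sum n (fun k => (mul_term_integral k).1).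
have TT k := Rintegral_square_sum n (fun l => (term_term_integral k l).1).
have [SS1 SS2] := Rintegral_square_sum n (fun k => (TT k).1).
have fSE z : square_sum (fun k => f z * T k z) n = f z * S z by rewrite square_sumZ.
have SSE z : square_sum (fun k => square_sum (fun l => T k z * T l z) n) n = S z * S z.
  rewrite -square_sumZ; apply: eq_square_sum => k.
  by rewrite square_sumZ mulrC.
have ff := Lfun2_integrable_sqr fL2.
have i1 : mu.-integrable setT (EFin \o (fun z => f z * S z)).
  by move: fS1; apply: eq_integrable => // z _; rewrite /= fSE.
have i2 : mu.-integrable setT (EFin \o (fun z => S z * S z)).
  by move: SS1; apply: eq_integrable => // z _; rewrite /= SSE.
have i3 : mu.-integrable setT (EFin \o (fun z => - 2 * (f z * S z))).
  have := integrableZl measurableT (- 2) i1.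
  by apply: eq_integrable => // z _; rewrite /= EFinM.
have i4 : mu.-integrable setT (EFin \o (fun z => f z ^+ 2 + - 2 * (f z * S z))).
  have := integrableD measurableT ff i3.
  by apply: eq_integrable => // z _; rewrite /= EFinD.
have : 0 <= \int[mu]_z ((f z ^+ 2 + - 2 * (f z * S z)) + S z * S z).
  apply: Rintegral_ge0 => z _; rewrite (_ : _ + _ = (f z - S z) ^+ 2) ?sqr_ge0//.
  ring.
rewrite RintegralD// RintegralD// RintegralZl// -L2_norm2_sqr.
have -> : \int[mu]_z (f z * S z) = square_sum (fun k => c k ^+ 2 + s k ^+ 2) n.
  transitivity (\int[mu]_z square_sum (fun k => f z * T k z) n).
    by apply: eq_Rintegral => z _; rewrite fSE.
  rewrite fS2; apply: eq_square_sum => k; exact: (mul_term_integral k).2.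
(* The double counting of k and -k is compensated by the factor 1/2 of [term_term_integral]: each of
   the two deltas sums to at most 1. *)
have : \int[mu]_z (S z * S z) <= square_sum (fun k => c k ^+ 2 + s k ^+ 2) n.
  have -> : \int[mu]_z (S z * S z) =
      \int[mu]_z square_sum (fun k => square_sum (fun l => T k z * T l z) n) n.
    by apply: eq_Rintegral => z _; rewrite SSE.
  rewrite SS2; apply: ler_square_sum => k; rewrite (TT k).2.
  rewrite (eq_square_sum (U := fun l => (c k ^+ 2 + s k ^+ 2) / 2 *
      ((l == k)%:R + (l == (- k.1, - k.2))%:R))); last first.
    by move=> l; rewrite (term_term_integral k l).2.
  rewrite square_sumZ square_sumD -[leRHS](divfK (_ : 2 != 0 :> R))//.
  rewrite ler_wpM2l//; last first.
    by have := square_sum_delta R k n; have := square_sum_delta R (- k.1, - k.2) n; lra.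
  by rewrite divr_ge0// addr_ge0 ?sqr_ge0.
lra.
Qed.

(** Cauchy-Schwarz followed by Bessel. From [(|c| + |s|)^2 <= 2 (c^2 + s^2)] the factor would be
    sqrt 2; it is rounded up to 2. *)
Lemma fourier_sum_bound (U b : int * int -> R) (B : R) n :
  (forall k, `|U k| <= b k * (`|c k| + `|s k|)) -> 0 <= B ->
  square_sum (fun k => b k ^+ 2) n <= B ^+ 2 ->
  `|square_sum U n| <= 2 * B * L2_norm2 f.
Proof.
move=> Ub B0 bB.
have L0 := L2_norm2_ge0.
apply: le_trans (ler_norm_square_sum _ _) _.
apply: (@le_trans _ _ (square_sum (fun k => `|b k * (`|c k| + `|s k|)|) n)).
  by apply: ler_square_sum => k; apply: le_trans (Ub k) (ler_norm _).
rewrite -(@ler_pXn2r _ 2)// ?nnegrE ?mulr_ge0 ?square_sum_ge0//.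
apply: le_trans (square_sum_CS _ _ _) _.
rewrite (_ : (_ * L2_norm2 f) ^+ 2 = B ^+ 2 * (4 * L2_norm2 f ^+ 2)); last by ring.
apply: ler_pM => //.
- by apply: square_sum_ge0 => k; exact: sqr_ge0.
- by apply: square_sum_ge0 => k; exact: sqr_ge0.
apply: (@le_trans _ _ (square_sum (fun k => 2 * (c k ^+ 2 + s k ^+ 2)) n)).
  apply: ler_square_sum => k.
  rewrite -(real_normK (num_real (c k))) -(real_normK (num_real (s k))).
  by have := sqr_ge0 (`|c k| - `|s k|); lra.
rewrite square_sumZ; have := bessel n; have := sqr_ge0 (L2_norm2 f); lra.
Qed.

End Bessel.

(** * Gaussian averages of trigonometric functions *)

Section IntegralLine.
Variable R : realType.

Lemma is_derive_scaled_sqr (c x : R) :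
  is_derive x (1 : R) (fun y => c * y ^+ 2) (2 * c * x).
Proof.
have h := is_deriveZ c (is_deriveM (is_derive_id x (1 : R)) (is_derive_id x (1 : R))).
have -> : (fun y => c * y ^+ 2) = c *: (@id R * @id R).
  by apply/funext => y; rewrite !fctE /GRing.scale/= expr2.
by apply: (is_derive_eq h); rewrite /GRing.scale/=; ring.
Qed.

Lemma norm_le_harmonic_cvg0 (u : nat -> R) (M : R) :
  (forall n, `|u n| <= M * harmonic n) -> u @ \oo --> (0 : R).
Proof.
move=> uM; apply/norm_cvg0P.
have Mc : (fun n : nat => M * harmonic n) @ \oo --> (0 : R).
  rewrite -(mulr0 M); apply: cvgMr; exact: cvg_harmonic.
apply: (squeeze_cvgr _ (cvg_cst 0) Mc).
by apply: nearW => n; rewrite /= normr_ge0 uM.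
Qed.

Lemma is_derive_quadratic (F : R -> R) (a D C : R) :
  (forall h, `|F (h + a) - (F a + h * D)| <= C * `|h| ^+ 2) ->
  is_derive a (1 : R) F D.
Proof.
move=> FC; pose L (h : R^o) : R^o := h * D.
have Llin : linear L by move=> c u v; rewrite /L mulrDl -scalerAl.
pose L' : {linear R^o -> R^o} := HB.pack L (GRing.isLinear.Build _ _ _ _ L Llin).
have Lc : continuous L' by exact: mulrr_continuous.
have [dF dE] := @differentiable_quadratic _ R^o R^o F L' a 1 C ltr01 Lc (fun h _ => FC h).
apply: DeriveDef; first exact/derivable1_diffP.
by rewrite deriveE// dE /L' /= /L mul1r.
Qed.

(** The fundamental theorem on growing symmetric intervals, with |g| as dominating function. *)
Lemma integral_derive_line (G g : R -> R) :
  lebesgue_measure.-integrable setT (EFin \o g) ->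
  (forall x, is_derive x (1 : R) G (g x)) -> continuous g ->
  (fun n : nat => G n.+1%:R - G (- n.+1%:R)) @ \oo --> (0 : R) ->
  (\int[lebesgue_measure]_x (g x)%:E = 0)%E.
Proof.
move=> gi dG cg G0.
pose D (n : nat) : set R := `[- n.+1%:R, n.+1%:R]%classic.
pose f_ (n : nat) (x : R) : \bar R := ((EFin \o g) \_ (D n)) x.
have mg : measurable_fun setT (EFin \o g) by exact: measurable_int gi.
have mf n : measurable_fun setT (f_ n).
  by apply/(measurable_restrictT _ (measurable_itv _)); exact: measurable_funTS.
have fint n : (\int[lebesgue_measure]_x f_ n x = (G n.+1%:R - G (- n.+1%:R))%:E)%E.
  have n0 : - n.+1%:R < n.+1%:R :> R by have := ltr0Sn R n; lra.
  by rewrite -integral_mkcond /D (integral_derive n0 (fun x _ => dG x) (fun x _ => cg x)).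
have [|||_ _] := @dominated_convergence _ _ _ lebesgue_measure setT measurableT
    f_ (EFin \o g) (fun x => `|(g x)%:E|%E) mf mg.
- apply: aeW => x _; apply: cvg_near_cst.
  near=> n; rewrite /f_ patchE ifT// inE /D /= in_itv /= -ler_norml.
  apply: (@le_trans _ _ n%:R); last by rewrite ler_nat.
  by near: n; exact: nbhs_infty_ger.
- exact: (integrable_abse gi).
- apply: aeW => x n _; rewrite /f_ patchE; case: ifP => // _.
  by rewrite abse0.
move=> cvgf.
have cvg0 : (fun n => \int[lebesgue_measure]_x f_ n x)%E @ \oo --> (0 : \bar R)%E.
  under eq_fun do rewrite fint.
  by apply: cvg_EFin; [exact: nearW|exact: G0].
exact: (cvg_unique _ cvgf cvg0).
Unshelve. all: by end_near. Qed.

End IntegralLine.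

(** * Integration against a centred normal law *)

Section Normal.
Variables (R : realType) (sigma : R).
Hypothesis sigma_gt0 : 0 < sigma.

Local Notation la := (@lebesgue_measure R).
Local Notation N := (normal_prob 0 sigma).
Local Notation p := (normal_pdf 0 sigma).

Let sigma_neq0 : sigma != 0. Proof. exact: lt0r_neq0. Qed.

(** Change of variables is available for the Radon-Nikodym derivative; it agrees almost everywhere
    with the explicit density because both have the same integral over every measurable set. *)
Lemma normal_density_ae :
  ae_eq la setT (Radon_Nikodym_SigmaFinite.f N la) (EFin \o p).
Proof.
apply: integral_ae_eq => //.
- apply: Radon_Nikodym_SigmaFinite.f_integrable; exact: normal_prob_dominates.
- by apply/measurable_EFinP; exact: measurable_normal_pdf.
- move=> A _ mA; rewrite -Radon_Nikodym_SigmaFinite.f_integral//.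
  exact: normal_prob_dominates.
Qed.

Lemma ge0_integral_normal (f : R -> \bar R) : measurable_fun setT f ->
  (forall x, 0 <= f x)%E ->
  (\int[N]_x f x = \int[la]_x (f x * (p x)%:E))%E.
Proof.
move=> mf f0.
rewrite -(Radon_Nikodym_SigmaFinite.change_of_variables (normal_prob_dominates _ _))//.
apply: ae_eq_integral => //.
- apply: emeasurable_funM => //; apply: measurable_int.
  by apply: Radon_Nikodym_SigmaFinite.f_integrable; exact: normal_prob_dominates.
- apply: emeasurable_funM => //; apply/measurable_EFinP; exact: measurable_normal_pdf.
- by apply: filterS normal_density_ae => x /= + _ => ->.
Qed.

Lemma normal_integrable (f : R -> R) : measurable_fun setT f ->
  (N.-integrable setT (EFin \o f) <-> la.-integrable setT (EFin \o (fun x => f x * p x))).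
Proof.
move=> mf; have mp : measurable_fun setT (fun x => f x * p x).
  by apply: measurable_funM => //; exact: measurable_normal_pdf.
have E : (\int[N]_x `|(EFin \o f) x| = \int[la]_x `|(EFin \o (fun x => f x * p x)%R) x|)%E.
  rewrite ge0_integral_normal//.
    by apply: eq_integral => x _; rewrite /= normrM (ger0_norm (normal_pdf_ge0 _ _ _)).
  by apply/measurable_EFinP; apply: measurableT_comp.
split => /integrableP[_ h]; apply/integrableP; split.
- exact/measurable_EFinP.
- by rewrite -E.
- exact/measurable_EFinP.
- by rewrite E.
Qed.

Lemma Rintegral_normal (f : R -> R) : measurable_fun setT f ->
  N.-integrable setT (EFin \o f) ->
  \int[N]_x f x = \int[la]_x (f x * p x).
Proof.
move=> mf fi; rewrite /Rintegral; congr fine.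
have pos (h : R -> \bar R) : measurable_fun setT h -> (forall x, 0 <= h x)%E ->
    (\int[N]_x h x = \int[la]_x (h x * (p x)%:E))%E by exact: ge0_integral_normal.
have mef : measurable_fun setT (EFin \o f) by exact/measurable_EFinP.
rewrite integralE pos//; last exact: measurable_funepos.
rewrite pos//; last exact: measurable_funeneg.
rewrite [RHS]integralE; congr (_ - _)%E; apply: eq_integral => x _.
- by rewrite !funeposE -!EFin_max -EFinM maxr_pMl ?normal_pdf_ge0// mul0r.
- by rewrite !funenegE -!EFinN -!EFin_max -EFinM maxr_pMl ?normal_pdf_ge0// mul0r mulNr.
Qed.

(** Half of the Gaussian exponent absorbs [x^2] through [u exp (-u) <= 1] with
    [u = x^2 / (4 sigma^2)]; the other half is a normal density of twice the variance. This gives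
    both the second moment and the boundary terms at infinity. *)
Lemma normal_pdf_decay : exists2 K, 0 <= K &
  forall x, x ^+ 2 * p x <= K * normal_pdf 0 (sigma * Num.sqrt 2) x.
Proof.
have s20 : sigma * Num.sqrt 2 != 0 by rewrite mulf_neq0// sqrtr_eq0 -ltNge.
pose q := normal_peak (sigma * Num.sqrt 2).
have q0 : 0 < q by exact: normal_peak_gt0.
exists (4 * sigma ^+ 2 * normal_peak sigma / q).
  by rewrite divr_ge0 ?(ltW q0)// mulr_ge0 ?normal_peak_ge0// mulr_ge0 ?sqr_ge0.
move=> x; rewrite !normal_pdfE// -/q /normal_fun subr0.
set k := normal_peak sigma.
rewrite [leRHS]mulrA divfK ?lt0r_neq0//.
have -> : - x ^+ 2 / ((sigma * Num.sqrt 2) ^+ 2 *+ 2) = - (x ^+ 2 / (4 * sigma ^+ 2)).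
  rewrite exprMn sqr_sqrtr// -mulr_natr.
  by field.
have -> : - x ^+ 2 / (sigma ^+ 2 *+ 2) =
    - (x ^+ 2 / (4 * sigma ^+ 2)) + - (x ^+ 2 / (4 * sigma ^+ 2)).
  by rewrite -mulr_natr; field.
set u := x ^+ 2 / (4 * sigma ^+ 2).
have -> : x ^+ 2 = 4 * sigma ^+ 2 * u by rewrite /u; field.
rewrite expRD.
have ue : u * expR (- u) <= 1.
  rewrite expRN ler_pdivrMr ?expR_gt0// mul1r.
  by apply: le_trans (expR_ge1Dx u); rewrite lerDr.
have -> : 4 * sigma ^+ 2 * u * (k * (expR (- u) * expR (- u))) =
  (u * expR (- u)) * (4 * sigma ^+ 2 * k * expR (- u)) by ring.
rewrite -[leRHS]mul1r ler_wpM2r// mulr_ge0 ?expR_ge0// mulr_ge0 ?normal_peak_ge0//.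
by rewrite mulr_ge0 ?sqr_ge0.
Qed.

Lemma normal_sqr_integrable : N.-integrable setT (EFin \o (fun x : R => x ^+ 2)).
Proof.
have m2 : measurable_fun setT (fun x : R => x ^+ 2) by exact: measurable_funX.
apply/normal_integrable => //; have [K K0 hK] := normal_pdf_decay.
have := integrableZl measurableT K (@integrable_normal_pdf R 0 (sigma * Num.sqrt 2)).
apply: le_integrable => //.
- by apply/measurable_EFinP; apply: measurable_funM => //; exact: measurable_normal_pdf.
- move=> x _; rewrite /= lee_fin !ger0_norm ?hK// mulr_ge0 ?sqr_ge0 ?normal_pdf_ge0//.
Qed.

Lemma normal_linear_growth_integrable (f : R -> R) : measurable_fun setT f ->
  (forall x, `|f x| <= 1 + x ^+ 2) -> N.-integrable setT (EFin \o f).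
Proof.
move=> mf fle.
have i1 : N.-integrable setT (EFin \o cst (1 : R)).
  by apply: (@bounded_integrable _ _ _ N _ 1) => // x; rewrite normr1.
have := integrableD measurableT i1 normal_sqr_integrable.
apply: le_integrable => //; first exact/measurable_EFinP.
move=> x _; rewrite /= lee_fin [leRHS]ger0_norm; first exact: fle.
by rewrite addr_ge0 ?sqr_ge0.
Qed.

Lemma normal_cos_integrable a b :
  N.-integrable setT (EFin \o (fun x : R => cos (a * x + b))).
Proof.
apply: (@bounded_integrable _ _ _ N _ 1); last by move=> x; exact: norm_cos_le1.
by apply: measurable_cos_comp; exact: measurable_affine.
Qed.

Lemma measurable_id_sin (a b : R) :
  measurable_fun setT (fun x : R => x * sin (a * x + b)).
Proof.
by apply: measurable_funM => //; apply: measurable_sin_comp; exact: measurable_affine.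
Qed.

Lemma normal_id_sin_integrable a b :
  N.-integrable setT (EFin \o (fun x : R => x * sin (a * x + b))).
Proof.
apply: normal_linear_growth_integrable; first exact: measurable_id_sin.
move=> x; rewrite normrM; apply: (@le_trans _ _ `|x|).
  by rewrite ler_piMr ?norm_sin_le1.
by rewrite -(real_normK (num_real x)); have := sqr_ge0 (1 - `|x|); have := sqr_ge0 `|x|; lra.
Qed.

Lemma is_derive_normal_pdf (x : R) :
  is_derive x (1 : R) p (- (x / sigma ^+ 2) * p x).
Proof.
rewrite normal_pdfE// /normal_fun.
set c := - (sigma ^+ 2 *+ 2)^-1.
have -> : (fun x : R => normal_peak sigma * expR (- (x - 0) ^+ 2 / (sigma ^+ 2 *+ 2))) =
  normal_peak sigma *: (expR \o (fun y => c * y ^+ 2)).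
  apply/funext => y; rewrite !fctE /GRing.scale/= subr0; congr (_ * expR _).
  by rewrite /c; ring.
have h := is_deriveZ (normal_peak sigma)
  (is_derive1_comp (is_derive_expR _) (is_derive_scaled_sqr c x)).
apply: (is_derive_eq h); rewrite /GRing.scale /= subr0.
have -> : - x ^+ 2 / (sigma ^+ 2 *+ 2) = c * x ^+ 2 by rewrite /c; ring.
have -> : - (x / sigma ^+ 2) = 2 * c * x by rewrite /c -mulr_natr; field.
by ring.
Qed.

(* Stein's identity: the integrand is the derivative of [- sigma^2 sin (a x + b) p x]. *)
Lemma normal_stein a b :
  \int[N]_x (x * sin (a * x + b)) = sigma ^+ 2 * a * \int[N]_x cos (a * x + b).
Proof.
pose g x := (x * sin (a * x + b) - sigma ^+ 2 * a * cos (a * x + b)) * p x.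
have i1 := normal_id_sin_integrable a b; have i2 := normal_cos_integrable a b.
have i3 : N.-integrable setT (EFin \o (fun x => sigma ^+ 2 * a * cos (a * x + b))).
  have := integrableZl measurableT (sigma ^+ 2 * a) i2.
  by apply: eq_integrable => // z _; rewrite /= EFinM.
have i4 : N.-integrable setT (EFin \o (fun x => x * sin (a * x + b) - sigma ^+ 2 * a * cos (a * x + b))).
  have := integrableB measurableT i1 i3.
  by apply: eq_integrable => // z _; rewrite /= EFinB.
have m4 : measurable_fun setT (fun x : R => x * sin (a * x + b) - sigma ^+ 2 * a * cos (a * x + b)).
  by move: (measurable_int _ i4) => /measurable_EFinP.
apply/eqP; rewrite -subr_eq0 -RintegralZl// -RintegralB//.
rewrite Rintegral_normal// /Rintegral.
pose G x := - sigma ^+ 2 * (sin (a * x + b) * p x).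
suff -> : (\int[la]_x (g x)%:E = 0)%E by [].
apply: (@integral_derive_line _ G g).
- exact/(normal_integrable m4).
- move=> x.
  have h := is_deriveM (is_derive_sin_affine a b x) (is_derive_normal_pdf x).
  have h2 := is_deriveZ (- sigma ^+ 2) h.
  apply: (is_derive_eq h2); rewrite /GRing.scale /= /g.
  by field.
- move=> x; apply: cvgM; last exact: continuous_normal_pdf.
  have cs : {for x, continuous (fun x => sin (a * x + b))}.
    by apply: (@continuous_comp _ _ _ (fun x => a * x + b) sin); [exact: continuous_affine|exact: continuous_sin].
  have cc : {for x, continuous (fun x => cos (a * x + b))}.
    by apply: (@continuous_comp _ _ _ (fun x => a * x + b) cos); [exact: continuous_affine|exact: continuous_cos].
  apply: cvgB; first by apply: cvgM => //; exact: cvg_id.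
  by apply: cvgM => //; exact: cvg_cst.
(* Since [x^2 p x] is bounded, G is O(1 / |x|), and the boundary terms tend to 0. *)
- have [K K0 hK] := normal_pdf_decay.
  pose M := 2 * sigma ^+ 2 * (K * normal_peak (sigma * Num.sqrt 2)).
  have pb (x : R) : 1 <= `|x| -> `|G x| <= sigma ^+ 2 * (K * normal_peak (sigma * Num.sqrt 2)) / `|x|.
    move=> x1; rewrite /G normrM normrN (ger0_norm (sqr_ge0 sigma)) -mulrA ler_wpM2l ?sqr_ge0//.
    rewrite normrM (ger0_norm (normal_pdf_ge0 _ _ _)).
    have x0 : 0 < `|x| by lra.
    rewrite ler_pdivlMr//.
    have s20 : sigma * Num.sqrt 2 != 0 by rewrite mulf_neq0// sqrtr_eq0 -ltNge.
    have h1 : x ^+ 2 * p x <= K * normal_peak (sigma * Num.sqrt 2).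
      by apply: le_trans (hK x) _; rewrite ler_wpM2l// normal_pdf_ub.
    apply: le_trans h1; rewrite -(real_normK (num_real x)) expr2.
    have := norm_sin_le1 (a * x + b); have := normr_ge0 (sin (a * x + b)).
    have := normal_pdf_ge0 0 sigma x; set s := `|sin _|; set q := p x => q0 s0 s1.
    have xq : 0 <= `|x| * q by rewrite mulr_ge0.
    apply: (@le_trans _ _ (1 * (`|x| * q))).
      by rewrite -mulrA [q * _]mulrC ler_wpM2r.
    by rewrite -mulrA ler_wpM2r.
  apply: (@norm_le_harmonic_cvg0 _ _ M) => n.
  apply: le_trans (ler_normB _ _) _.
  have n1 : 1 <= n.+1%:R :> R by rewrite ler1n.
  have nn : `|n.+1%:R : R| = n.+1%:R by rewrite ger0_norm.
  have := pb n.+1%:R; have := pb (- n.+1%:R); rewrite normrN nn => /(_ n1) h1 /(_ n1) h2.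
  apply: le_trans (lerD h2 h1) _.
  set X := sigma ^+ 2 * (K * _).
  have -> : M = X + X by rewrite /M /X; ring.
  by rewrite mulrDl.
Qed.

(** The Taylor error of the cosine is at most [h^2 x^2], whose mean is finite, so the derivative
    passes under the integral; Stein's identity then closes a differential equation in a. *)
Lemma normal_cos_is_derive b (a : R) :
  is_derive a (1 : R) (fun a => \int[N]_x cos (a * x + b))
    (- (sigma ^+ 2 * a * \int[N]_x cos (a * x + b))).
Proof.
pose I a := \int[N]_x cos (a * x + b).
pose J := \int[N]_x (x * sin (a * x + b)).
pose m2 := \int[N]_x (x ^+ 2).
apply: (@is_derive_quadratic _ I a _ m2) => h.
  have i1 := normal_cos_integrable a b; have i2 := normal_cos_integrable (h + a) b.
  have i3 := normal_id_sin_integrable a b.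
  have i4 : N.-integrable setT (EFin \o (fun x => - h * (x * sin (a * x + b)))).
    have := integrableZl measurableT (- h) i3.
    by apply: eq_integrable => // z _; rewrite /= EFinM.
  have i5 : N.-integrable setT (EFin \o (fun x => cos (a * x + b) + - h * (x * sin (a * x + b)))).
    have := integrableD measurableT i1 i4.
    by apply: eq_integrable => // z _; rewrite /= EFinD.
  have i6 : N.-integrable setT (EFin \o (fun x => cos ((h + a) * x + b) -
      (cos (a * x + b) + - h * (x * sin (a * x + b))))).
    have := integrableB measurableT i2 i5.
    by apply: eq_integrable => // z _; rewrite /= EFinB.
  rewrite -normal_stein -/J.
  have -> : I (h + a) - (I a + h * - J) = \int[N]_x (cos ((h + a) * x + b) -
      (cos (a * x + b) + - h * (x * sin (a * x + b)))).
    by rewrite RintegralB// RintegralD// RintegralZl// mulrN -mulNr.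
  apply: (le_trans (le_normr_Rintegral measurableT i6)).
  rewrite mulrC -RintegralZl//; last exact: normal_sqr_integrable.
  apply: le_Rintegral => //.
  - exact: (integrable_norm i6).
  - have := integrableZl measurableT (`|h| ^+ 2) normal_sqr_integrable.
    by apply: eq_integrable => // z _; rewrite /= EFinM.
  - move=> x _; have := cos_taylor (a * x + b) (h * x).
    have -> : a * x + b + h * x = (h + a) * x + b by ring.
    by rewrite normrM exprMn (real_normK (num_real x)); congr (`|_| <= _); ring.
Qed.

(** Multiplication by the integrating factor [exp (sigma^2 a^2 / 2)] makes the solution of that
    equation constant in a, with value [cos b] at a = 0. *)
Lemma normal_cos a b :
  \int[N]_x cos (a * x + b) = expR (- (sigma ^+ 2 * a ^+ 2 / 2)) * cos b.
Proof.
pose I a := \int[N]_x cos (a * x + b).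
pose e a := expR (sigma ^+ 2 / 2 * a ^+ 2).
have de x : is_derive x (1 : R) e (sigma ^+ 2 * x * e x).
  have h := is_derive1_comp (is_derive_expR _) (is_derive_scaled_sqr (sigma ^+ 2 / 2) x).
  by apply: (is_derive_eq h); rewrite /e; field.
have d0 x : is_derive x (1 : R) (I * e) 0.
  have h := is_deriveM (normal_cos_is_derive b x) (de x).
  apply: (is_derive_eq h); rewrite /GRing.scale/= -/(I x).
  by ring.
have := @is_derive_0_is_cst _ (I * e) a 0 d0.
rewrite !fctE /e expr0n/= mulr0 expR0 mulr1.
have -> : I 0 = cos b.
  rewrite /I (_ : (fun x => _) = cst (cos b)); last first.
    by apply/funext => x; rewrite mul0r add0r.
  by rewrite Rintegral_cst//= probability_setT/= mulr1.
move=> <-; rewrite -/(I a) mulrC mulrAC -mulrA -expRD.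
rewrite (_ : _ + _ = 0) ?expR0 ?mulr1//; by field.
Qed.

Lemma normal_mean : \int[N]_x x = 0.
Proof.
(* For a = 0 and b = pi/2 the sine in Stein's identity is identically 1. *)
have := normal_stein 0 (pi / 2); rewrite mulr0 mul0r => E; rewrite -[RHS]E.
by apply: eq_Rintegral => x _; rewrite mul0r add0r sin_pihalf mulr1.
Qed.

End Normal.

(** * Riemann sums of functions singular at 0 *)

Section RightRiemannSums.
Variable R : realType.
Local Notation la := (@lebesgue_measure R).

Lemma inv_sqrt_integral_bound (e t : R) : 0 < e -> e < t ->
  (\int[la]_(x in `[e, t]) (Num.sqrt x)^-1%:E <= (2 * Num.sqrt t)%:E)%E.
Proof.
move=> e0 et.
have pos x : e <= x <= t -> 0 < x by move=> /andP[ex _]; exact: lt_le_trans ex.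
have hd (x : R) : e <= x <= t -> is_derive x (1 : R) (2 *: @Num.sqrt R) (Num.sqrt x)^-1.
  move=> /pos x0; have h := is_deriveZ 2 (is_derive1_sqrt x0).
  by apply: (is_derive_eq h); rewrite /GRing.scale/= invfM mulrA divff ?mul1r.
have hc (x : R) : e <= x <= t -> {for x, continuous (fun y : R => (Num.sqrt y)^-1)}.
  move=> /pos x0; apply: cvgV; first by rewrite gt_eqF// sqrtr_gt0.
  exact: sqrt_continuous.
rewrite (integral_derive et hd hc) lee_fin !fctE /GRing.scale/=.
by rewrite gerBl mulr_ge0// sqrtr_ge0.
Qed.

Lemma measurable_inv_sqrt (D : set R) : measurable D -> D `<=` `]0, +oo[%classic ->
  measurable_fun D (fun x : R => (Num.sqrt x)^-1).
Proof.
move=> mD D0.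
suff h : measurable_fun (`]0, +oo[%classic : set R) (fun x : R => (Num.sqrt x)^-1).
  by apply: measurable_funS h => //; exact: measurable_itv.
apply: open_continuous_measurable_fun; first exact: interval_open.
move=> x; rewrite inE /= in_itv /= andbT => x0.
by apply: cvgV; [rewrite gt_eqF// sqrtr_gt0|exact: sqrt_continuous].
Qed.

Lemma inv_sqrt_integrable (t : R) : 0 < t ->
  la.-integrable `]0, t] (fun x => (Num.sqrt x)^-1%:E).
Proof.
move=> t0; apply/integrableP; split.
  apply/measurable_EFinP; apply: measurable_inv_sqrt; first exact: measurable_itv.
  by move=> x /=; rewrite !in_itv /= andbT => /andP[].
(* With [n.+2] the left end is strictly below t already for n = 0. *)
pose F (n : nat) : set R := `[t / n.+2%:R, t]%classic.
have FE : \bigcup_n F n = `]0, t]%classic.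
  apply/seteqP; split=> [x [n _]|x].
    rewrite /F /= !in_itv /= => /andP[h ->]; rewrite andbT.
    by apply: lt_le_trans h; rewrite divr_gt0.
  rewrite /= in_itv /= => /andP[x0 xt].
  exists (Num.trunc (t / x)) => //; rewrite /F /= in_itv /= xt andbT.
  rewrite ler_pdivrMr// mulrC -ler_pdivrMr//.
  have := @truncnS_gt _ (t / x); move/ltW => h; apply: le_trans h _.
  by rewrite ler_nat.
have -> : (\int[la]_(x in `]0%R, t]) `|(Num.sqrt x)^-1%:E| = \int[la]_(x in `]0%R, t]) (Num.sqrt x)^-1%:E)%E.
  by apply: eq_integral => x _; rewrite /= ger0_norm// invr_ge0 sqrtr_ge0.
rewrite -FE.
apply: (@le_lt_trans _ _ (2 * Num.sqrt t)%:E); last by rewrite ltry.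
have cv : (\int[la]_(x in F n) (Num.sqrt x)^-1%:E)%E @[n --> \oo] -->
    (\int[la]_(x in \bigcup_n F n) (Num.sqrt x)^-1%:E)%E.
  apply: ge0_nondecreasing_set_cvg_integral.
  - move=> n m nm; apply/subsetPset => x; rewrite /F /= !in_itv /= => /andP[h ->].
    rewrite andbT; apply: le_trans h; rewrite ler_wpM2l ?(ltW t0)//.
    by rewrite lef_pV2 ?posrE// ler_nat.
  - by move=> n; exact: measurable_itv.
  - move=> n; apply/measurable_EFinP; apply: measurable_inv_sqrt; first exact: measurable_itv.
    move=> x; rewrite /F /= !in_itv /= andbT => /andP[h _].
    by apply: lt_le_trans h; rewrite divr_gt0.
  - by move=> n x _; rewrite lee_fin invr_ge0 sqrtr_ge0.
apply: (cvge_to_le cv).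
apply: nearW => n; apply: inv_sqrt_integral_bound.
    by rewrite divr_gt0.
  by rewrite ltr_pdivrMr// ltr_pMr// ltr1n.
Qed.

(* Right endpoints stay away from the singularity of the integrand at 0. *)
Definition right_node (t : R) (n i : nat) : R := i.+1%:R * (t / n.+1%:R).

Definition right_cell (t : R) (n i : nat) : set R :=
  `]i%:R * (t / n.+1%:R), i.+1%:R * (t / n.+1%:R)]%classic.

Definition right_sum (t : R) (g : R -> R) (n : nat) : R :=
  \sum_(i < n.+1) t / n.+1%:R * g (right_node t n i).

(** The Riemann sum is the Lebesgue integral of this step function, to which dominated convergence
    applies. *)
Definition right_step (t : R) (g : R -> R) (n : nat) (s : R) : R :=
  \sum_(i < n.+1) g (right_node t n i) * \1_(right_cell t n i) s.

Lemma right_node_bounds (t : R) n (i : 'I_n.+1) : 0 < t -> 0 < right_node t n i <= t.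
Proof.
move=> t0; rewrite mulr_gt0 ?divr_gt0//=.
rewrite /right_node mulrCA ler_piMr ?(ltW t0)// ler_pdivrMr// mul1r ler_nat.
exact: ltn_ord.
Qed.

(** The node u is within one cell of s, which gives pointwise convergence, and [s <= u] gives
    domination: a bound decreasing in time at u is no larger than at s. *)
Lemma right_step_node (t : R) (g : R -> R) n s : 0 < t -> 0 < s <= t ->
  exists2 u, s <= u <= t /\ u <= s + t * harmonic n & right_step t g n s = g u.
Proof.
move=> t0 /andP[s0 st]; set h := t / n.+1%:R.
have h0 : 0 < h by rewrite divr_gt0.
have ex : exists j : nat, s <= j%:R * h.
  by exists n.+1; rewrite /h mulrCA divff ?mulr1// pnatr_eq0.
(* The least j with [s <= j h] is not 0 because s > 0; its predecessor i indexes the cell containing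
   s. *)
case: (ex_minnP ex) => -[|i] si imin.
  by move: si; rewrite mul0r leNgt s0.
have iN : (i < n.+1)%N.
  by apply: imin; rewrite /h mulrCA divff ?mulr1// pnatr_eq0.
have is_ : i%:R * h < s.
  by rewrite ltNge; apply/negP => /imin; rewrite ltnn.
exists (right_node t n i).
  split; first by rewrite {1}/right_node si; have /andP[] := right_node_bounds (Ordinal iN) t0.
  by rewrite /right_node -/h -natr1 mulrDl mul1r lerD2r ltW.
rewrite /right_step (bigD1 (Ordinal iN))//= big1 ?addr0.
  by rewrite indicE mem_set ?mulr1// /right_cell /= in_itv /= is_ si.
move=> [j jN] /=; rewrite -val_eqE /= => ji.
rewrite indicE memNset ?mulr0// /right_cell /= in_itv /= => /andP[h1 h2].
case: (ltngtP j i) ji => // ij _.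
  have : j.+1%:R * h <= i%:R * h by rewrite ler_wpM2r ?(ltW h0)// ler_nat.
  move: h2 is_; rewrite -/h; lra.
have : i.+1%:R * h <= j%:R * h by rewrite ler_wpM2r ?(ltW h0)// ler_nat.
move: h1 si; rewrite -/h; lra.
Qed.

Lemma right_step_out (t : R) (g : R -> R) n s : 0 < t -> ~~ (0 < s <= t) ->
  right_step t g n s = 0.
Proof.
move=> t0 sn; apply: big1 => i _; rewrite indicE memNset ?mulr0//.
rewrite /right_cell /= in_itv /= => /andP[h1 h2]; case/negP: sn.
have /andP[_ h3] := right_node_bounds i t0.
rewrite (le_trans h2 h3) andbT; apply: le_lt_trans h1.
by rewrite mulr_ge0// divr_ge0 ?(ltW t0).
Qed.

Lemma right_step_integral (t : R) (g : R -> R) n : 0 < t ->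
  la.-integrable setT (EFin \o right_step t g n) /\
  \int[la]_s right_step t g n s = right_sum t g n.
Proof.
move=> t0.
have mc i : measurable (right_cell t n i : set (measurableTypeR R)) by exact: measurable_itv.
have lc i : la (right_cell t n i) = (t / n.+1%:R)%:E.
  rewrite lebesgue_measure_itv /= lte_fin ltr_pM2r ?divr_gt0// ltr_nat ltnSn.
  by rewrite -EFinD -mulrBl -natrB// subSnn mul1r.
have li (i : nat) : (\int[la]_x (\1_(right_cell t n i) x)%:E = (t / n.+1%:R)%:E)%E.
  by rewrite integral_indic// setIT; exact: lc.
have i1 (i : 'I_n.+1) : la.-integrable setT (EFin \o \1_(right_cell t n i)).
  apply/integrableP; split; [apply/measurable_EFinP|].
    by apply: measurable_indic; exact: measurable_itv.
  rewrite (_ : (fun x => _) = (fun x => (\1_(right_cell t n i) x)%:E)); last first.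
    by apply/funext => x; rewrite /= ger0_norm.
  by rewrite li ltry.
have i2 (i : 'I_n.+1) : la.-integrable setT
    (EFin \o (fun s => g (right_node t n i) * \1_(right_cell t n i) s)).
  have := integrableZl measurableT (g (right_node t n i)) (i1 i).
  by apply: eq_integrable => // z _; rewrite /= EFinM.
have [I1 I2] := Rintegral_sum (index_enum 'I_n.+1) i2.
split; first exact: I1.
rewrite I2; apply: eq_bigr => i _; rewrite RintegralZl// mulrC; congr (_ * _).
by rewrite /Rintegral li.
Qed.

Lemma right_sum_cvg (t K : R) (g : R -> R) : 0 < t ->
  {within `]0, t], continuous g} ->
  (forall s, 0 < s <= t -> `|g s| <= K * (Num.sqrt s)^-1) ->
  la.-integrable `]0, t] (EFin \o g) /\
  right_sum t g @ \oo --> \int[la]_(s in `]0, t]) g s.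
Proof.
move=> t0 cg gK.
have mg : measurable_fun `]0, t] g.
  by apply: subspace_continuous_measurable_fun cg; exact: measurable_itv.
have iK : la.-integrable `]0, t] (fun x => (K * (Num.sqrt x)^-1)%:E).
  rewrite (_ : (fun x => _) = (fun x => K%:E * (Num.sqrt x)^-1%:E)%E); last first.
    by apply/funext => x; rewrite EFinM.
  by apply: integrableZl; [exact: measurable_itv|exact: inv_sqrt_integrable].
have ig : la.-integrable `]0, t] (EFin \o g).
  apply: le_integrable iK; first exact: measurable_itv.
  - exact/measurable_EFinP.
  - move=> x; rewrite /= in_itv /= => xt; rewrite lee_fin.
    by apply: le_trans (gK _ xt) (ler_norm _).
split => //.
have mD : measurable (`]0, t]%classic : set (measurableTypeR R)) by exact: measurable_itv.
pose D : (R -> \bar R) := (fun x => (K * (Num.sqrt x)^-1)%:E) \_ `]0, t].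
have iD : la.-integrable setT D by apply/(integrable_mkcond _ mD).
have inE' x : (x \in (`]0, t]%classic : set R)) = (0 < x <= t).
  by rewrite mem_setE in_itv.
have RE n : (\int[la]_x (EFin \o right_step t g n) x = (right_sum t g n)%:E)%E.
  have [I1 I2] := right_step_integral g n t0.
  by rewrite -I2 /Rintegral fineK//; exact: integrable_fin_num.
have -> : (\int[la]_(s in `]0, t]) g s)%R = fine (\int[la]_s ((EFin \o g) \_ `]0%R, t]) s)%E.
  by rewrite -integral_mkcond.
have ifin : (\int[la]_s ((EFin \o g) \_ `]0%R, t]) s)%E \is a fin_num.
  by rewrite -integral_mkcond; exact: integrable_fin_num.
suff H : (fun n => (right_sum t g n)%:E) @ \oo -->
    (\int[la]_s ((EFin \o g) \_ `]0%R, t]) s)%E.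
  by move: H; rewrite -{1}(fineK ifin) => /fine_cvg.
have -> : (fun n => (right_sum t g n)%:E) =
    (fun n => \int[la]_x (EFin \o right_step t g n) x)%E.
  by apply/funext => n; rewrite RE.
apply: (@dominated_cvg _ _ _ la setT measurableT (fun n => EFin \o right_step t g n)
  ((EFin \o g) \_ `]0, t]) D) => //.
- by move=> n; have [I1 _] := right_step_integral g n t0; exact: measurable_int I1.
- move=> s _; rewrite patchE inE'; case: ifPn => st; last first.
    apply: cvg_near_cst; apply: nearW => n /=.
    by rewrite right_step_out.
  apply: cvg_EFin; first exact: nearW.
  have /subspace_continuousP := cg; move=> /(_ s).
  rewrite /= in_itv /= => /(_ st) cs.
  apply/cvgrPdist_lt => e e0; move/cvgrPdist_lt: cs => /(_ e e0).
  rewrite /within /= => /nbhs_ballP[d /= d0 dP].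
  have : (fun n => t * harmonic n) @ \oo --> (0 : R).
    by rewrite -(mulr0 t); apply: cvgMr; exact: cvg_harmonic.
  move/cvgrPdist_lt => /(_ d d0); apply: filterS => n /=.
  rewrite sub0r normrN => hd.
  have [u [/andP[su ut] us] ->] := right_step_node g n t0 st.
  apply: dP; last by rewrite /= in_itv /= ut andbT; case/andP: st => s0 _; exact: lt_le_trans su.
  rewrite /ball /= distrC ger0_norm ?subr_ge0//.
  apply: le_lt_trans hd; apply: le_trans (ler_norm _).
  by rewrite lerBlDl; exact: us.
- by move=> x _; rewrite /D patchE; case: ifP.
- move=> n s _; rewrite /D patchE inE'; case: ifPn => st /=; last first.
    by rewrite right_step_out// normr0.
  rewrite lee_fin; have [u [/andP[su ut] us] ->] := right_step_node g n t0 st.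
  case/andP: st => s0 st; have u0 := lt_le_trans s0 su.
  have K0 : 0 <= K.
    have := gK t; rewrite t0 lexx => /(_ isT) /(le_trans (normr_ge0 _)).
    by rewrite pmulr_lge0// invr_gt0 sqrtr_gt0.
  apply: le_trans (gK u _) _; first by rewrite u0 ut.
  by rewrite ler_wpM2l// lef_pV2 ?posrE ?sqrtr_gt0// ler_wsqrtr.
Qed.

(** The bound depends on g only through K and not on n, so it holds for all Brownian paths at once
    and allows the limit of expectations. *)
Lemma right_sum_bound (t K : R) (g : R -> R) n : 0 < t -> 0 <= K ->
  (forall s, 0 < s <= t -> `|g s| <= K * (Num.sqrt s)^-1) ->
  `|right_sum t g n| <= K * \int[la]_(s in `]0, t]) (Num.sqrt s)^-1.
Proof.
move=> t0 K0 gK.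
have mD : measurable (`]0, t]%classic : set (measurableTypeR R)) by exact: measurable_itv.
have [I1 <-] := right_step_integral g n t0.
apply: (le_trans (le_normr_Rintegral measurableT I1)).
rewrite -RintegralZl//; last exact: inv_sqrt_integrable.
rewrite [leRHS]Rintegral_mkcond.
have inE' x : (x \in (`]0, t]%classic : set R)) = (0 < x <= t).
  by rewrite mem_setE in_itv.
apply: le_Rintegral => //.
- exact: (integrable_norm I1).
- rewrite (_ : _ \o _ = (fun x => (K * (Num.sqrt x)^-1)%:E) \_ `]0, t]); last first.
    by apply/funext => x; rewrite /= !patchE; case: ifP.
  apply/(integrable_mkcond _ mD).
  rewrite (_ : (fun x => _) = (fun x => K%:E * (Num.sqrt x)^-1%:E)%E); last first.
    by apply/funext => x; rewrite EFinM.
  by apply: integrableZl; [exact: measurable_itv|exact: inv_sqrt_integrable].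
- move=> s _; rewrite patchE inE'; case: ifPn => st /=; last first.
    by rewrite right_step_out// normr0.
  have [u [/andP[su ut] us] ->] := right_step_node g n t0 st.
  case/andP: st => s0 st; have u0 := lt_le_trans s0 su.
  apply: le_trans (gK u _) _; first by rewrite u0 ut.
  by rewrite ler_wpM2l// lef_pV2 ?posrE ?sqrtr_gt0// ler_wsqrtr.
Qed.

End RightRiemannSums.

Lemma ae_eq_integrable d (T : measurableType d) (R : realType)
    (mu : {measure set T -> \bar R}) (f g : T -> \bar R) :
  measurable_fun setT f -> ae_eq mu setT f g -> mu.-integrable setT g ->
  mu.-integrable setT f.
Proof.
move=> mf fg /integrableP[mg gi]; apply/integrableP; split => //.
rewrite (ae_eq_integral (fun x => `|g x|%E))//.
- exact: measurableT_comp.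
- exact: measurableT_comp.
- by move: fg; apply: filterS => x /= /[apply] ->.
Qed.

(** * Brownian increments *)

Section Law.
Context d1 d2 (T1 : measurableType d1) (T2 : measurableType d2) (R : realType).
Variables (P : {measure set T1 -> \bar R}) (m : {measure set T2 -> \bar R}).
Variable X : T1 -> T2.
Hypothesis mX : measurable_fun setT X.
Hypothesis PX : forall B, measurable B -> P (X @^-1` B) = m B.

Lemma law_integrable (f : T2 -> R) : measurable_fun setT f ->
  m.-integrable setT (EFin \o f) -> P.-integrable setT (EFin \o (fun w => f (X w))).
Proof.
move=> mf /integrableP[_ fi]; apply/integrableP; split.
  by apply/measurable_EFinP; exact: measurableT_comp mf mX.
have := @ge0_integral_pushforward _ _ _ _ _ _ mX P setT (fun y => `|(f y)%:E|%E) measurableT.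
rewrite preimage_setT => <-//.
- by rewrite (eq_measure_integral m) => // A mA _; exact: PX.
- by apply/measurable_EFinP; apply: measurableT_comp.
Qed.

Lemma law_Rintegral (f : T2 -> R) : measurable_fun setT f ->
  m.-integrable setT (EFin \o f) -> \int[P]_w f (X w) = \int[m]_y f y.
Proof.
move=> mf fi; rewrite /Rintegral; congr fine.
have mef : measurable_fun setT (EFin \o f) by exact/measurable_EFinP.
have := @integral_pushforward _ _ _ _ _ _ mX P setT _ mef (law_integrable mf fi) measurableT.
rewrite preimage_setT => <-.
by apply: eq_measure_integral => A mA _; exact: PX.
Qed.

End Law.

Section GaussianPair.
Context d (T : measurableType d) (R : realType) (P : probability T R).
Variables (sigma : R) (X Y : T -> measurableTypeR R).
Hypothesis sigma_gt0 : 0 < sigma.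
Hypotheses (mX : measurable_fun setT X) (mY : measurable_fun setT Y).
Local Notation N := (normal_prob 0 sigma).
Hypothesis XY : forall A B : set (measurableTypeR R), measurable A -> measurable B ->
  P (X @^-1` A `&` Y @^-1` B) = (N A * N B)%E.

Let XY_pair w := (X w, Y w).

Let mXY : measurable_fun setT XY_pair.
Proof. exact: measurable_fun_pair. Qed.

(** Measurable rectangles determine a measure on the product, so the product rule fixes the joint
    law. *)
Lemma gaussian_pair_law (B : set (measurableTypeR R * measurableTypeR R)) : measurable B ->
  P (XY_pair @^-1` B) = (N \x N)%E B.
Proof.
pose m' : {measure set (measurableTypeR R * measurableTypeR R) -> \bar R} :=
  pushforward P XY_pair.
move=> mB; rewrite (@product_measure_unique _ _ _ _ _ N N (m' mXY))//.
Qed.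

(** Fubini and [normal_cos] twice: the inner integral treats [b y + c] as its phase shift. *)
Lemma gaussian_pair_cos (a b c : R) :
  \int[P]_w cos (a * X w + b * Y w + c) =
  expR (- (sigma ^+ 2 * (a ^+ 2 + b ^+ 2) / 2)) * cos c.
Proof.
pose f (z : measurableTypeR R * measurableTypeR R) : R := cos (a * z.1 + b * z.2 + c).
have mf : measurable_fun setT f.
  apply: measurable_cos_comp; apply: measurable_funD => //.
  by apply: measurable_funD; apply: measurable_funM.
have fi : (N \x N)%E.-integrable setT (EFin \o f).
  by apply: (@bounded_integrable _ _ _ (N \x N)%E _ 1) => // z; exact: norm_cos_le1.
rewrite (@law_Rintegral _ _ _ _ _ P (N \x N)%E XY_pair mXY gaussian_pair_law f mf fi).
rewrite /Rintegral -(integral21_prod_meas1 fi) /fubini_G.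
have E y : (\int[N]_x (EFin \o f) (x, y) =
    (expR (- (sigma ^+ 2 * a ^+ 2 / 2)) * cos (b * y + c))%:E)%E.
  rewrite -(normal_cos sigma_gt0) /Rintegral fineK.
    by apply: eq_integral => x _; rewrite /= /f /= addrA.
  by apply: integrable_fin_num => //; exact: normal_cos_integrable.
under eq_integral do rewrite E.
rewrite -/(Rintegral _ _ _) RintegralZl//; last exact: normal_cos_integrable.
rewrite (normal_cos sigma_gt0) mulrA -expRD; congr (expR _ * _); ring.
Qed.

End GaussianPair.

Section BrownianIncrements.
Context d (T : measurableType d) (R : realType) (P : probability T R).
Variable W : R -> T -> 'rV[R]_3.
Hypothesis BM : brownian_motion P W.

Lemma measurable_increment s t i : 0 <= s -> 0 <= t ->
  measurable_fun setT (increment W s t i : T -> measurableTypeR R).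
Proof.
move=> s0 t0; have [mW _ _ _ _] := BM.
by apply: measurable_funB; exact: mW.
Qed.

Lemma increment_cos s t (a b c : R) : 0 <= s -> s <= t ->
  \int[P]_w cos (a * increment W s t 1 w + b * increment W s t 2 w + c) =
  expR (- ((t - s) * (a ^+ 2 + b ^+ 2) / 2)) * cos c.
Proof.
move=> s0; rewrite le_eqVlt => /predU1P[<-|st].
  rewrite subrr mul0r mul0r oppr0 expR0 mul1r.
  rewrite (_ : (fun w => _) = cst (cos c)); last first.
    by apply/funext => w; rewrite /increment !subrr !mulr0 !add0r.
  by rewrite Rintegral_cst//= probability_setT/= mulr1.
have t0 : 0 <= t by exact: le_trans (ltW st).
have [_ _ _ gW indW] := BM.
have sig0 : 0 < Num.sqrt (t - s) by rewrite sqrtr_gt0 subr_gt0.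
rewrite (@gaussian_pair_cos _ _ _ P (Num.sqrt (t - s)) _ _ sig0
  (measurable_increment 1 s0 t0) (measurable_increment 2 s0 t0)).
  by rewrite sqr_sqrtr// subr_ge0 ltW.
move=> A B mA mB.
(* Independence is stated along an infinite increasing sequence of times; this one starts with s and
   t, and only its first increment is taken. *)
pose tt (k : nat) : R := s + k%:R * (t - s).
have tt0 : 0 <= tt 0%N by rewrite /tt mul0r addr0.
have tti k : tt k < tt k.+1.
  by rewrite /tt ltrD2l ltr_pM2r ?subr_gt0// ltr_nat.
(* The full set at coordinate 0 drops that coordinate from the product rule. *)
pose BB (ki : 'I_1 * 'I_3) : set R := if ki.2 == 1 then A else if ki.2 == 2 then B else setT.
have mBB ki : measurable (BB ki).
  by rewrite /BB; case: ifP => // _; case: ifP.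
have t1 : tt 1%N = t by rewrite /tt mul1r addrC subrK.
have t00 : tt 0%N = s by rewrite /tt mul0r addr0.
have incE (k : 'I_1) i : increment W (tt k) (tt k.+1) i = increment W s t i.
  by rewrite (ord1 k) /= t00 t1.
have := indW 1%N tt tt0 tti BB mBB.
have -> : \bigcap_i ((fun ki : 'I_1 * 'I_3 => increment W (tt ki.1) (tt ki.1.+1) ki.2) i @^-1` BB i) =
    (increment W s t 1 @^-1` A `&` increment W s t 2 @^-1` B).
  apply/seteqP; split => [w h|w [hA hB] [k i] _].
    split.
      by have := h (ord0, 1) I; rewrite /BB /= t00 t1.
    by have := h (ord0, 2) I; rewrite /BB /= t00 t1.
  by rewrite /preimage /= incE /BB /=; case: eqP => [->//|_]; case: eqP => [->//|_].
move=> ->.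
rewrite (eq_bigr (fun ki : 'I_1 * 'I_3 => P (increment W s t ki.2 @^-1` BB ki))); last first.
  by move=> [k i] _; rewrite /= incE.
rewrite -(pair_big xpredT xpredT (fun k i => P (increment W s t i @^-1` BB (k, i)))) /=.
rewrite big_ord1 !big_ord_recl big_ord0 /= /BB /= preimage_setT probability_setT mul1e mule1.
have -> : lift ord0 ord0 = 1 :> 'I_3 by apply: val_inj.
have -> : lift ord0 (lift ord0 ord0) = 2 :> 'I_3 by apply: val_inj.
by rewrite (gW s t 1 A) // (gW s t 2 B).
Qed.

(** The law is prescribed for increments over s < t, so [W t] is compared almost surely with its
    increment from 0, and t = 0 is treated apart. *)
Lemma brownian_integrable t i : 0 <= t ->
  P.-integrable setT (EFin \o (fun w => W t w 0 i)) /\ \int[P]_w W t w 0 i = 0.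
Proof.
have [mW W0 _ gW _] := BM.
rewrite le_eqVlt => /predU1P[<-|t0].
  have ae0 : ae_eq P setT (fun w => (W 0 w 0 i)%:E) (cst 0%E).
    by apply: filterS W0 => w -> _; rewrite mxE.
  have m0 : measurable_fun setT (fun w => (W 0 w 0 i)%:E).
    by apply/measurable_EFinP; exact: mW.
  split.
    by apply: ae_eq_integrable m0 ae0 _; exact: integrable0.
  by rewrite /Rintegral (ae_eq_integral (cst 0%E))// integral0.
have sig0 : 0 < Num.sqrt (t - 0) by rewrite sqrtr_gt0 subr_gt0.
have mi := measurable_increment i (lexx 0) (ltW t0).
have law B : measurable B -> P (increment W 0 t i @^-1` B) = normal_prob 0 (Num.sqrt (t - 0)) B.
  by move=> mB; exact: gW.
have fi : (normal_prob 0 (Num.sqrt (t - 0))).-integrable setT (EFin \o (@id R)).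
  apply: normal_linear_growth_integrable => // x.
  by rewrite -(real_normK (num_real x)); have := sqr_ge0 (1 - `|x|); have := sqr_ge0 `|x|; lra.
have mid : measurable_fun setT (@id R) by [].
have I1 := law_integrable mi law mid fi; have I2 := law_Rintegral mi law mid fi.
have ae0 : ae_eq P setT (fun w => (W t w 0 i)%:E) (fun w => (increment W 0 t i w)%:E).
  by apply: filterS W0 => w h _; rewrite /increment h mxE subr0.
have m0 : measurable_fun setT (fun w => (W t w 0 i)%:E).
  by apply/measurable_EFinP; apply: mW; exact: ltW.
split.
  exact: ae_eq_integrable m0 ae0 I1.
rewrite /Rintegral (ae_eq_integral (fun w => (increment W 0 t i w)%:E))//; last exact: measurable_int I1.
by have := normal_mean sig0; rewrite -I2.
Qed.

End BrownianIncrements.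

(** * The shear flow *)

Section DeriveSlice.
Context (K : numFieldType) (U V W : normedModType K).
Variables (F : V -> W) (i : U -> V) (x v : U) (v' : V).
Hypothesis iE : forall h : K, i (h *: v + x) = h *: v' + i x.

Let quotientE :
  (fun h : K => h^-1 *: (((F \o i) \o shift x) (h *: v) - (F \o i) x)) =
  (fun h : K => h^-1 *: ((F \o shift (i x)) (h *: v') - F (i x))).
Proof. by apply/funext => h /=; rewrite iE. Qed.

(** Fixing the time or the point restricts a space-time function to an affine slice with the same
    difference quotients; this carries derivatives of [heat_series] over to [derive1] and
    [partial]. *)
Lemma derive_slice : 'D_v (F \o i) x = 'D_v' F (i x).
Proof. by rewrite /derive quotientE. Qed.

Lemma derivable_slice : derivable F (i x) v' -> derivable (F \o i) x v.
Proof. by rewrite /derivable quotientE. Qed.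

End DeriveSlice.

(** * The profile solves the heat equation, the flow Navier-Stokes *)

Section ShearProfile.
Variables (R : realType) (nu : R) (f : R * R -> R).
Hypothesis nu_gt0 : 0 < nu.
Hypothesis fL2 : f \in Lfun (torus2_measure R) 2%:E.

Local Notation c := (cos_coef f).
Local Notation s := (sin_coef f).
Local Notation phi := (shear_profile nu f).
Local Notation hs := (heat_series nu).

(** Holds at every t, even where the series may diverge, because both sides are [limn] of the same
    sequence. *)
Lemma shear_profileE t x : phi t x = hs c s (t, x).
Proof.
rewrite /shear_profile /heat /heat_series /square_series; congr (limn _).
apply/funext => n; apply: eq_bigr => i _; apply: eq_bigr => j _.
rewrite /heat_mode /mode; congr (expR _ * _).
by rewrite /rate /sqnorm /=; ring.
Qed.

Lemma tempered_cs : tempered c s. Proof. exact: coef_tempered. Qed.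

Definition evec (j : 'I_3) : R^o * 'rV[R]_3 := (0, delta_mx 0 j).

Lemma derive_time A B t x : tempered A B -> 0 < t ->
  derive1 (fun r => hs A B (r, x)) t =
  hs (dcos nu (1, 0) A B) (dsin nu (1, 0) A B) (t, x).
Proof.
move=> AB t0.
have [_ /(_ (1, 0))] := @heat_series_diff R nu nu_gt0 R^o (hs A B) 1 A B (t, x) AB
  (fun y _ => esym (mulr1 _)) t0.
rewrite /GRing.scale/= mulr1 => <-; rewrite derive1E.
apply: (@derive_slice _ R^o _ R^o (hs A B) (fun r => (r, x))) => h.
by congr pair; rewrite /= scaler0 add0r.
Qed.

Lemma derive_space A B j t x : tempered A B -> 0 < t ->
  partial j (fun y => hs A B (t, y)) x =
  hs (dcos nu (evec j) A B) (dsin nu (evec j) A B) (t, x).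
Proof.
move=> AB t0.
have [_ /(_ (evec j))] := @heat_series_diff R nu nu_gt0 R^o (hs A B) 1 A B (t, x) AB
  (fun y _ => esym (mulr1 _)) t0.
rewrite /GRing.scale/= mulr1 => <-; rewrite /partial.
apply: (@derive_slice _ _ _ R^o (hs A B) (fun y => (t, y))) => h.
by congr pair; rewrite /= scaler0 add0r.
Qed.

Lemma partial_scale j (v : 'rV[R]_3 -> R) (a : R) x : derivable v x (delta_mx 0 j) ->
  partial j (fun y => a * v y) x = a * partial j v x.
Proof. by move=> dv; rewrite /partial (deriveZ a dv). Qed.

Lemma derivable_space A B j t x : tempered A B -> 0 < t ->
  derivable (fun y => hs A B (t, y)) x (delta_mx 0 j : 'rV[R]_3).
Proof.
move=> AB t0.
have [dF _] := @heat_series_diff R nu nu_gt0 R^o (hs A B) 1 A B (t, x) AB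
  (fun y _ => esym (mulr1 _)) t0.
have dd := @diff_derivable _ _ _ (hs A B : R^o * 'rV[R]_3 -> R^o) (t, x) (evec j) dF.
apply: (@derivable_slice _ _ _ R^o (hs A B) (fun y => (t, y)) x _ (evec j)) => // h.
by congr pair; rewrite /= scaler0 add0r.
Qed.

Lemma phase_delta k j : phase k (delta_mx 0 j : 'rV[R]_3) =
  2 * pi * (if j == 1 then k.1 else if j == 2 then k.2 else 0)%:~R.
Proof.
rewrite /phase /torus2_phase /= !mxE /=.
case: j => [[|[|[|//]]] ?]; rewrite /= -?val_eqE /=; ring.
Qed.

Lemma heat_series0 z : hs (fun=> 0) (fun=> 0) z = 0.
Proof.
apply/cvg_lim => //; rewrite (_ : square_sum _ = cst 0); first exact: cvg_cst.
apply/funext => n; rewrite /square_sum big1// => i _; rewrite big1// => j _.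
by rewrite /mode !mul0r addr0 mulr0.
Qed.

Lemma derive_space0 A B t x : tempered A B -> 0 < t ->
  partial 0 (fun y => hs A B (t, y)) x = 0.
Proof.
move=> AB t0; rewrite derive_space// -[RHS](heat_series0 (t, x)).
by congr (hs _ _ _); apply/funext => k; rewrite /dcos /dsin /= phase_delta/= mulr0 !mul0r ?oppr0 ?addr0 ?subr0.
Qed.

Lemma shear_profile_fun t : phi t = (fun y => hs c s (t, y)).
Proof. by apply/funext => y; rewrite shear_profileE. Qed.

Lemma heat_equation t x : 0 < t ->
  derive1 (fun r => phi r x) t = nu * laplacian (phi t) x.
Proof.
move=> t0; have AB := tempered_cs.
rewrite (_ : (fun r => phi r x) = (fun r => hs c s (r, x))); last first.
  by apply/funext => r; rewrite shear_profileE.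
rewrite derive_time// /laplacian shear_profile_fun.
have E j : partial j (partial j (fun y => hs c s (t, y))) x =
    hs (dcos nu (evec j) (dcos nu (evec j) c s) (dsin nu (evec j) c s))
       (dsin nu (evec j) (dcos nu (evec j) c s) (dsin nu (evec j) c s)) (t, x).
  rewrite (_ : partial j (fun y => hs c s (t, y)) =
      (fun y => hs (dcos nu (evec j) c s) (dsin nu (evec j) c s) (t, y))).
    by rewrite derive_space//; exact: tempered_d.
  by apply/funext => y; rewrite derive_space.
rewrite (eq_bigr _ (fun j _ => E j)) !big_ord_recl big_ord0 addr0.
have S j : square_summable (fun k =>
    mode nu (dcos nu (evec j) (dcos nu (evec j) c s) (dsin nu (evec j) c s))
       (dsin nu (evec j) (dcos nu (evec j) c s) (dsin nu (evec j) c s)) k t x).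
  by apply: mode_summable => //; do 2 apply: tempered_d => //.
rewrite /heat_series -!square_seriesD//; last exact: square_summableD.
rewrite -square_seriesZ; last by do 2 apply: square_summableD => //.
congr (limn (square_sum _)); apply/funext => k.
rewrite /mode /dcos /dsin /= !phase_delta /= (_ : phase k 0 = 0); last first.
  by rewrite -(scale0r 0) phaseZ mul0r.
by rewrite /rate /sqnorm; ring.
Qed.

Lemma shear_profile_periodic t : periodic3 (phi t).
Proof.
move=> x j; rewrite !shear_profileE /heat_series /=.
congr (limn (square_sum _)); apply/funext => k.
by rewrite /mode phaseD phase_delta cos_periodz sin_periodz.
Qed.

Lemma shear_flow_coord t i :
  (fun y => shear_flow nu f t y 0 i) = if i == 0 then phi t else cst 0.
Proof.
apply/funext => y; rewrite /shear_flow /e1 !mxE /=.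
by case: (i == 0); rewrite ?mulr1 ?mulr0.
Qed.

Lemma partial_cst j (a : R) x : partial j (cst a) x = 0.
Proof. exact: derive_cst. Qed.

Lemma partial0_shear_flow t i x : 0 < t ->
  partial 0 (fun y => shear_flow nu f t y 0 i) x = 0.
Proof.
move=> t0; rewrite shear_flow_coord; case: ifP => _; last exact: partial_cst.
by rewrite shear_profile_fun derive_space0//; exact: tempered_cs.
Qed.

Lemma shear_flow_coord0 t x i : i != 0 -> shear_flow nu f t x 0 i = 0.
Proof. by move=> i0; rewrite -[LHS]/((fun y => _) x) shear_flow_coord (negbTE i0). Qed.

Lemma advection_shear_flow t x : 0 < t ->
  advection (shear_flow nu f t) (shear_flow nu f t) x = 0.
Proof.
move=> t0; apply/rowP => i; rewrite !mxE (bigD1 0)//= partial0_shear_flow//.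
by rewrite mulr0 add0r big1// => j j0; rewrite shear_flow_coord0// mul0r.
Qed.

Lemma shear_flow_navier_stokes : smooth_navier_stokes nu (shear_flow nu f).
Proof.
have AB := tempered_cs.
split.
- rewrite (_ : (fun z => _) = (fun z => hs c s z *: e1 R)); last first.
    by apply/funext => -[t x]; rewrite /shear_flow shear_profileE.
  exact: heat_series_smooth.
- by move=> t t0 x j; rewrite /shear_flow shear_profile_periodic.
- move=> t x t0; rewrite /divergence (bigD1 0)//= partial0_shear_flow// add0r.
  rewrite big1// => j j0; rewrite shear_flow_coord (negbTE j0); exact: partial_cst.
(* Advection vanishes, so zero pressure works and the momentum equation is the heat equation. *)
- exists (fun _ _ => 0); split => //.
    rewrite (_ : (fun z => _) = (fun z => hs c s z *: (0 : R^o))).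
      exact: heat_series_smooth.
    by apply/funext => z; rewrite scaler0.
  move=> t x i t0; rewrite advection_shear_flow// mxE addr0.
  rewrite (_ : partial i _ x = 0) ?addr0; last exact: partial_cst.
  rewrite shear_flow_coord; have [->|i0] := eqVneq i 0.
    rewrite (_ : (fun r => shear_flow nu f r x 0 0) = (fun r => phi r x)); last first.
      by apply/funext => r; rewrite -[LHS]/((fun y => _) x) shear_flow_coord.
    by rewrite heat_equation// subrr.
  rewrite (_ : (fun r => shear_flow nu f r x 0 i) = cst 0); last first.
    by apply/funext => r; rewrite shear_flow_coord0.
  rewrite derive1_cst /laplacian big1 ?mulr0 ?subrr// => j _.
  rewrite (_ : partial j (cst 0) = cst 0) ?partial_cst//.
  by apply/funext => y; rewrite partial_cst.
Qed.

End ShearProfile.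

(** * Sup and Hoelder bounds for the profile and its gradient *)

Section Bounds.
Variables (R : realType) (nu : R) (f : R * R -> R).
Hypothesis nu_gt0 : 0 < nu.
Hypothesis fL2 : f \in Lfun (torus2_measure R) 2%:E.

Local Notation c := (cos_coef f).
Local Notation s := (sin_coef f).
Local Notation phi := (shear_profile nu f).
Local Notation hs := (heat_series nu).

Lemma four_pi_sq_ge1 : 1 <= 4 * pi ^+ 2 :> R.
Proof.
have : 2 <= pi :> R := pi_ge2 R.
by set p := pi; nra.
Qed.

Lemma pi_sq_rate t k : expR (- (rate nu k * t)) ^+ 2 =
  expR (- (2 * (4 * pi ^+ 2 * (nu * t)) * sqnorm R k)).
Proof. by rewrite expr2 -expRD; congr expR; rewrite /rate; ring. Qed.

Lemma sqrt_sqnorm k : `|k.1%:~R| <= Num.sqrt (sqnorm R k) /\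
  `|k.2%:~R| <= Num.sqrt (sqnorm R k).
Proof.
by split; rewrite -sqrtr_sqr ler_wsqrtr// /sqnorm ?lerDl ?lerDr sqr_ge0.
Qed.

(** The 2 comes from [fourier_sum_bound], the root from [square_sum_gauss_nz] for the squared heat
    factor, whose exponent is at least [2 nu t |k|^2] because 4 pi^2 >= 1. *)
Definition inv_sqrt_const : R := 2 * Num.sqrt (68 / (2 * nu)) * L2_norm2 f.

Lemma inv_sqrt_const_ge0 : 0 <= inv_sqrt_const.
Proof. by rewrite mulr_ge0 ?L2_norm2_ge0// mulr_ge0// sqrtr_ge0. Qed.

(* The zero mode vanishes, whence the decay for large times as well. *)
Lemma shear_profile_bound t x : \int[torus2_measure R]_y f y = 0 -> 0 < t ->
  `|phi t x| <= inv_sqrt_const * (Num.sqrt t)^-1.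
Proof.
move=> f0 t0; rewrite shear_profileE//.
have AB := tempered_cs fL2.
apply: square_series_bound; first exact: (@mode_summable _ _ _ _ _ _ x AB t0).
have c0 : c (0, 0) = 0.
  rewrite -[RHS]f0; apply: eq_Rintegral => z _.
  by rewrite /torus2_phase /= !mul0r addr0 mulr0 cos0 mulr1.
have s0 : s (0, 0) = 0.
  rewrite /sin_coef (_ : (fun z => _) = cst 0) ?Rintegral_cst ?mul0r//.
  by apply/funext => z; rewrite /torus2_phase /= !mul0r addr0 mulr0 sin0 mulr0.
pose b k : R := (k != (0, 0))%:R * expR (- (rate nu k * t)).
move=> n; have -> : inv_sqrt_const * (Num.sqrt t)^-1 =
    2 * Num.sqrt (68 / (2 * nu * t)) * L2_norm2 f.
  rewrite /inv_sqrt_const [68 / (2 * nu * t)](_ : _ = 68 / (2 * nu) * t^-1); last first.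
    by rewrite invfM mulrA.
  have q0 : 0 <= 68 / (2 * nu) by rewrite divr_ge0// mulr_ge0// ltW.
  by rewrite (sqrtrM t^-1 q0) (sqrtrV (ltW t0)); ring.
apply: (fourier_sum_bound fL2 (b := b)); last 2 first.
- exact: sqrtr_ge0.
- rewrite sqr_sqrtr; last by rewrite divr_ge0// !mulr_ge0// ltW.
  pose a := 2 * (4 * pi ^+ 2 * (nu * t)).
  have nt : 0 < nu * t by rewrite mulr_gt0.
  have at_ : 2 * nu * t <= a by rewrite /a; have := four_pi_sq_ge1; set p := 4 * _; nra.
  have a0 : 0 < a by apply: lt_le_trans at_; rewrite !mulr_gt0.
  rewrite (eq_square_sum (U := fun k => (k != (0, 0))%:R * expR (- (a * sqnorm R k)))); last first.
    by move=> k; rewrite /b exprMn pi_sq_rate; case: (k != _); rewrite ?expr1n ?expr0n.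
  apply: le_trans (square_sum_gauss_nz n a0) _.
  by rewrite ler_wpM2l// lef_pV2 ?posrE// !mulr_gt0.
- move=> k /=; apply: le_trans (ler_norm_mode _ _ _ _ _ _) _.
  rewrite /b; have [->|k0] := eqVneq k (0, 0); last by rewrite mul1r.
  by rewrite c0 s0 normr0 addr0 mulr0 mulr0.
Qed.

(** The power is at most 1 for y <= 1 and at most [y^2] beyond; the 4 is [N^N] of [exprn_le_expR] at
    N = 2. *)
Lemma powR_le_expR (a y : R) : 0 <= a <= 1 -> 0 <= y -> y `^ (1 + a) <= 4 * expR y.
Proof.
move=> /andP[a0 a1] y0; have e1 : 1 <= expR y.
  by apply: le_trans (expR_ge1Dx y); rewrite lerDl.
have [y1|y1] := leP y 1.
  apply: (@le_trans _ _ 1); last by lra.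
  have h : y `^ (1 + a) <= 1 `^ (1 + a) by rewrite ge0_ler_powR ?nnegrE// addr_ge0.
  by move: h; rewrite powR1.
apply: (@le_trans _ _ (y `^ 2)).
  by apply: ler_powR; [exact: ltW|lra].
have := @exprn_le_expR R y 2 y0 isT.
by rewrite powR_mulrn// -natrX.
Qed.

(** The power of |k| is 1 + al: one for the gradient and al for the Hoelder seminorm. *)
Definition gradient_weight (al t : R) (k : int * int) : R :=
  expR (- (rate nu k * t)) * sqnorm R k `^ ((1 + al) / 2).

(** Half of the squared decay absorbs [|k|^(2 + 2 al)] by [powR_le_expR], the other half is summed
    over nonzero k. The constants multiply to 4 * 68 = 272, below 17^2 = 289. *)
Lemma gradient_weight_sum (al t : R) n : 0 < al -> al < 1 -> 0 < t ->
  square_sum (fun k => gradient_weight al t k ^+ 2) n <=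
  (17 * (nu * t) `^ (- 1 - al / 2)) ^+ 2.
Proof.
move=> al0 al1 t0; have nt : 0 < nu * t by rewrite mulr_gt0.
pose b := 4 * pi ^+ 2 * (nu * t).
have b0 : 0 < b by rewrite mulr_gt0// four_pi_sq_gt0.
have ntb : nu * t <= b by rewrite ler_peMl ?(ltW nt)// four_pi_sq_ge1.
have bp : 0 < b `^ (1 + al) by exact: powR_gt0.
apply: (@le_trans _ _ (4 / b `^ (1 + al) * (68 / b))).
  apply: (le_trans _ (ler_wpM2l _ (square_sum_gauss_nz n b0))); last first.
    by rewrite divr_ge0// ltW.
  rewrite -square_sumZ; apply: ler_square_sum => k.
  rewrite /gradient_weight exprMn pi_sq_rate -/b.
  have q0 := sqnorm_ge0 R k.
  have -> : (sqnorm R k `^ ((1 + al) / 2)) ^+ 2 = sqnorm R k `^ (1 + al).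
    by rewrite -powR_mulrn ?powR_ge0// -powRrM divfK.
  have [->|k0] := eqVneq k (0, 0).
    by rewrite /sqnorm /= expr0n/= addr0 powR0 ?mulr0 ?mul0r ?mulr0// lt0r_neq0// addr_gt0.
  rewrite mul1r; set q := sqnorm R k in q0 *.
  have h := @powR_le_expR al (b * q); rewrite ltW//= ltW// in h.
  have {}h := h isT (mulr_ge0 (ltW b0) q0).
  rewrite powRM// ?(ltW b0)// in h.
  have -> : expR (- (2 * b * q)) = expR (- (b * q)) * (expR (b * q))^-1.
    by rewrite -expRN -expRD; congr expR; ring.
  rewrite mulrAC [leRHS]mulrC -[leLHS]mulrA ler_wpM2l ?expR_ge0//.
  by rewrite ler_pdivrMr ?expR_gt0// mulrAC ler_pdivlMr// mulrC.
have E : (17 * (nu * t) `^ (- 1 - al / 2)) ^+ 2 = 289 * (nu * t) `^ (- (2 + al)).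
  rewrite exprMn -[in LHS](powR_mulrn 2 (powR_ge0 _ _)) -powRrM.
  rewrite (_ : (- 1 - al / 2) * 2 = - (2 + al)); last by field.
  by congr (_ * _); rewrite -natrX.
rewrite E; apply: (@le_trans _ _ (272 * b `^ (- (2 + al)))).
  rewrite le_eqVlt; apply/orP; left; apply/eqP.
  have -> : b `^ (- (2 + al)) = (b `^ (1 + al))^-1 * b^-1.
    rewrite powRN (_ : 2 + al = 1 + al + 1); last by ring.
    by rewrite powRD ?powRr1 ?(ltW b0)// ?invfM// lt0r_neq0 ?implybT.
  by field; rewrite !lt0r_neq0.
have h : b `^ (- (2 + al)) <= (nu * t) `^ (- (2 + al)).
  rewrite !powRN lef_pV2 ?posrE ?powR_gt0// ge0_ler_powR ?nnegrE ?(ltW b0) ?(ltW nt)//.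
  by rewrite addr_ge0// ltW.
have := powR_ge0 (nu * t) (- (2 + al)); lra.
Qed.

Lemma norm_phase_delta k j :
  `|phase k (delta_mx 0 j : 'rV[R]_3)| <= 2 * pi * Num.sqrt (sqnorm R k).
Proof.
have p0 : 0 <= 2 * pi :> R by rewrite mulr_ge0 ?pi_ge0.
rewrite phase_delta normrM (ger0_norm p0) ler_wpM2l//.
have [h1 h2] := sqrt_sqnorm k.
by case: ifP => _ //; case: ifP => _ //; rewrite normr0 sqrtr_ge0.
Qed.

Lemma sqrt_mul_powR (q al : R) : 0 <= q -> 0 < al ->
  Num.sqrt q * Num.sqrt q `^ al = q `^ ((1 + al) / 2).
Proof.
move=> q0 al0; rewrite -{1}(powRr1 (sqrtr_ge0 q)).
have [->|qn0] := eqVneq q 0.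
  rewrite sqrtr0 !powR0 ?mul0r// ?lt0r_neq0// ?divr_gt0// ?addr_gt0//.
rewrite -powRD; last by rewrite sqrtr_eq0 -ltNge lt0r qn0 q0 implybT.
have -> : Num.sqrt q = q `^ (2^-1) by rewrite powR12_sqrt.
by rewrite -powRrM mulrC.
Qed.

(** On the lattice |k| is 0 or at least 1. The sup norm of the gradient can therefore use the
    Hoelder weight and obtain the same power of nu t. *)
Lemma one_le_sqrt_powR k (al : R) : 0 < al ->
  Num.sqrt (sqnorm R k) <= Num.sqrt (sqnorm R k) * Num.sqrt (sqnorm R k) `^ al.
Proof.
move=> al0; have [->|k0] := eqVneq k (0, 0).
  by rewrite /sqnorm /= expr0n/= addr0 sqrtr0 mul0r.
rewrite ler_peMr ?sqrtr_ge0//.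
have q1 : 1 <= Num.sqrt (sqnorm R k).
  by rewrite -[leLHS]sqrtr1 ler_wsqrtr// sqnorm_ge1.
by rewrite -[leLHS](powRr0 (Num.sqrt (sqnorm R k))) ler_powR// ltW.
Qed.

(** Interpolates between the trivial bound 2 on a difference of cosines or sines and the Lipschitz
    bound y. *)
Lemma min_two_powR (a y : R) : 0 < a < 1 -> 0 <= y -> forall z : R, `|z| <= 2 -> `|z| <= y ->
  `|z| <= 2 * y `^ a.
Proof.
move=> /andP[a0 a1] y0 z z2 zy; have [y1|y1] := leP y 1.
  apply: le_trans zy _; apply: (@le_trans _ _ (y `^ a)).
    have [->|yn0] := eqVneq y 0; first by rewrite powR_ge0.
    rewrite -{1}(powRr1 y0) ger_powR ?(ltW a1)//.
    by rewrite lt0r yn0 y0.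
  by have := powR_ge0 y a; lra.
apply: le_trans z2 _; rewrite -{1}[2]mulr1 ler_wpM2l//.
by rewrite -(powRr0 y) ler_powR// ltW.
Qed.

Local Notation D j t x := (hs (dcos nu (evec R j) c s) (dsin nu (evec R j) c s) (t, x)).

Lemma dcos_evec j k : dcos nu (evec R j) c s k = phase k (delta_mx 0 j) * s k.
Proof. by rewrite /dcos /= !mul0r oppr0 add0r. Qed.

Lemma dsin_evec j k : dsin nu (evec R j) c s k = - (phase k (delta_mx 0 j) * c k).
Proof. by rewrite /dsin /= !mul0r oppr0 add0r. Qed.

Lemma gradient_bound j al t x : 0 < al -> al < 1 -> 0 < t ->
  `|D j t x| <= 68 * pi * (nu * t) `^ (- 1 - al / 2) * L2_norm2 f.
Proof.
move=> al0 al1 t0.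
have AB := tempered_d nu_gt0 (evec R j) (tempered_cs fL2).
apply: square_series_bound; first exact: (@mode_summable _ _ _ _ _ _ x AB t0).
move=> n.
pose b k := 2 * pi * gradient_weight al t k.
have p0 : 0 <= 2 * pi :> R by rewrite mulr_ge0 ?pi_ge0.
have -> : 68 * pi * (nu * t) `^ (- 1 - al / 2) * L2_norm2 f =
    2 * (2 * pi * (17 * (nu * t) `^ (- 1 - al / 2))) * L2_norm2 f by ring.
apply: (fourier_sum_bound fL2 (b := b)); last 2 first.
- by rewrite mulr_ge0// mulr_ge0// powR_ge0.
- rewrite (eq_square_sum (U := fun k => (2 * pi) ^+ 2 * gradient_weight al t k ^+ 2)); last first.
    by move=> k; rewrite /b exprMn.
  by rewrite square_sumZ [leRHS]exprMn ler_wpM2l ?sqr_ge0// gradient_weight_sum.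
- move=> k /=; apply: le_trans (ler_norm_mode _ _ _ _ _ _) _.
  rewrite dcos_evec dsin_evec normrN; have := norm_phase_delta k j.
  move: (phase k _) => P hP; rewrite !normrM -mulrDr addrC.
  rewrite mulrA /b /gradient_weight; apply: ler_wpM2r; first by rewrite addr_ge0.
  rewrite mulrCA ler_wpM2l ?expR_ge0//; apply: le_trans hP _.
  by rewrite ler_wpM2l// -sqrt_mul_powR ?sqnorm_ge0// one_le_sqrt_powR.
Qed.

(** The constant is 2 * 17 * 16 pi^2: the 2 is that of [fourier_sum_bound], the 17 that of
    [gradient_weight_sum], and 16 pi^2 is 2 pi from the derivative times 8 pi from the interpolated
    difference. *)
Lemma gradient_holder j al t x y : 0 < al -> al < 1 -> 0 < t ->
  `|D j t x - D j t y| <=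
  544 * pi ^+ 2 * (nu * t) `^ (- 1 - al / 2) * L2_norm2 f * `|x - y| `^ al.
Proof.
move=> al0 al1 t0.
have AB := tempered_d nu_gt0 (evec R j) (tempered_cs fL2).
have sx := mode_summable nu_gt0 x AB t0; have sy := mode_summable nu_gt0 y AB t0.
have -> : D j t x - D j t y = square_series (fun k =>
    mode nu (dcos nu (evec R j) c s) (dsin nu (evec R j) c s) k t x +
    - 1 * mode nu (dcos nu (evec R j) c s) (dsin nu (evec R j) c s) k t y).
  by rewrite square_seriesD ?square_seriesZ ?mulN1r//; exact: square_summableZ.
apply: square_series_bound; first by apply: square_summableD => //; exact: square_summableZ.
move=> n.
pose m := 16 * pi ^+ 2 * `|x - y| `^ al.
have m0 : 0 <= m by rewrite mulr_ge0 ?powR_ge0// mulr_ge0// sqr_ge0.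
pose b k := m * gradient_weight al t k.
have -> : 544 * pi ^+ 2 * (nu * t) `^ (- 1 - al / 2) * L2_norm2 f * `|x - y| `^ al =
    2 * (m * (17 * (nu * t) `^ (- 1 - al / 2))) * L2_norm2 f by rewrite /m; ring.
apply: (fourier_sum_bound fL2 (b := b)); last 2 first.
- by rewrite mulr_ge0// mulr_ge0// powR_ge0.
- rewrite (eq_square_sum (U := fun k => m ^+ 2 * gradient_weight al t k ^+ 2)); last first.
    by move=> k; rewrite /b exprMn.
  by rewrite square_sumZ [leRHS]exprMn ler_wpM2l ?sqr_ge0// gradient_weight_sum.
- move=> k /=; set q := Num.sqrt (sqnorm R k); have q0 : 0 <= q by exact: sqrtr_ge0.
  have hP := norm_phase_delta k j; rewrite -/q in hP.
  rewrite /mode !dcos_evec !dsin_evec.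
  have thE : `|phase k x - phase k y| <= 2 * pi * (`|k.1%:~R| + `|k.2%:~R|) * `|x - y|.
    have -> : phase k x - phase k y = phase k (x - y).
      by rewrite phaseD -[- y]scaleN1r phaseZ mulN1r.
    exact: ler_norm_phase.
  move: thE hP; move: (phase k (delta_mx _ _)) (phase k x) (phase k y) => P th th' thE0 hP.
  have p1 : 0 <= pi :> R by exact: pi_ge0.
  have p2 : 1 <= pi :> R by apply: le_trans (pi_ge2 R); lra.
  have thE : `|th - th'| <= 4 * pi * q * `|x - y|.
    apply: le_trans thE0 _; rewrite ler_wpM2r//.
    have [h1 h2] := sqrt_sqnorm k.
    rewrite -/q in h1 h2.
    have -> : 4 * pi * q = 2 * pi * (q + q) by ring.
    by rewrite ler_wpM2l ?lerD// mulr_ge0.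
  have y0 : 0 <= 4 * pi * q * `|x - y| by rewrite !mulr_ge0.
  (* As 4 pi >= 1 and al < 1, the power (4 pi)^al is replaced by 4 pi; this makes the constant
     independent of al. *)
  have yal : (4 * pi * q * `|x - y|) `^ al <= 4 * pi * (q `^ al * `|x - y| `^ al).
    have p4 : 0 <= 4 * pi :> R by rewrite mulr_ge0.
    rewrite -mulrA powRM ?mulr_ge0// (powRM _ q0)//.
    apply: ler_wpM2r; first by rewrite mulr_ge0 ?powR_ge0.
    rewrite -[leRHS](powRr1 p4); apply: ler_powR; last exact: ltW.
    lra.
  have al01 : 0 < al < 1 by rewrite al0 al1.
  have two (a a' : R) : `|a| <= 1 -> `|a'| <= 1 -> `|a - a'| <= 2.
    by move=> h h'; apply: le_trans (ler_normB _ _) _; lra.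
  have hc : `|cos th - cos th'| <= 2 * (4 * pi * (q `^ al * `|x - y| `^ al)).
    apply: (le_trans _ (ler_wpM2l _ yal)) => //; apply: min_two_powR => //.
      by apply: two; exact: norm_cos_le1.
    exact: le_trans (norm_cosB_le _ _) thE.
  have hs' : `|sin th - sin th'| <= 2 * (4 * pi * (q `^ al * `|x - y| `^ al)).
    apply: (le_trans _ (ler_wpM2l _ yal)) => //; apply: min_two_powR => //.
      by apply: two; exact: norm_sin_le1.
    exact: le_trans (norm_sinB_le _ _) thE.
  set Z := 2 * _ in hc hs'.
  set e := expR _.
  have -> : e * (P * s k * cos th + - (P * c k) * sin th) +
      -1 * (e * (P * s k * cos th' + - (P * c k) * sin th')) =
    e * (P * (s k * (cos th - cos th') - c k * (sin th - sin th'))) by ring.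
  rewrite normrM (ger0_norm (expR_ge0 _)) normrM.
  have Z0 : 0 <= Z by exact: le_trans hc.
  have hZ : `|s k * (cos th - cos th') - c k * (sin th - sin th')| <= Z * (`|c k| + `|s k|).
    apply: le_trans (ler_normB _ _) _; rewrite !normrM addrC [Z * _]mulrC mulrDl.
    by rewrite lerD// ler_wpM2l.
  apply: (le_trans (ler_wpM2l (expR_ge0 _) (ler_pM (normr_ge0 _) (normr_ge0 _) hP hZ))).
  rewrite /b /gradient_weight -/e -sqrt_mul_powR ?sqnorm_ge0// -/q /m /Z.
  by rewrite le_eqVlt; apply/orP; left; apply/eqP; ring.
Qed.

End Bounds.

(** * The stochastic flow and its mean displacement *)

Section BoundedConvergence.
Context d (T : measurableType d) (R : realType) (P : probability T R).

Lemma bounded_cvg_Rintegral (g_ : nat -> T -> R) (g : T -> R) (M : R) :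
  (forall n, measurable_fun setT (g_ n)) -> measurable_fun setT g ->
  (forall n w, `|g_ n w| <= M) ->
  {ae P, forall w, (fun n => g_ n w) @ \oo --> g w} ->
  P.-integrable setT (EFin \o g) /\
  (fun n => \int[P]_w g_ n w) @ \oo --> \int[P]_w g w.
Proof.
move=> mg_ mg gM gc.
have [gi _ Ic] : [/\ P.-integrable setT (EFin \o g),
    (fun n => \int[P]_w `|(g_ n w)%:E - (g w)%:E|)%E @ \oo --> 0%E &
    (fun n => \int[P]_w (g_ n w)%:E)%E @ \oo --> (\int[P]_w (g w)%:E)%E].
  apply: (@dominated_convergence _ _ _ P setT measurableT _ _ (EFin \o cst M)) => //.
  - by move=> n; apply/measurable_EFinP.
  - by apply/measurable_EFinP.
  - by apply: filterS gc => w gw _; apply: cvg_EFin => //; exact: nearW.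
  - exact: finite_measure_integrable_cst.
  - by apply: nearW => w n _; rewrite /= lee_fin.
split => //; apply: fine_cvg.
by rewrite fineK//; exact: integrable_fin_num gi.
Qed.

End BoundedConvergence.

(** * Time integrals of the profile along continuous paths *)

Section Paths.
Variables (R : realType) (nu : R) (f : R * R -> R).
Hypothesis nu_gt0 : 0 < nu.
Hypothesis fL2 : f \in Lfun (torus2_measure R) 2%:E.
Hypothesis f0 : \int[torus2_measure R]_y f y = 0.

Local Notation phi := (shear_profile nu f).
Local Notation la := (@lebesgue_measure R).
Local Notation AB := (tempered_cs fL2).

Lemma shear_profile_continuous (z : R^o * 'rV[R]_3) : 0 < z.1 ->
  {for z, continuous (fun z : R^o * 'rV[R]_3 => phi z.1 z.2)}.
Proof.
move=> z0.
rewrite (_ : (fun z : R^o * 'rV[R]_3 => phi z.1 z.2) =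
    heat_series nu (cos_coef f) (sin_coef f)); last first.
  by apply/funext => -[t x]; rewrite shear_profileE.
have [dF _] := @heat_series_diff R nu nu_gt0 R^o
  (heat_series nu (cos_coef f) (sin_coef f)) 1 _ _ z AB (fun y _ => esym (mulr1 _)) z0.
exact: differentiable_continuous.
Qed.

Lemma path_continuous (y : R -> 'rV[R]_3) (t : R) :
  {within `[0, +oo[, continuous y} -> {within `]0, t], continuous (fun s => phi s (y s))}.
Proof.
move=> /subspace_continuousP cy; apply/subspace_continuousP => s /=.
rewrite in_itv/= => /andP[s0 st].
have cy' : y r @[r --> within `]0, t]%classic (nbhs s)] --> y s.
  apply: cvg_trans (cy s _); last by rewrite /= in_itv/= andbT ltW.
  apply: cvg_app => U; rewrite /nbhs/= /within/=; apply: filterS => r h.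
  by rewrite in_itv/= => /andP[r0 _]; apply: h; rewrite in_itv/= andbT ltW.
have ci : (r : R^o) @[r --> within `]0, t]%classic (nbhs s)] --> (s : R^o).
  by apply: cvg_within.
have h := @shear_profile_continuous (s, y s) s0.
by apply: (cvg_comp2 ci cy' h).
Qed.

Lemma path_integral (y : R -> 'rV[R]_3) (t : R) : 0 < t ->
  {within `[0, +oo[, continuous y} ->
  la.-integrable `[0, t] (fun s => (phi s (y s))%:E) /\
  right_sum t (fun s => phi s (y s)) @ \oo --> \int[la]_(s in `[0, t]) phi s (y s).
Proof.
move=> t0 cy.
have [gi gc] := @right_sum_cvg R t (inv_sqrt_const nu f) (fun s => phi s (y s)) t0
  (path_continuous (t := t) cy)
  (fun s sP => shear_profile_bound nu_gt0 fL2 _ f0 (proj1 (andP sP))).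
(* The endpoint 0, where the value of the profile carries no meaning, is a null set. *)
rewrite -Rintegral_itv_obnd_cbnd//; split=> //.
have /integrableP[mg ig] := gi; apply/integrableP.
have mg' : measurable_fun (`[0, t] : set R) (fun s => (phi s (y s))%:E).
  by apply/emeasurable_fun_itv_obnd_cbndP.
split => //; rewrite -integral_itv_obnd_cbnd//.
by apply: measurableT_comp.
Qed.

(** A pointwise limit of finite trigonometric sums in the coordinates of Y. *)
Lemma measurable_shear_profile d (T : measurableType d) (s : R) (Y : T -> 'rV[R]_3) :
  0 < s -> (forall j, measurable_fun setT (fun w => Y w 0 j)) ->
  measurable_fun setT (fun w => phi s (Y w)).
Proof.
move=> s0 mY.
apply: (@measurable_fun_cvg _ _ _ _ (fun n w => square_sum (fun k =>
  mode nu (cos_coef f) (sin_coef f) k s (Y w)) n)); last first.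
  move=> w _; rewrite shear_profileE.
  exact: (square_summable_cvg (mode_summable nu_gt0 (Y w) AB s0)).
move=> n; apply: measurable_sum => i; apply: measurable_sum => j.
have mph : measurable_fun setT (fun w => phase (i%:Z - n%:Z, j%:Z - n%:Z) (Y w)).
  rewrite /phase /torus2_phase /=; apply: measurable_funM => //.
  by apply: measurable_funD; apply: measurable_funM.
apply: measurable_funM => //; apply: measurable_funD; apply: measurable_funM => //.
  exact: measurable_cos_comp.
exact: measurable_sin_comp.
Qed.

End Paths.

Section AlmostEverywhere.
Context d (T : measurableType d) (R : realType) (mu : {measure set T -> \bar R}).

(** Measurability of f is assumed, since mu need not be complete. *)
Lemma ae_Rintegral (f g : T -> R) : measurable_fun setT f ->
  mu.-integrable setT (EFin \o g) -> {ae mu, forall w, f w = g w} ->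
  mu.-integrable setT (EFin \o f) /\ \int[mu]_w f w = \int[mu]_w g w.
Proof.
move=> mf gi fg.
have fg' : ae_eq mu setT (EFin \o f) (EFin \o g).
  by apply: filterS fg => w /= -> _.
have mf' : measurable_fun setT (EFin \o f) by apply/measurable_EFinP.
split; first exact: ae_eq_integrable fg' gi.
have /integrableP[mg _] := gi.
by rewrite /Rintegral (ae_eq_integral (EFin \o g)).
Qed.

End AlmostEverywhere.

(** * Averages of the profile over Brownian paths *)

Section BrownianMean.
Context d (T : measurableType d) (R : realType) (P : probability T R).
Variable W : R -> T -> 'rV[R]_3.
Hypothesis BM : brownian_motion P W.
Variables (nu : R) (f : R * R -> R).
Hypothesis nu_gt0 : 0 < nu.
Hypothesis fL2 : f \in Lfun (torus2_measure R) 2%:E.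
Hypothesis f0 : \int[torus2_measure R]_y f y = 0.

Local Notation phi := (shear_profile nu f).
Local Notation la := (@lebesgue_measure R).
Local Notation AB := (tempered_cs fL2).
Local Notation sig := (Num.sqrt (2 * nu)).

(** Its transverse coordinates are those at time s of the particle that is at x at time t. Its first
    coordinate omits the drift, which the profile does not see. *)
Definition backward_path (t : R) (x : 'rV[R]_3) (s : R) (w : T) : 'rV[R]_3 :=
  x - sig *: (W t w - W s w).

Lemma measurable_backward_path t x s j : 0 <= s -> 0 <= t ->
  measurable_fun setT (fun w => backward_path t x s w 0 j).
Proof.
move=> s0 t0; have [mW _ _ _ _] := BM.
rewrite (_ : (fun w => _) = fun w => x 0 j - sig * (W t w 0 j - W s w 0 j)); last first.
  by apply/funext => w; rewrite /backward_path !mxE.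
apply: measurable_funB => //; apply: measurable_funM => //.
by apply: measurable_funB; exact: mW.
Qed.

Lemma backward_path_continuous t x w : {within `[0, +oo[, continuous (W^~ w)} ->
  {within `[0, +oo[, continuous (fun s => backward_path t x s w)}.
Proof.
move=> cw s; apply: cvgB; first exact: cvg_cst.
by apply: cvgZl_tmp; apply: cvgB; [exact: cvg_cst|exact: cw].
Qed.

Lemma phase_backward_path k t x s w : phase k (backward_path t x s w) =
  (- (sig * (2 * pi * k.1%:~R))) * increment W s t 1 w +
  (- (sig * (2 * pi * k.2%:~R))) * increment W s t 2 w + phase k x.
Proof. by rewrite /phase /torus2_phase /increment /backward_path/= !mxE; ring. Qed.

(** With noise intensity sqrt (2 nu) the Gaussian factor has exponent (t - s) * 2 nu * (2 pi |k|)^2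
    / 2, which is exactly [rate nu k * (t - s)]. *)
Lemma cos_phase_mean k t x s c : 0 <= s -> s <= t ->
  P.-integrable setT (EFin \o (fun w => cos (phase k (backward_path t x s w) + c))) /\
  \int[P]_w cos (phase k (backward_path t x s w) + c) =
  expR (- (rate nu k * (t - s))) * cos (phase k x + c).
Proof.
move=> s0 st; have t0 := le_trans s0 st.
split.
  apply: (@bounded_integrable _ _ _ P _ 1); last by move=> w; exact: norm_cos_le1.
  apply: measurable_cos_comp; apply: measurable_funD => //.
  rewrite /phase /torus2_phase /=; apply: measurable_funM => //.
  by apply: measurable_funD; apply: measurable_funM => //; exact: measurable_backward_path.
under eq_Rintegral => w _ do rewrite phase_backward_path -addrA.
rewrite (increment_cos BM)//; congr (expR _ * _).
have nu2 : 0 <= 2 * nu by rewrite mulr_ge0// ltW.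
rewrite !sqrrN ![(sig * _) ^+ 2]exprMn sqr_sqrtr// /rate /sqnorm !exprMn.
by field.
Qed.

Lemma mode_mean A B k t x s : 0 <= s -> s <= t ->
  P.-integrable setT (EFin \o (fun w => mode nu A B k s (backward_path t x s w))) /\
  \int[P]_w mode nu A B k s (backward_path t x s w) = mode nu A B k t x.
Proof.
move=> s0 st; set e := expR (- (rate nu k * s)).
have [i1 E1] := cos_phase_mean k x 0 s0 st.
have [i2 E2] := cos_phase_mean k x (- (pi / 2)) s0 st.
have sinE u : cos (u + - (pi / 2)) = sin u :> R.
  by rewrite cosB cos_pihalf sin_pihalf mulr0 mulr1 add0r.
have E : (fun w => mode nu A B k s (backward_path t x s w)) = (fun w =>
    (e * A k) * cos (phase k (backward_path t x s w) + 0) +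
    (e * B k) * cos (phase k (backward_path t x s w) + - (pi / 2))).
  by apply/funext => w; rewrite sinE addr0 /mode -/e; ring.
have j1 : P.-integrable setT (EFin \o (fun w =>
    (e * A k) * cos (phase k (backward_path t x s w) + 0))).
  by apply: eq_integrable (integrableZl measurableT (e * A k) i1) => //.
have j2 : P.-integrable setT (EFin \o (fun w =>
    (e * B k) * cos (phase k (backward_path t x s w) + - (pi / 2)))).
  by apply: eq_integrable (integrableZl measurableT (e * B k) i2) => //.
rewrite E; split.
  by apply: eq_integrable (integrableD measurableT j1 j2) => // w _; rewrite /= EFinD.
rewrite RintegralD// !RintegralZl// E1 E2 sinE addr0 /mode.
have -> : expR (- (rate nu k * t)) = e * expR (- (rate nu k * (t - s))).
  by rewrite -expRD; congr expR; ring.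
ring.
Qed.

Lemma shear_profile_mean t x s : 0 < s -> s <= t ->
  P.-integrable setT (EFin \o (fun w => phi s (backward_path t x s w))) /\
  \int[P]_w phi s (backward_path t x s w) = phi t x.
Proof.
move=> s0 st; have t0 := lt_le_trans s0 st.
have [M AM] := tempered_summable nu_gt0 AB s0.
pose c := cos_coef f; pose s' := sin_coef f.
have mk k := mode_mean c s' k x (ltW s0) st.
have sk n := Rintegral_square_sum n (fun k => proj1 (mk k)).
have [] := @bounded_cvg_Rintegral _ T R P
  (fun n w => square_sum (fun k => mode nu c s' k s (backward_path t x s w)) n)
  (fun w => phi s (backward_path t x s w)) M.
- by move=> n; have [/integrableP[/measurable_EFinP]] := sk n.
- by apply: measurable_shear_profile => // j; apply: measurable_backward_path; exact: ltW.
- move=> n w; apply: le_trans (ler_norm_square_sum _ _) _; apply: le_trans (AM n).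
  apply: ler_square_sum => k; apply: le_trans (ler_norm_mode _ _ _ _ _ _) _.
  exact: ler_norm.
- apply: nearW => w; rewrite shear_profileE.
  exact: (square_summable_cvg (mode_summable nu_gt0 _ AB s0)).
move=> hi hc; split => //.
apply: (cvg_unique _ hc) => //.
rewrite (_ : (fun n => _) = square_sum (fun k => mode nu c s' k t x)); last first.
  by apply/funext => n; have [_ ->] := sk n; apply: eq_square_sum => k; have [] := mk k.
rewrite shear_profileE.
exact: (square_summable_cvg (mode_summable nu_gt0 _ AB t0)).
Qed.

(** Every right Riemann sum already has mean [t * phi t x], so only the limit has to be justified. I
    is any measurable version of the time integral, whose Riemann sums are known to converge only
    along continuous paths. *)
Lemma backward_integral_mean t x (I : T -> R) : 0 <= t ->
  measurable_fun setT I ->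
  {ae P, forall w, I w = \int[la]_(s in `[0, t]) phi s (backward_path t x s w)} ->
  P.-integrable setT (EFin \o I) /\ \int[P]_w I w = t * phi t x.
Proof.
rewrite le_eqVlt => /predU1P[<-|t0] mI aI.
  have [|Ii ->] := ae_Rintegral mI (finite_measure_integrable_cst P 0 measurableT).
    by apply: filterS aI => w ->; rewrite set_itv1 Rintegral_set1.
  by rewrite mul0r Rintegral_cst// mul0r.
have [mW _ cW _ _] := BM.
pose K := inv_sqrt_const nu f.
pose g w s := phi s (backward_path t x s w).
have gK w s : 0 < s <= t -> `|g w s| <= K * (Num.sqrt s)^-1.
  by move=> /andP[s0 _]; exact: shear_profile_bound.
have node n (i : 'I_n.+1) := andP (right_node_bounds i t0).
have term n (i : 'I_n.+1) := shear_profile_mean x (proj1 (node n i)) (proj2 (node n i)).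
have termi n (i : 'I_n.+1) : P.-integrable setT
    (EFin \o (fun w => t / n.+1%:R * g w (right_node t n i))).
  by apply: eq_integrable (integrableZl measurableT (t / n.+1%:R) (proj1 (term n i))) => //.
have [] := @bounded_cvg_Rintegral _ T R P (fun n w => right_sum t (g w) n) I
  (K * \int[la]_(s in `]0, t]) (Num.sqrt s)^-1).
- move=> n; apply: measurable_sum => i.
  by have /integrableP[/measurable_EFinP] := termi n i.
- exact: mI.
- by move=> n w; apply: right_sum_bound => //; [exact: inv_sqrt_const_ge0|exact: gK].
- apply: filterS2 aI cW => w -> cw.
  by have [] := path_integral nu_gt0 fL2 f0 t0 (@backward_path_continuous t x w cw).
move=> hi hc; split => //; apply: (cvg_unique _ hc) => //.
rewrite (_ : (fun n => _) = cst (t * phi t x)); first exact: cvg_cst.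
apply/funext => n; rewrite /right_sum.
have [_ ->] := Rintegral_sum (index_enum 'I_n.+1) (termi n).
rewrite (eq_bigr (fun=> t / n.+1%:R * phi t x)); last first.
  by move=> i _; have [h <-] := term n i; rewrite RintegralZl.
have n0 : n.+1%:R != 0 :> R by rewrite pnatr_eq0.
by rewrite sumr_const card_ord -mulrnAl -[_ / _ *+ _]mulr_natr divfK.
Qed.

End BrownianMean.

Section ShearFlowEntry.
Variables (R : realType) (nu : R) (f : R * R -> R).
Local Notation phi := (shear_profile nu f).

Lemma shear_flow_entry t y i :
  shear_flow nu f t y 0 i = if i == 0 then phi t y else 0.
Proof. by rewrite -[LHS]/((fun y => _) y) shear_flow_coord; case: ifP. Qed.

Lemma eq_shear_profile t (x y : 'rV[R]_3) : x 0 1 = y 0 1 -> x 0 2 = y 0 2 -> phi t x = phi t y.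
Proof. by rewrite /shear_profile => -> ->. Qed.

End ShearFlowEntry.

(** * Mean displacement, mean deformation and the Hoelder bound *)

Section MeanDisplacement.
Context d (T : measurableType d) (R : realType) (P : probability T R).
Variables (W : R -> T -> 'rV[R]_3) (X A : R -> 'rV[R]_3 -> T -> 'rV[R]_3).
Variables (nu : R) (f : R * R -> R).
Hypothesis BM : brownian_motion P W.
Hypothesis nu_gt0 : 0 < nu.
Hypothesis fL2 : f \in Lfun (torus2_measure R) 2%:E.
Hypothesis f0 : \int[torus2_measure R]_y f y = 0.
Hypothesis flowX : stochastic_flow P nu W (shear_flow nu f) X.
Hypothesis flowA : inverse_flow P X A.

Local Notation phi := (shear_profile nu f).
Local Notation la := (@lebesgue_measure R).
Local Notation sig := (Num.sqrt (2 * nu)).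

Lemma displacement_ae t x : 0 <= t -> {ae P, forall w, forall i,
  displacement A t x i w = (if i == 0 then
    - \int[la]_(s in `[0, t]) phi s (backward_path W nu t x s w) else 0)
    - sig * W t w 0 i}.
Proof.
move=> t0; apply: filterS2 flowX.2 flowA.2 => w hX hA i.
(* The label a is random; this is allowed because the exceptional event of the flow equation is
   common to all labels. *)
set a := A t x w; have [_ Xa] := hX a.
have Xt : X t a w = x by have [_ ->] := hA t t0.
have tr s (j : 'I_3) : 0 <= s -> j != 0 -> X s a w 0 j = a 0 j + sig * W s w 0 j.
  move=> s0 /negPf j0; have [_ ->] := Xa s j s0.
  under eq_Rintegral => r _ do rewrite shear_flow_entry j0.
  by rewrite Rintegral_cst//= mul0r addr0.
rewrite /displacement -/a mxE [(- x) _ _]mxE.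
have [->|i0] := eqVneq i 0; last first.
  by rewrite -[in x 0 i]Xt tr//; ring.
have [_] := Xa t 0 t0; rewrite Xt => ->.
rewrite (_ : \int[la]_(s in `[0, t]) shear_flow nu f s (X s a w) 0 0 =
  \int[la]_(s in `[0, t]) phi s (backward_path W nu t x s w)); first by ring.
apply: eq_Rintegral => s; rewrite inE/= in_itv/= => /andP[s0 _].
rewrite shear_flow_entry eqxx.
by apply: eq_shear_profile; rewrite tr// /backward_path -Xt !mxE tr//; ring.
Qed.

Lemma displacement_mean t x i : 0 <= t ->
  P.-integrable setT (EFin \o displacement A t x i) /\
  \int[P]_w displacement A t x i w = - t * shear_flow nu f t x 0 i.
Proof.
move=> t0; have [Wi EW] := brownian_integrable BM i t0.
have mD : measurable_fun setT (displacement A t x i).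
  rewrite (_ : displacement A t x i = fun w => A t x w 0 i - x 0 i); last first.
    by apply/funext => w; rewrite /displacement mxE [(- x) _ _]mxE.
  by apply: measurable_funB => //; exact: flowA.1.
have sWi : P.-integrable setT (EFin \o (fun w => sig * W t w 0 i)).
  by apply: eq_integrable (integrableZl measurableT sig Wi) => //.
have EsW : \int[P]_w (sig * W t w 0 i) = 0 by rewrite RintegralZl// EW mulr0.
(* The time integral is recovered from the displacement, from which it inherits its
   measurability. *)
pose I w := - (displacement A t x i w + sig * W t w 0 i).
have mI : measurable_fun setT I.
  apply: measurable_funN; apply: measurable_funD => //.
  by have /integrableP[/measurable_EFinP] := sWi.
have [Ii EI] : P.-integrable setT (EFin \o I) /\
    \int[P]_w I w = t * shear_flow nu f t x 0 i.
  rewrite shear_flow_entry; have [i0|i0] := eqVneq i 0.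
    apply: (backward_integral_mean BM nu_gt0 fL2 f0) => //.
    by apply: filterS (displacement_ae x t0) => w /(_ i); rewrite /I i0 eqxx => ->; ring.
  have [|Ii ->] := ae_Rintegral mI (finite_measure_integrable_cst P 0 measurableT).
    by apply: filterS (displacement_ae x t0) => w /(_ i); rewrite /I (negPf i0) => -> /=; ring.
  by rewrite mulr0 Rintegral_cst// mul0r.
have E : displacement A t x i = fun w => -1 * I w - sig * W t w 0 i.
  by apply/funext => w; rewrite /I; ring.
have Ni : P.-integrable setT (EFin \o (fun w => -1 * I w)).
  by apply: eq_integrable (integrableZl measurableT (-1) Ii) => //.
rewrite E; split.
  by apply: eq_integrable (integrableB measurableT Ni sWi) => // w _; rewrite /= EFinB.
by rewrite RintegralB// EsW RintegralZl// EI; ring.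
Qed.

Lemma mean_displacementE t : 0 <= t ->
  mean_displacement P A t = fun x => - t *: shear_flow nu f t x.
Proof.
move=> t0; apply/funext => x; apply/rowP => i; rewrite mxE [RHS]mxE.
by have [_] := displacement_mean x i t0; rewrite /Rintegral unlock => ->.
Qed.

Lemma mean_deformation_entry t x i j : 0 <= t ->
  (mean_deformation P A t x - 1%:M) i j =
  if (i == 0) && (j != 0) then - t * partial j (phi t) x else 0.
Proof.
move=> t0; rewrite /mean_deformation addrC addKr mxE mean_displacementE//.
rewrite (_ : (fun y => _) = fun y => - t * (if i == 0 then phi t y else 0)); last first.
  by apply/funext => y; rewrite mxE shear_flow_entry.
case: (i == 0) => /=; last first.
  by rewrite (_ : (fun y => _) = cst 0) ?partial_cst//; apply/funext => y; rewrite mulr0.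
(* At t = 0 the profile need not be differentiable, but the factor t makes the displacement
   identically 0. *)
move: t0; rewrite le_eqVlt => /predU1P[<-|t0].
  rewrite oppr0 mul0r (_ : (fun y => _) = cst 0) ?partial_cst ?if_same//.
  by apply/funext => y; rewrite mul0r.
have AB := tempered_cs fL2.
rewrite partial_scale; last by rewrite shear_profile_fun; exact: derivable_space.
have [->|//] := eqVneq j 0.
by rewrite shear_profile_fun derive_space0// mulr0.
Qed.

Lemma mean_deformationE t x : 0 <= t -> mean_deformation P A t x =
  1%:M - t *: tensor (e1 R) (grad_perp (phi t) x).
Proof.
move=> t0; apply/matrixP => i j; have := mean_deformation_entry x i j t0.
move: (mean_deformation P A t x) => D.
have -> : (D - 1%:M) i j = D i j - 1%:M i j by rewrite mxE [(- 1%:M) i j]mxE.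
move=> /(canRL (subrK _)) ->; rewrite addrC [RHS]mxE; congr (_ + _).
rewrite !mxE /=; case: (i == 0); case: (j == 0) => /=; rewrite ?mul1r ?mul0r ?mulr0 ?oppr0 //.
by rewrite mulNr.
Qed.

(** The factor t cancels one power of time, and the remaining [t^(-al/2)] is largest at t = tau. *)
Lemma shear_decay al tau t : 0 < al -> 0 < tau -> tau <= t ->
  t * (nu * t) `^ (- 1 - al / 2) <= nu `^ (- 1 - al / 2) * tau `^ (- (al / 2)).
Proof.
move=> al0 tau0 taut; have t0 := lt_le_trans tau0 taut.
rewrite powRM ?(ltW nu_gt0) ?(ltW t0)// mulrCA; apply: ler_wpM2l; first exact: powR_ge0.
rewrite -{1}(powRr1 (ltW t0)) -powRD; last by rewrite (lt0r_neq0 t0) implybT.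
rewrite (_ : 1 + (- 1 - al / 2) = - (al / 2)); last by ring.
rewrite !powRN lef_pV2 ?posrE ?powR_gt0// ge0_ler_powR ?nnegrE ?(ltW t0) ?(ltW tau0)//.
by rewrite divr_ge0// ltW.
Qed.

Lemma mx_norm_le (M : 'M[R]_3) c : 0 <= c -> (forall i j, `|M i j| <= c) -> `|M| <= c.
Proof.
move=> c0 Mc; rewrite [leLHS]/Num.norm /= mx_normrE.
by apply/bigmax_leP; split => // ij _; exact: Mc.
Qed.

Lemma mean_deformation_holder al tau t : 0 < al -> al < 1 -> 0 < tau -> tau <= t ->
  (holder_norm al (fun x => (mean_deformation P A t x - 1%:M)%R) <=
   ((68 * pi + 544 * pi ^+ 2) * nu `^ (- 1 - al / 2) * tau `^ (- (al / 2)) *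
     L2_norm2 f)%:E)%E.
Proof.
move=> al0 al1 tau0 taut; have t0 := lt_le_trans tau0 taut.
have AB := tempered_cs fL2.
pose q := nu `^ (- 1 - al / 2) * tau `^ (- (al / 2)).
have q0 : 0 <= q by rewrite mulr_ge0 ?powR_ge0.
have tq : t * (nu * t) `^ (- 1 - al / 2) <= q by exact: shear_decay.
have L0 : 0 <= L2_norm2 f by exact: L2_norm2_ge0.
have p0 : 0 <= pi :> R by exact: pi_ge0.
(* Turns a bound on the gradient of the profile into one on an entry of M - I. The matrix norm is
   the largest entry, so no dimensional constant appears. *)
have rescale (a u : R) : 0 <= a -> `|u| <= a * (nu * t) `^ (- 1 - al / 2) * L2_norm2 f ->
    `|- t * u| <= a * q * L2_norm2 f.
  move=> a0 ua; rewrite normrM normrN (gtr0_norm t0).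
  apply: le_trans (ler_wpM2l (ltW t0) ua) _.
  rewrite !mulrA ler_wpM2r// [t * a]mulrC -!mulrA ler_wpM2l//.
pose D j x := heat_series nu (dcos nu (evec R j) (cos_coef f) (sin_coef f))
  (dsin nu (evec R j) (cos_coef f) (sin_coef f)) (t, x).
have DE j x : partial j (shear_profile nu f t) x = D j x.
  by rewrite shear_profile_fun derive_space.
have split_const : (68 * pi + 544 * pi ^+ 2) * nu `^ (- 1 - al / 2) *
    tau `^ (- (al / 2)) * L2_norm2 f =
    68 * pi * q * L2_norm2 f + 544 * pi ^+ 2 * q * L2_norm2 f by rewrite /q; ring.
have a0 : 0 <= 68 * pi :> R := mulr_ge0 (ler0n _ _) p0.
have b0 : 0 <= 544 * pi ^+ 2 :> R := mulr_ge0 (ler0n _ _) (sqr_ge0 _).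
have Da j x := gradient_bound nu_gt0 fL2 j x al0 al1 t0.
have Db j x y := gradient_holder nu_gt0 fL2 j x y al0 al1 t0.
rewrite split_const EFinD {split_const}.
move: (68 * pi) (544 * pi ^+ 2) a0 b0 Da Db => a b a0 b0 Da Db.
have aq : 0 <= a * q * L2_norm2 f := mulr_ge0 (mulr_ge0 a0 q0) L0.
have bq : 0 <= b * q * L2_norm2 f := mulr_ge0 (mulr_ge0 b0 q0) L0.
apply: leeD; apply: ge_ereal_sup.
  move=> _ [x _ <-]; rewrite lee_fin; apply: mx_norm_le => // i j.
  rewrite mean_deformation_entry ?(ltW t0)//.
  case: ifP => _; last by rewrite normr0.
  by rewrite DE; apply: rescale => //; exact: Da.
move=> _ [[x y] /= xy <-]; rewrite lee_fin.
have xy0 : 0 < `|x - y| `^ al by rewrite powR_gt0// normr_gt0 subr_eq0.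
rewrite ler_pdivrMr//; apply: mx_norm_le; first exact: mulr_ge0 (ltW xy0).
move=> i j; rewrite (_ : (_ - _ : 'M[R]_3) i j =
    (mean_deformation P A t x - 1%:M) i j - (mean_deformation P A t y - 1%:M) i j); last first.
  by rewrite mxE [X in _ + X = _]mxE.
rewrite !mean_deformation_entry ?(ltW t0)//.
case: ifP => _; last by rewrite subr0 normr0; exact: mulr_ge0 (ltW xy0).
rewrite !DE -mulrBr.
rewrite (_ : b * q * L2_norm2 f * `|x - y| `^ al = b * `|x - y| `^ al * q * L2_norm2 f);
  last by ring.
apply: rescale; first exact: mulr_ge0 (ltW xy0).
have -> : b * `|x - y| `^ al * (nu * t) `^ (- 1 - al / 2) * L2_norm2 f =
  b * (nu * t) `^ (- 1 - al / 2) * L2_norm2 f * `|x - y| `^ al by ring.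
exact: Db.
Qed.

End MeanDisplacement.

(** * Construction of the flow and its inverse *)

Section Existence.
Context d (T : measurableType d) (R : realType) (P : probability T R).
Variables (W : R -> T -> 'rV[R]_3) (nu : R) (f : R * R -> R).
Hypothesis BM : brownian_motion P W.
Hypothesis nu_gt0 : 0 < nu.
Hypothesis fL2 : f \in Lfun (torus2_measure R) 2%:E.
Hypothesis f0 : \int[torus2_measure R]_y f y = 0.

Local Notation phi := (shear_profile nu f).
Local Notation la := (@lebesgue_measure R).
Local Notation sig := (Num.sqrt (2 * nu)).

(** W is replaced by 0 on a measurable null set N containing the bad events. Continuity on every
    event makes the path integrals limits of Riemann sums everywhere, hence measurable. *)
Lemma brownian_modification : exists V : R -> T -> 'rV[R]_3,
  [/\ forall t i, 0 <= t -> measurable_fun setT (fun w => V t w 0 i),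
      forall w, V 0 w = 0,
      forall w, {within `[0, +oo[, continuous (V^~ w)} &
      {ae P, forall w, forall t, V t w = W t w}].
Proof.
have [mW W0 cW _ _] := BM.
have [N [mN N0 NW]] : {ae P, forall w, W 0 w = 0 /\ {within `[0, +oo[, continuous (W^~ w)}}.
  by apply: filterS2 W0 cW.
have good w : ~ N w -> W 0 w = 0 /\ {within `[0, +oo[, continuous (W^~ w)}.
  by move=> Nw; apply: contrapT => h; apply/Nw/NW.
exists (fun t w => \1_(~` N) w *: W t w); split.
- move=> t i t0; rewrite (_ : (fun w => _) = fun w => \1_(~` N) w * W t w 0 i); last first.
    by apply/funext => w; rewrite mxE.
  apply: measurable_funM; last exact: mW.
  by apply: measurable_indic; exact: measurableC.
- move=> w; rewrite indicE; have [/set_mem /good[-> _]|_] := boolP (w \in ~` N).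
    by rewrite scaler0.
  by rewrite scale0r.
- move=> w; rewrite indicE; have [/set_mem /good[_ cw]|_] := boolP (w \in ~` N).
    by move=> s; apply: cvgZl_tmp; exact: cw.
  rewrite (_ : (fun t => _) = cst 0); first by move=> s; exact: cvg_cst.
  by apply/funext => t; rewrite scale0r.
- exists N; split => // w /= h; apply: contrapT => Nw; apply: h => t.
  by rewrite indicE mem_set// scale1r.
Qed.

Lemma measurable_path_integral (t : R) (Y : R -> T -> 'rV[R]_3) : 0 <= t ->
  (forall s j, 0 <= s -> measurable_fun setT (fun w => Y s w 0 j)) ->
  (forall w, {within `[0, +oo[, continuous (Y^~ w)}) ->
  measurable_fun setT (fun w => \int[la]_(s in `[0, t]) phi s (Y s w)).
Proof.
rewrite le_eqVlt => /predU1P[<-|t0] mY cY.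
  rewrite (_ : (fun w => _) = cst 0)//.
  by apply/funext => w; rewrite set_itv1 Rintegral_set1.
apply: (@measurable_fun_cvg _ _ _ _ (fun n w => right_sum t (fun s => phi s (Y s w)) n)).
  move=> n; apply: measurable_sum => i.
  have /andP[r0 rt] := right_node_bounds i t0.
  apply: measurable_funM => //; apply: measurable_shear_profile => // j.
  by apply: mY; exact: ltW.
by move=> w _; have [] := path_integral nu_gt0 fL2 f0 t0 (cY w).
Qed.

Lemma shear_profile_translate s (x : 'rV[R]_3) c : phi s (x + c *: e1 R) = phi s x.
Proof. by apply: eq_shear_profile; rewrite /e1 !mxE /= mulr0 addr0. Qed.

(** The accumulated drift J is unchanged by translations along e_1. Hence the drift along X is that
    along [a + sig *: V], and subtracting noise and drift inverts the flow. *)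
Lemma stochastic_flow_exists : exists X A : R -> 'rV[R]_3 -> T -> 'rV[R]_3,
  stochastic_flow P nu W (shear_flow nu f) X /\ inverse_flow P X A.
Proof.
have [V [mV V0 cV VW]] := brownian_modification.
pose J t (a : 'rV[R]_3) w := \int[la]_(s in `[0, t]) phi s (a + sig *: V s w).
have JE t a w c : J t (a + c *: e1 R) w = J t a w.
  by apply: eq_Rintegral => s _; rewrite addrAC shear_profile_translate.
pose X t a w := a + (sig *: V t w + J t a w *: e1 R).
pose A t x w := x - (sig *: V t w + J t (x - sig *: V t w) w *: e1 R).
have cVa a w : {within `[0, +oo[, continuous (fun s => a + sig *: V s w)}.
  by move=> s; apply: cvgD; [exact: cvg_cst|apply: cvgZl_tmp; exact: cV].
have XE t a w i : X t a w 0 i = a 0 i + (sig * V t w 0 i + J t a w * (i == 0)%:R).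
  by rewrite /X /e1 !mxE.
have AE t x w i : A t x w 0 i =
    x 0 i - (sig * V t w 0 i + J t (x - sig *: V t w) w * (i == 0)%:R).
  by rewrite /A /e1 !mxE.
have uX s a w i : shear_flow nu f s (X s a w) 0 i =
    if i == 0 then phi s (a + sig *: V s w) else 0.
  by rewrite shear_flow_entry /X addrA shear_profile_translate.
exists X, A; split; split.
- move=> t a i t0; under eq_fun do rewrite XE.
  apply: measurable_funD => //; apply: measurable_funD.
    by apply: measurable_funM => //; exact: mV.
  apply: measurable_funM => //; apply: measurable_path_integral => // s j s0.
  under eq_fun do rewrite !mxE.
  by apply: measurable_funD => //; apply: measurable_funM => //; exact: mV.
- apply: filterS VW => w Vw a; split.
    by rewrite /X V0 scaler0 add0r /J set_itv1 Rintegral_set1 scale0r addr0.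
  move=> t i t0.
  have gi : la.-integrable `[0, t] (fun s => (phi s (a + sig *: V s w))%:E).
    move: t0; rewrite le_eqVlt => /predU1P[<-|t0]; last first.
      by have [] := path_integral nu_gt0 fL2 f0 t0 (cVa a w).
    rewrite set_itv1; apply/integrableP; split; first exact: measurable_fun_set1.
    by rewrite integral_set1.
  have -> : (fun s => (shear_flow nu f s (X s a w) 0 i)%:E) =
      (fun s => (if i == 0 then phi s (a + sig *: V s w) else 0)%:E).
    by apply/funext => s; rewrite uX.
  under eq_Rintegral do rewrite uX.
  rewrite XE Vw; have [_|_] := eqVneq i 0.
    by split => //; rewrite mulr1 -/(J t a w); ring.
  split; first exact: integrable0.
  by rewrite Rintegral_cst//= mul0r mulr0 !addr0.
- move=> t x i t0; under eq_fun do rewrite AE.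
  apply: measurable_funB => //; apply: measurable_funD.
    by apply: measurable_funM => //; exact: mV.
  apply: measurable_funM => //; apply: measurable_path_integral => // s j s0.
  under eq_fun do rewrite !mxE.
  apply: measurable_funD; last by apply: measurable_funM => //; exact: mV.
  by apply: measurable_funB => //; apply: measurable_funM => //; exact: mV.
- apply: nearW => w t t0; split=> y; rewrite /A /X.
    set c := J t y w.
    have -> : y + (sig *: V t w + c *: e1 R) - sig *: V t w = y + c *: e1 R.
      by rewrite [sig *: _ + _]addrC addrA addrK.
    by rewrite JE -/c addrK.
  set c := J t (y - _) w.
  have -> : J t (y - (sig *: V t w + c *: e1 R)) w = c.
    by rewrite opprD addrA -[- (c *: _)]scaleNr JE.
  by rewrite subrK.
Qed.

End Existence.
Theorem proposition5p2 (R : realType) :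
  exists C : R -> R,
  forall (nu : R) (f0 : R * R -> R),
    0 < nu ->
    periodic2 f0 ->
    f0 \in Lfun (torus2_measure R) 2%:E ->
    \int[torus2_measure R]_y f0 y = 0 ->
    [/\ smooth_navier_stokes nu (shear_flow nu f0),
        forall (t : R) x, 0 < t ->
          advection (shear_flow nu f0 t) (shear_flow nu f0 t) x = 0 &
        forall (d : measure_display) (T : measurableType d)
               (P : probability T R) (W : R -> T -> 'rV[R]_3),
          brownian_motion P W ->
          (exists X A : R -> 'rV[R]_3 -> T -> 'rV[R]_3,
             stochastic_flow P nu W (shear_flow nu f0) X /\
             inverse_flow P X A) /\
          forall X A : R -> 'rV[R]_3 -> T -> 'rV[R]_3,
            stochastic_flow P nu W (shear_flow nu f0) X ->
            inverse_flow P X A ->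
            [/\ forall (t : R) x i, 0 <= t ->
                  P.-integrable [set: T] (EFin \o displacement A t x i),
                forall (t : R) x, 0 <= t ->
                  mean_displacement P A t x = - t *: shear_flow nu f0 t x,
                forall (t : R) x, 0 <= t ->
                  mean_deformation P A t x =
                  1%:M - t *: tensor (e1 R)
                                (grad_perp (shear_profile nu f0 t) x) &
                forall alpha tau : R, 0 < alpha -> alpha < 1 -> 0 < tau ->
                  (ereal_sup [set holder_norm alpha
                                    (fun x => (mean_deformation P A t x - 1%:M)%R)
                             | t in [set t : R | (tau <= t)%R]]
                   <= (C alpha * nu `^ (- 1 - alpha / 2)
                       * tau `^ (- (alpha / 2)) * L2_norm2 f0)%:E)%E]].
Proof.
(* The first summand comes from the sup norm in [gradient_bound], the second from the seminorm in
   [gradient_holder]. *)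
exists (fun=> 68 * pi + 544 * pi ^+ 2) => nu f0 nu_gt0 _ fL2 f0_mean.
split.
- exact: shear_flow_navier_stokes.
- by move=> t x t0; exact: advection_shear_flow.
move=> d T P W BM; split; first exact: stochastic_flow_exists.
move=> X A flowX flowA; split.
- by move=> t x i t0; have [] := displacement_mean BM nu_gt0 fL2 f0_mean flowX flowA x i t0.
- by move=> t x t0; rewrite (mean_displacementE BM nu_gt0 fL2 f0_mean flowX flowA).
- by move=> t x t0; exact: (mean_deformationE BM nu_gt0 fL2 f0_mean flowX flowA).
move=> al tau al0 al1 tau0; apply: ge_ereal_sup => _ [t /= taut <-].
exact: (mean_deformation_holder BM nu_gt0 fL2 f0_mean flowX flowA).
Qed.
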